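(* Let $d\ge 2$, $\mu_0\in\mathcal{S}^{d-1}$ and $\kappa_0>0$, and let $X_1,X_2,\ldots$ be i.i.d. random vectors with the von Mises-Fisher distribution $vMF(\mu_0,\kappa_0)$ on $\mathcal{S}^{d-1}$. Let $$\hat\kappa_n^{\mathrm{ST}}=\frac{(d-1)\,\hat\mu_n^\top(I_d-\overline{XX^\top})\overline{X}}{\hat\mu_n^\top(I_d-\overline{XX^\top})^2\hat\mu_n},\qquad \hat\mu_n=\frac{\overline{X}}{\Vert\overline{X}\Vert},$$ where $\overline{X}=n^{-1}\sum_{i=1}^nX_i$ and $\overline{XX^\top}=n^{-1}\sum_{i=1}^nX_iX_i^\top$. Then $\hat\kappa_n^{\mathrm{ST}}$ is asymptotically normal: as $n\to\infty$, $$\sqrt{n}\,\big(\hat\kappa_n^{\mathrm{ST}}-\kappa_0\big)\overset{D}{\longrightarrow}N(0,P),$$ where $$P=\frac{\kappa_0\,\mathcal{I}_{d/2-1}(\kappa_0)\big(2\kappa_0\,\mathcal{I}_{d/2-1}(\kappa_0)-(d+1)\,\mathcal{I}_{d/2}(\kappa_0)\big)}{(d-1)\,\mathcal{I}_{d/2}(\kappa_0)^2}.$$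
   Context: $\mathcal{S}^{d-1}=\{x\in\mathbb{R}^d:x^\top x=1\}$. For $\mu\in\mathcal{S}^{d-1}$ and $\kappa>0$, the von Mises-Fisher distribution $vMF(\mu,\kappa)$ has density $$p_\theta(x)=\frac{\kappa^{d/2-1}}{(2\pi)^{d/2}\,\mathcal{I}_{d/2-1}(\kappa)}\exp(\kappa\mu^\top x),\quad x\in\mathcal{S}^{d-1},$$ with respect to the surface area measure on $\mathcal{S}^{d-1}$. Here $\mathcal{I}_\nu(\cdot)$ denotes the modified Bessel function of the first kind of order $\nu$, $I_d$ is the $d\times d$ identity matrix, $\Vert\cdot\Vert$ is the Euclidean norm, and $\overset{D}{\longrightarrow}$ denotes convergence in distribution. $N(0,P)$ is the normal distribution with mean $0$ and variance $P$. *)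

(* Defs.v *)
From HB Require Import structures.
From mathcomp Require Import all_boot all_order all_algebra finmap.
From mathcomp Require Import all_classical all_reals all_analysis.
From mathcomp Require Import measurable_realfun.

Set Implicit Arguments.
Unset Strict Implicit.
Unset Printing Implicit Defensive.

Import Order.TTheory GRing.Theory Num.Def Num.Theory.
Import numFieldTopology.Exports numFieldNormedType.Exports.

Local Open Scope classical_set_scope.
Local Open Scope ring_scope.

(* Points of R^d are [d.-tuple R], which carries the product sigma-algebra of
   the library; [tcol] gives the column vector used in matrix expressions. *)
Section euclidean.
Context {R : realType}.

Definition tcol d (x : d.-tuple R) : 'cV[R]_d := \col_i tnth x i.

Definition dotv d (u v : 'cV[R]_d) : R := (u^T *m v) 0 0.

(* The library norm on matrices is the sup norm. *)
Definition enorm d (u : 'cV[R]_d) : R := Num.sqrt (dotv u u).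

Definition sphere d : set (d.-tuple R) := [set x | dotv (tcol x) (tcol x) = 1].

(* y |-> y / ||y|| (with value 0 at 0). *)
Definition normalize d (y : d.-tuple R) : d.-tuple R :=
  [tuple tnth y i / enorm (tcol y) | i < d].

End euclidean.
Arguments sphere {R} d.

Section measurability.
Context {R : realType}.

Lemma measurable_fun_inv dT (T : measurableType dT) (f : T -> R) :
  measurable_fun setT f -> measurable_fun setT (fun x => (f x)^-1).
Proof.
move=> mf.
rewrite (_ : (fun _ => _) = fun x => f x * ((f x ^+ 2) `^ (-1))).
  apply: measurable_funM => //.
  apply: (@measurableT_comp _ _ _ _ _ _ (@powR R ^~ (-1)) _
    (fun x => f x ^+ 2)); first exact: measurable_powR.
  exact: measurable_funX.
apply/funext => x; rewrite powR_inv1 ?sqr_ge0//.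
have [->|f0] := eqVneq (f x) 0; first by rewrite mul0r invr0.
by rewrite expr2 invfM mulrA mulfV// mul1r.
Qed.

Definition mxmeasurable dT (T : measurableType dT) m n (A : T -> 'M[R]_(m, n)) :=
  forall i j, measurable_fun setT (fun w => A w i j).

Section matrix.
Context dT (T : measurableType dT).

Lemma mxmeasurable_mul m n p (A : T -> 'M[R]_(m, n)) (B : T -> 'M[R]_(n, p)) :
  mxmeasurable A -> mxmeasurable B -> mxmeasurable (fun w => A w *m B w).
Proof.
move=> mA mB i j; under eq_fun do rewrite mxE.
by apply: measurable_sum => k; apply: measurable_funM.
Qed.

Lemma mxmeasurable_tr m n (A : T -> 'M[R]_(m, n)) :
  mxmeasurable A -> mxmeasurable (fun w => (A w)^T).
Proof. by move=> mA i j; under eq_fun do rewrite mxE; exact: mA. Qed.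

Lemma mxmeasurable_scale m n (a : T -> R) (A : T -> 'M[R]_(m, n)) :
  measurable_fun setT a -> mxmeasurable A -> mxmeasurable (fun w => a w *: A w).
Proof.
by move=> ma mA i j; under eq_fun do rewrite mxE; apply: measurable_funM.
Qed.

Lemma mxmeasurable_sub m n (A B : T -> 'M[R]_(m, n)) :
  mxmeasurable A -> mxmeasurable B -> mxmeasurable (fun w => A w - B w).
Proof.
by move=> mA mB i j; under eq_fun do rewrite !mxE; apply: measurable_funB.
Qed.

Lemma mxmeasurable_sum m n k (A : 'I_k -> T -> 'M[R]_(m, n)) :
  (forall l, mxmeasurable (A l)) -> mxmeasurable (fun w => \sum_l A l w).
Proof.
move=> mA i j; under eq_fun do rewrite summxE.
by apply: measurable_sum => l; exact: mA.
Qed.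

Lemma mxmeasurable_tcol d (f : T -> d.-tuple R) :
  measurable_fun setT f -> mxmeasurable (fun w => tcol (f w)).
Proof.
move=> mf i j; under eq_fun do rewrite mxE.
exact: (measurableT_comp (measurable_tnth i) mf).
Qed.

Lemma measurable_dotv d (u v : T -> 'cV[R]_d) :
  mxmeasurable u -> mxmeasurable v ->
  measurable_fun setT (fun w => dotv (u w) (v w)).
Proof.
by move=> mu mv; apply: mxmeasurable_mul => //; exact: mxmeasurable_tr.
Qed.

Lemma measurable_enorm d (u : T -> 'cV[R]_d) :
  mxmeasurable u -> measurable_fun setT (fun w => enorm (u w)).
Proof.
move=> mu; apply: (@measurableT_comp _ _ _ _ _ _ (@Num.sqrt R)) => //.
  by apply: continuous_measurable_fun; exact: sqrt_continuous.
exact: measurable_dotv.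
Qed.

End matrix.

Lemma measurable_normalize d : measurable_fun setT (@normalize R d).
Proof.
apply/measurable_fun_tnthP => i; rewrite /comp.
under eq_fun do rewrite tnth_mktuple.
apply: measurable_funM; first exact: measurable_tnth.
apply: measurable_fun_inv; apply: measurable_enorm.
exact: mxmeasurable_tcol.
Qed.

End measurability.

(* d-dimensional Lebesgue measure, as an iterated product measure. *)
Section lebesgue_tuple.
Context {R : realType}.

Definition tcons n (p : R * n.-tuple R) : n.+1.-tuple R :=
  [the n.+1.-tuple R of p.1 :: p.2].

Lemma measurable_tcons n : measurable_fun setT (@tcons n).
Proof. exact: measurable_cons. Qed.


Section cons_measure.
Variables (n : nat) (m : {sigma_finite_measure set (n.-tuple R) -> \bar R}).

Definition cons_measure : set (n.+1.-tuple R) -> \bar R :=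
  pushforward (@lebesgue_measure R \x m)%E (@tcons n).

Let cons_measure0 : cons_measure set0 = 0%E.
Proof. by rewrite /cons_measure /pushforward preimage_set0 measure0. Qed.

Let cons_measure_ge0 A : (0 <= cons_measure A)%E.
Proof. by rewrite /cons_measure /pushforward measure_ge0. Qed.

Let cons_measure_sigma_additive : semi_sigma_additive cons_measure.
Proof.
move=> F mF tF mUF; rewrite /cons_measure /pushforward preimage_bigcup.
apply: measure_semi_sigma_additive.
- by move=> k; rewrite -[X in measurable X]setTI; exact: measurable_tcons.
- apply/trivIsetP => /= i j _ _ ij; rewrite -preimage_setI.
  by move/trivIsetP : tF => /(_ _ _ _ _ ij) ->//; rewrite preimage_set0.
- by rewrite -preimage_bigcup -[X in measurable X]setTI; exact: measurable_tcons.
Qed.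

HB.instance Definition _ := isMeasure.Build _ _ _ cons_measure
  cons_measure0 cons_measure_ge0 cons_measure_sigma_additive.

Let cons_measure_sigma_finite : sigma_finite setT cons_measure.
Proof.
have /sigma_finiteP[F [FT ndF Foo]] := sigma_finiteT (@lebesgue_measure R).
have /sigma_finiteP[G [GT ndG Goo]] := sigma_finiteT m.
have FGT : \bigcup_k (F k `*` G k) = setT.
  rewrite -setXTT FT GT predeqE => -[x y]; split.
    by move=> [k _ []/= ? ?]; split; exists k.
  move=> [/= [k _ Fkx] [l _ Gly]]; exists (maxn k l) => //; split.
  - by move: x Fkx; exact/subsetPset/ndF/leq_maxl.
  - by move: y Gly; exact/subsetPset/ndG/leq_maxr.
pose u (x : n.+1.-tuple R) : R * n.-tuple R :=
  (tnth x ord0, [tuple of behead x]).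
have mu : measurable_fun setT u.
  apply/measurable_fun_pair; first exact: measurable_tnth.
  exact: measurable_behead.
have uK p : u (tcons p) = p.
  by case: p => a t; rewrite /u /tcons; congr pair; exact: val_inj.
exists (fun k => u @^-1` (F k `*` G k)).
  by rewrite -preimage_bigcup FGT preimage_setT.
move=> k; have [mF mFoo] := Foo k; have [mG mGoo] := Goo k; split.
  by rewrite -[X in measurable X]setTI; apply: mu => //; exact: measurableX.
rewrite /cons_measure /pushforward -comp_preimage.
rewrite (_ : u \o _ = id) ?preimage_id; last exact/funext.
by rewrite product_measure1E// lte_mul_pinfty// ge0_fin_numE.
Qed.

HB.instance Definition _ := Measure_isSigmaFinite.Build _ _ _ cons_measure
  cons_measure_sigma_finite.

End cons_measure.

Fixpoint lebesgue_tuple n : {sigma_finite_measure set (n.-tuple R) -> \bar R} :=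
  if n is n'.+1 return {sigma_finite_measure set (n.-tuple R) -> \bar R}
  then cons_measure (lebesgue_tuple n')
  else @dirac _ _ [tuple] R.

End lebesgue_tuple.

(* The surface area of A is d times the Lebesgue measure of the cone over A
   in the closed unit ball (polar coordinates); as a measure on R^d it is
   concentrated on the sphere. *)
Section surface_area.
Context {R : realType} (d : nat).

Definition cone (A : set (d.-tuple R)) : set (d.-tuple R) :=
  [set y | 0 < enorm (tcol y) <= 1] `&` @normalize R d @^-1` A.

Definition surface_area (A : set (d.-tuple R)) : \bar R :=
  (d%:R%:E * lebesgue_tuple d (cone A))%E.

Lemma measurable_cone A : measurable A -> measurable (cone A).
Proof.
move=> mA; apply: measurableI; last first.
  by rewrite -[X in measurable X]setTI; exact: measurable_normalize.
have -> : [set y : d.-tuple R | 0 < enorm (tcol y) <= 1] =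
    setT `&` (fun y => enorm (tcol y)) @^-1` `]0, 1].
  by rewrite setTI; apply/seteqP; split=> y /=; rewrite in_itv.
by apply: measurable_enorm => //; exact: mxmeasurable_tcol.
Qed.

Let surface_area0 : surface_area set0 = 0%E.
Proof. by rewrite /surface_area /cone preimage_set0 setI0 measure0 mule0. Qed.

Let surface_area_ge0 A : (0 <= surface_area A)%E.
Proof. by rewrite /surface_area mule_ge0// lee_fin. Qed.

Let surface_area_sigma_additive : semi_sigma_additive surface_area.
Proof.
move=> F mF tF mUF.
have := @measure_semi_sigma_additive _ _ _
  (mscale (d%:R : R)%:nng (lebesgue_tuple d)) (fun k => cone (F k)).
rewrite -setI_bigcupr -preimage_bigcup; apply.
- by move=> k; exact: measurable_cone.
- apply/trivIsetP => i j _ _ ij; rewrite -subset0 => y [[_ Fi] [_ Fj]].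
  move/trivIsetP : tF => /(_ i j I I ij) FiFj.
  by have : (F i `&` F j) (normalize y) by []; rewrite FiFj.
- exact: measurable_cone.
Qed.

HB.instance Definition _ := isMeasure.Build _ _ _ surface_area
  surface_area0 surface_area_ge0 surface_area_sigma_additive.

End surface_area.
Arguments surface_area {R} d.

Section von_mises_fisher.
Context {R : realType}.

(* Used for 0 < s, where the integral converges. *)
Definition Gamma (s : R) : R :=
  \int[lebesgue_measure]_(t in `]0, +oo[) (t `^ (s - 1) * expR (- t)).

(* Used for 0 <= nu and 0 < x. *)
Definition besselI (nu x : R) : R :=
  limn (series (fun k : nat =>
    (x / 2) `^ (k.*2%:R + nu) / (k`!%:R * Gamma (k%:R + nu + 1)))).

Definition vmf_pdf d (mu : d.-tuple R) (kappa : R) (x : d.-tuple R) : R :=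
  kappa `^ (d%:R / 2 - 1)
    / ((2 * pi) `^ (d%:R / 2) * besselI (d%:R / 2 - 1) kappa)
  * expR (kappa * dotv (tcol mu) (tcol x)).

Definition vmf d (mu : d.-tuple R) (kappa : R) (A : set (d.-tuple R)) : \bar R :=
  (\int[surface_area d]_(x in A) (vmf_pdf mu kappa x)%:E)%E.

End von_mises_fisher.

Section random_variables.
Context dT (T : measurableType dT) (R : realType) (P : probability T R).

Definition mutually_independent (I : choiceType) d' (T' : measurableType d')
    (X : I -> {RV P >-> T'}) :=
  forall (J : {fset I}) (A : I -> set T'), (forall i, measurable (A i)) ->
    P (\bigcap_(i in [set` J]) (X i @^-1` A i)) =
    (\prod_(i <- J) P (X i @^-1` A i))%E.

Definition cvg_in_distribution (Y : nat -> {RV P >-> R})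
    (nu : probability (measurableTypeR R) R) :=
  forall x : R, {for x, continuous (fun y : R => nu `]-oo, y]%classic)} ->
    cdf (Y n) x @[n --> \oo] --> nu `]-oo, x]%classic.

End random_variables.

(* In the estimators below x 0, ..., x (n - 1) are the n observations; a
   division by zero gives 0. *)
Section estimators.
Context {R : realType} (d : nat).
Implicit Types x : nat -> d.-tuple R.

Definition sample_mean n x : 'cV[R]_d :=
  n%:R^-1 *: \sum_(i < n) tcol (x i).

Definition sample_moment2 n x : 'M[R]_d :=
  n%:R^-1 *: \sum_(i < n) (tcol (x i) *m (tcol (x i))^T).

Definition mu_hat n x : 'cV[R]_d :=
  (enorm (sample_mean n x))^-1 *: sample_mean n x.

Definition kappa_ST n x : R :=
  let M := 1%:M - sample_moment2 n x in
  ((d%:R - 1) * ((mu_hat n x)^T *m M *m sample_mean n x) 0 0)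
  / ((mu_hat n x)^T *m (M *m M) *m mu_hat n x) 0 0.

Context dT (T : measurableType dT) (P : probability T R).
Variable X : nat -> {RV P >-> d.-tuple R}.

Let mX i : mxmeasurable (fun w => tcol (X i w)).
Proof. exact: mxmeasurable_tcol. Qed.

Lemma mxmeasurable_sample_mean n :
  mxmeasurable (fun w => sample_mean n (X ^~ w)).
Proof. by apply: mxmeasurable_scale => //; apply: mxmeasurable_sum => i. Qed.

Lemma mxmeasurable_sample_moment2 n :
  mxmeasurable (fun w => sample_moment2 n (X ^~ w)).
Proof.
apply: mxmeasurable_scale => //; apply: mxmeasurable_sum => i.
by apply: mxmeasurable_mul => //; exact: mxmeasurable_tr.
Qed.

Lemma mxmeasurable_mu_hat n : mxmeasurable (fun w => mu_hat n (X ^~ w)).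
Proof.
apply: mxmeasurable_scale; last exact: mxmeasurable_sample_mean.
by apply: measurable_fun_inv; apply: measurable_enorm;
  exact: mxmeasurable_sample_mean.
Qed.

Lemma measurable_kappa_ST n :
  measurable_fun setT (fun w => kappa_ST n (X ^~ w)).
Proof.
have mM : mxmeasurable (fun w => 1%:M - sample_moment2 n (X ^~ w)).
  by apply: mxmeasurable_sub; [move=> i j|exact: mxmeasurable_sample_moment2].
have mmu := mxmeasurable_mu_hat n.
have mmuT := mxmeasurable_tr mmu.
apply: measurable_funM.
  apply: measurable_funM => //.
  apply: (mxmeasurable_mul (mxmeasurable_mul mmuT mM)).
  exact: mxmeasurable_sample_mean.
apply: measurable_fun_inv.
exact: (mxmeasurable_mul (mxmeasurable_mul mmuT (mxmeasurable_mul mM mM)) mmu).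
Qed.

Definition kappa_ST_error (kappa : R) n (w : T) : R :=
  Num.sqrt n%:R * (kappa_ST n (X ^~ w) - kappa).

Let measurable_kappa_ST_error kappa n :
  measurable_fun setT (kappa_ST_error kappa n).
Proof.
apply: measurable_funM => //; apply: measurable_funB => //.
exact: measurable_kappa_ST.
Qed.

HB.instance Definition _ kappa n := isMeasurableFun.Build _ _ _ _
  (kappa_ST_error kappa n) (measurable_kappa_ST_error kappa n).

End estimators.

(* Main.v *)
(* Let t = mu0 . x, k = kappa0, A = E t and m = E (1 - t^2). Integration by parts
   on the sphere (Stein's identity, obtained from the ball by polar coordinates)
   gives E [(1 - t^2) g'(t) - (d - 1) t g(t) + k (1 - t^2) g(t)] = 0; for g = 1, t, t^2
   it yields (d - 1) A = k m and, for the score s(x) = k (1 - t^2) - (d - 1) t,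
   E s = 0 and Var s = 2 (d - 1) - (d + 1) m. Expanding the exponential turns A into
   the ratio of Bessel functions I_{d/2} / I_{d/2 - 1}.
   The matrix M0 = I - E (x x^T) satisfies M0 mu0 = m mu0, so to first order the
   error of the estimator is the mean of -s(X_i) / m, up to a term quadratic in the
   deviations of the first two sample moments, which Markov's inequality shows to
   be o(n^(-1/2)) in probability. The central limit theorem for this mean is
   Lindeberg's replacement argument with the functions heat a t, i.e. Gaussian
   distribution functions evolved by the heat equation, and P = Var s / m^2. *)
Require Import Defs.
From HB Require Import structures.
From mathcomp Require Import all_boot all_order all_algebra finmap.
From mathcomp Require Import all_classical all_reals all_analysis.
From mathcomp Require Import measurable_realfun.
From mathcomp Require Import ring lra.

Set Implicit Arguments.
Unset Strict Implicit.
Unset Printing Implicit Defensive.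

Import Order.TTheory GRing.Theory Num.Def Num.Theory.
Import numFieldTopology.Exports numFieldNormedType.Exports.

Local Open Scope classical_set_scope.
Local Open Scope ring_scope.

(** Since [surface_area] is defined through cones, every surface integral is an integral over the
    ball. Stein's identity is proved there for the field (1 - |y|^2) (v.y)^k u, whose weight kills
    the boundary term, so that Fubini's theorem and the one-variable fundamental theorem of calculus
    suffice. Only polynomials are integrated by parts; exponential moments are obtained by summing
    series. Of Gamma only the recursion is used: the nonvanishing of Gamma and Bessel values is
    forced by total mass 1 and by 0 < m. Two obstacles shape the limit theorem. Its test functions
    must be bounded everywhere, while polynomials are bounded only on the sphere, which carries the
    law; they are cut off outside it. And indicators are not smooth: [heat a t] smooths the
    indicator of ]-oo, a], with derivatives bounded uniformly for t >= t0, and replacing one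
    observation by a Gaussian increment is then a mere advance of time. The smoothing and the
    remainder of the expansion are removed together, by moving the threshold by 2 dl at time t =
    dl^4. *)

Section real_derivatives.
Context {R : realType}.
Implicit Types (f g : R -> R) (x a b : R).

(** Separates differentiation from algebra: [a] may be an existential variable filled by the
    differentiation rules, which leaves one identity to check. *)
Lemma is_derive_change f x a b : is_derive x 1 f a -> a = b -> is_derive x 1 f b.
Proof. by move=> df <-. Qed.

Lemma is_derive_fD f g x a b : is_derive x 1 f a -> is_derive x 1 g b ->
  is_derive x 1 (fun y => f y + g y) (a + b).
Proof. by move=> df dg; exact: is_deriveD. Qed.

Lemma is_derive_fB f g x a b : is_derive x 1 f a -> is_derive x 1 g b ->
  is_derive x 1 (fun y => f y - g y) (a - b).
Proof. by move=> df dg; exact: is_deriveB. Qed.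

Lemma is_derive_fN f x a : is_derive x 1 f a ->
  is_derive x 1 (fun y => - f y) (- a).
Proof. by move=> df; exact: is_deriveN. Qed.

Lemma is_derive_fM f g x a b : is_derive x 1 f a -> is_derive x 1 g b ->
  is_derive x 1 (fun y => f y * g y) (a * g x + f x * b).
Proof.
move=> df dg; apply: (is_derive_eq (is_deriveM df dg)).
by rewrite addrC /GRing.scale/= (mulrC a).
Qed.

Lemma is_derive_fX f x a n : is_derive x 1 f a ->
  is_derive x 1 (fun y => f y ^+ n) (n%:R * f x ^+ n.-1 * a).
Proof.
move=> df; elim: n => [|n ih].
  by rewrite !mul0r; under eq_fun do rewrite expr0; exact: is_derive_cst.
have := is_derive_fM df ih; under eq_fun do rewrite -exprS.
move=> h; apply: (is_derive_eq h); rewrite -[in RHS]natr1.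
case: n {ih h} => [|n]/=; first by rewrite !mul0r mulr0 !expr0 add0r !mul1r addr0 mulr1.
by rewrite exprS; ring.
Qed.

Lemma is_derive_fcomp f g x a b : is_derive (g x) 1 f a -> is_derive x 1 g b ->
  is_derive x 1 (fun y => f (g y)) (a * b).
Proof.
move=> df dg; have := @is_derive1_comp _ f g x a b df dg.
by [].
Qed.

Lemma is_derive_fcst x a : is_derive x 1 (fun=> a : R) 0.
Proof. exact: is_derive_cst. Qed.

Lemma is_derive_fid x : is_derive x 1 (fun y : R => y) 1.
Proof. exact: is_derive_id. Qed.

Lemma is_derive_fexp f x a : is_derive x 1 f a ->
  is_derive x 1 (fun y => expR (f y)) (expR (f x) * a).
Proof. by move=> df; apply: is_derive_fcomp; exact: is_derive_expR. Qed.

Lemma is_derive_continuous f x a : is_derive x 1 f a -> {for x, continuous f}.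
Proof.
move=> [df _]; apply: differentiable_continuous; exact/derivable1_diffP.
Qed.

Lemma is_derive_FTC2 f F a b : a < b ->
  (forall x, is_derive x 1 F (f x)) -> continuous f ->
  (\int[lebesgue_measure]_(x in `[a, b]) (f x)%:E = (F b - F a)%:E)%E.
Proof.
move=> ab dF cf; rewrite EFinB (@continuous_FTC2 _ f F)//.
- exact: continuous_subspaceT.
- split.
  + by move=> x _; have [] := dF x.
  + by apply: cvg_at_right_filter; exact: is_derive_continuous (dF a).
  + by apply: cvg_at_left_filter; exact: is_derive_continuous (dF b).
- by move=> x _; rewrite derive1E; have [_ ->] := dF x.
Qed.

Lemma is_derive_FTC2_le f F a b : a <= b ->
  (forall x, is_derive x 1 F (f x)) -> continuous f ->
  (\int[lebesgue_measure]_(x in `[a, b]) (f x)%:E = (F b - F a)%:E)%E.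
Proof.
rewrite le_eqVlt => /predU1P[<- _ _|]; last exact: is_derive_FTC2.
by rewrite set_itv1 integral_set1 subrr.
Qed.

End real_derivatives.

(** Builds the derivative by recursion on the expression. Differences and quotients by constants are
    covered, being sums with an opposite and products. [notypeclasses refine] keeps the premises as
    goals, since [is_derive] is a class. *)
Ltac derive_rules := repeat lazymatch goal with
  | |- is_derive _ _ (fun y => (@?f y + @?g y)%R) _ => notypeclasses refine (is_derive_fD (f := f) (g := g) _ _)
  | |- is_derive _ _ (fun y => (- @?f y)%R) _ => notypeclasses refine (is_derive_fN (f := f) _)
  | |- is_derive _ _ (fun y => (@?f y * @?g y)%R) _ => notypeclasses refine (is_derive_fM (f := f) (g := g) _ _)
  | |- is_derive _ _ (fun y => (@?f y ^+ _)%R) _ => notypeclasses refine (is_derive_fX (f := f) _ _)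
  | |- is_derive _ _ (fun y => expR (@?f y)) _ => notypeclasses refine (is_derive_fexp (f := f) _)
  | |- is_derive _ _ (fun y => y) _ => exact (is_derive_fid _)
  | |- is_derive _ _ (fun y => _) _ => exact (is_derive_fcst _ _)
  end.

Section power_integral.
Context {R : realType}.

Lemma integral_pow (a b : R) m : a <= b ->
  (\int[lebesgue_measure]_(r in `[a, b]) (m.+1%:R * r ^+ m)%:E =
   (b ^+ m.+1 - a ^+ m.+1)%:E)%E.
Proof.
pose f (r : R) : R := m.+1%:R * r ^+ m.
have dF (x : R) : is_derive x 1 (fun r : R => r ^+ m.+1) (f x).
  notypeclasses refine (is_derive_change _ _); first by derive_rules.
  by rewrite mulr1.
move=> ab; apply: (is_derive_FTC2_le ab dF) => x.
suff [c df] : exists c, is_derive x 1 f c by exact: is_derive_continuous df.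
by rewrite /f; eexists; derive_rules.
Qed.

End power_integral.

(** * Lebesgue measure on tuples *)

Section tuple_dot.
Context {R : realType}.

Definition tdot n (u v : n.-tuple R) : R := \sum_(i < n) tnth u i * tnth v i.

Lemma dotv_tcol n (u v : n.-tuple R) : dotv (tcol u) (tcol v) = tdot u v.
Proof. by rewrite /dotv !mxE; apply: eq_bigr => i _; rewrite !mxE. Qed.

Lemma tdot0 (u v : 0.-tuple R) : tdot u v = 0.
Proof. by rewrite /tdot big_ord0. Qed.

Lemma tdot_tcons n (p q : R * n.-tuple R) :
  tdot (tcons p) (tcons q) = p.1 * q.1 + tdot p.2 q.2.
Proof.
rewrite /tdot big_ord_recl; congr (_ * _ + _).
by apply: eq_bigr => i _; rewrite !tnthS.
Qed.

Lemma tcons_eta n (u : n.+1.-tuple R) : u = tcons (thead u, behead_tuple u).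
Proof. by rewrite [LHS]tuple_eta; exact: val_inj. Qed.

Lemma tdotC n (u v : n.-tuple R) : tdot u v = tdot v u.
Proof. by apply: eq_bigr => i _; rewrite mulrC. Qed.

Lemma tdot_ge0 n (u : n.-tuple R) : 0 <= tdot u u.
Proof. by apply: sumr_ge0 => i _; exact: sqr_ge0. Qed.

Lemma tdot_ge_sqr n (u : n.-tuple R) i : tnth u i ^+ 2 <= tdot u u.
Proof.
rewrite /tdot (bigD1 i)//= -expr2 lerDl.
by apply: sumr_ge0 => j _; exact: sqr_ge0.
Qed.

Lemma measurable_tdot n (u : n.-tuple R) : measurable_fun setT (tdot u).
Proof.
apply: measurable_sum => i; apply: measurable_funM => //.
exact: measurable_tnth.
Qed.

Lemma measurable_tdot_sqr n :
  measurable_fun setT (fun y : n.-tuple R => tdot y y).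
Proof.
by apply: measurable_sum => i; apply: measurable_funM; exact: measurable_tnth.
Qed.

Definition tscale n (r : R) (y : n.-tuple R) : n.-tuple R :=
  [tuple r * tnth y i | i < n].

Lemma tscale_tcons n r (p : R * n.-tuple R) :
  tscale r (tcons p) = tcons (r * p.1, tscale r p.2).
Proof.
apply: eq_from_tnth => i; rewrite tnth_mktuple.
case: (unliftP ord0 i) => [j ->|->]; last by [].
by rewrite !tnthS tnth_mktuple.
Qed.

Lemma tdot_tscaler n r (u y : n.-tuple R) : tdot u (tscale r y) = r * tdot u y.
Proof.
by rewrite /tdot mulr_sumr; apply: eq_bigr => i _; rewrite tnth_mktuple mulrCA.
Qed.

Lemma measurable_tscale n r : measurable_fun setT (@tscale n r).
Proof.
apply/measurable_fun_tnthP => i; rewrite /comp.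
under eq_fun do rewrite tnth_mktuple.
by apply: measurable_funM => //; exact: measurable_tnth.
Qed.

End tuple_dot.

Section tuple_integral.
Context {R : realType}.
Local Notation leb := (@lebesgue_measure R).
Local Open Scope ereal_scope.

Lemma ge0_integral_tcons n (f : n.+1.-tuple R -> \bar R) :
  measurable_fun setT f -> (forall y, 0 <= f y) ->
  \int[lebesgue_tuple n.+1]_y f y =
  \int[leb]_x \int[lebesgue_tuple n]_y f (tcons (x, y)).
Proof.
move=> mf f0; rewrite [LHS](_ : _ =
  \int[pushforward (leb \x lebesgue_tuple n) (@tcons R n)]_y f y)//.
rewrite ge0_integral_pushforward//; last exact: measurable_tcons.
rewrite preimage_setT fubini_tonelli1//; last by move=> p; exact: f0.
by apply: measurableT_comp => //; exact: measurable_tcons.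
Qed.

Lemma integral_tcons n (f : n.+1.-tuple R -> \bar R) :
  measurable_fun setT f ->
  (leb \x lebesgue_tuple n).-integrable setT (f \o @tcons R n) ->
  \int[lebesgue_tuple n.+1]_y f y =
  \int[leb \x lebesgue_tuple n]_p f (tcons p).
Proof.
move=> mf intf; rewrite [LHS](_ : _ =
  \int[pushforward (leb \x lebesgue_tuple n) (@tcons R n)]_y f y)//.
by rewrite integral_pushforward//; exact: measurable_tcons.
Qed.

(** [r] times the image of Lebesgue measure under multiplication by [r] agrees with Lebesgue measure
    on half-open intervals, hence everywhere. *)
Lemma ge0_integral_leb_scale (f : R -> \bar R) (r : R) :
  (0 < r)%R -> measurable_fun setT f -> (forall y, 0 <= f y) ->
  \int[leb]_x f (r * x)%R = r^-1%:E * \int[leb]_x f x.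
Proof.
move=> r0 mf f0.
have mM : measurable_fun setT (fun x : R => r * x : measurableTypeR R)%R.
  exact: mulrl_measurable.
pose phi : R -> measurableTypeR R := ( *%R r).
have mE A : measurable A -> leb A = mscale (NngNum (ltW r0)) (pushforward leb phi) A.
  move=> mA; apply: lebesgue_measure_unique => //= _ [[a b]] _ <-.
  rewrite /mscale/= /pushforward.
  rewrite (_ : _ @^-1` _ = `](a / r)%R, (b / r)%R]%classic); last first.
    apply/seteqP; split=> x /=; rewrite !in_itv/= ltr_pdivrMr// ler_pdivlMr//;
    by rewrite mulrC.
  rewrite !lebesgue_measure_itv/= !lte_fin ltr_pM2r ?invr_gt0//.
  case: ifPn => ab; last by rewrite mule0.
  by rewrite -!EFinB -EFinM -mulrBl mulrC divfK// gt_eqF.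
rewrite [in RHS](eq_measure_integral _ (fun A mA _ => mE mM A mA)).
rewrite ge0_integral_mscale//= ge0_integral_pushforward//.
by rewrite preimage_setT muleA -EFinM mulVf ?gt_eqF// mul1e.
Qed.

End tuple_integral.

Section tuple_integral_scale.
Context {R : realType}.
Local Notation leb := (@lebesgue_measure R).
Local Open Scope ereal_scope.

Lemma ge0_integral_tscale n (f : n.-tuple R -> \bar R) (r : R) :
  (0 < r)%R -> measurable_fun setT f -> (forall y, 0 <= f y) ->
  \int[lebesgue_tuple n]_y f (tscale r y) =
  (r^-1 ^+ n)%:E * \int[lebesgue_tuple n]_y f y.
Proof.
move=> r0; elim: n f => [|n ih] f mf f0.
  rewrite expr0 mul1e /=; apply: eq_integral => y _; congr f.
  by rewrite (tuple0 y) (tuple0 (tscale _ _)).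
have mtc := @measurable_tcons R n.
have mft : measurable_fun setT (f \o @tcons R n) by exact: measurableT_comp.
rewrite !ge0_integral_tcons//; last first.
  by apply: measurableT_comp => //; exact: measurable_tscale.
transitivity (\int[leb]_x ((r^-1 ^+ n)%:E *
    \int[lebesgue_tuple n]_y f (tcons ((r * x)%R, y)))).
  apply: eq_integral => x _.
  rewrite -(ih (fun y => f (tcons ((r * x)%R, y))))//; last first.
    exact: (measurableT_comp mft (pair1_measurable (r * x)%R)).
  by apply: eq_integral => y _; rewrite tscale_tcons.
have mF : measurable_fun setT (fun x : R =>
    \int[lebesgue_tuple n]_y f (tcons (x, y))).
  apply: (@measurable_fun_fubini_tonelli_F _ _ _ _ _ (lebesgue_tuple n)
    (f \o @tcons R n)) => //.
  by move=> p; exact: f0.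
have F0 (x : R) : 0 <= \int[lebesgue_tuple n]_y f (tcons (x, y)).
  by apply: integral_ge0 => y _; exact: f0.
have mFr : measurable_fun setT (fun x : R =>
    \int[lebesgue_tuple n]_y f (tcons ((r * x)%R, y))).
  exact: (measurableT_comp mF (mulrl_measurable r)).
have r0n : 0 <= (r^-1 ^+ n)%:E by rewrite lee_fin exprn_ge0// invr_ge0 ltW.
rewrite (ge0_integralZl leb measurableT mFr (fun x _ => F0 (r * x)%R) r0n).
rewrite (ge0_integral_leb_scale r0 (f := fun x =>
  \int[lebesgue_tuple n]_y f (tcons (x, y))))//.
by rewrite muleA -EFinM exprSr.
Qed.

End tuple_integral_scale.

(** * Integration by parts on balls *)

Section ball_stein.
Context {R : realType}.
Local Notation leb := (@lebesgue_measure R).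

Lemma integrable_bounded_support dT (T : measurableType dT)
    (mu : {measure set T -> \bar R}) (K : set T) (f : T -> R) (C : R) :
  measurable K -> (mu K < +oo)%E -> measurable_fun setT f ->
  (forall x, K x -> `|f x| <= C) -> (forall x, ~ K x -> f x = 0) ->
  mu.-integrable setT (EFin \o f).
Proof.
move=> mK Koo mf fC f0.
apply: (@le_integrable _ _ _ _ _ measurableT _ (EFin \o (fun x => C * \1_K x))).
- exact/measurable_EFinP.
- move=> x _ /=; rewrite lee_fin indicE.
  have [/set_mem xK|/negP xK] := boolP (x \in K).
    by rewrite mulr1 (le_trans (fC _ xK))// ler_norm.
  by rewrite f0 ?normr0// => /mem_set.
- under [X in _.-integrable _ X]eq_fun do rewrite /= EFinM.
  apply: integrableZl => //; apply/integrableP; split.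
    exact/measurable_EFinP/measurable_indic.
  under eq_integral do rewrite gee0_abs ?lee_fin//.
  by rewrite integral_indic// setIT.
Qed.

(** The divergence of the field (s - |y|^2) (a + v.y)^k u, with b = u.v, w = v.y, e = u.y and the
    factor s - |y|^2 renamed [s]. Free scalars in place of dot products let one formula serve in
    every dimension. *)
Definition ball_poly (b s a w e : R) k :=
  b *+ k * s * (a + w) ^+ k.-1 - 2 * e * (a + w) ^+ k.

Lemma ball_poly_bound (b s a w e S W E : R) k :
  `|s| <= S -> `|w| <= W -> `|e| <= E ->
  `|ball_poly b s a w e k| <=
    `|b| *+ k * S * (`|a| + W) ^+ k.-1 + 2 * E * (`|a| + W) ^+ k.
Proof.
move=> sS wW eE; have awW : `|a + w| <= `|a| + W.
  by rewrite (le_trans (ler_normD _ _))// lerD2l.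
rewrite (le_trans (ler_normB _ _))// !normrM !normrX normrMn normr_nat.
apply: lerD; apply: ler_pM => //.
- by rewrite ler_wpM2l// mulrn_wge0.
- by rewrite lerXn2r// nnegrE ?(le_trans _ awW).
- by rewrite ler_wpM2l.
- by rewrite lerXn2r// nnegrE ?(le_trans _ awW).
Qed.

(** The integrand is the derivative of u (s - x^2) (a + v x)^k, which vanishes at both ends of the
    interval x^2 <= s. For s = 0 the interval is the origin, where the integrand is 0; for s < 0 it
    is empty. *)
Lemma integral_ball_poly1 (b s a v u : R) k : b = u * v ->
  (\int[leb]_x (if x ^+ 2 <= s then
     ball_poly b (s - x ^+ 2) a (v * x) (u * x) k else 0)%:E = 0)%E.
Proof.
move=> ->.
have [s0|s0|s0] := ltrgt0P s; last 2 first.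
- apply: integral0_eq => x _; rewrite ifF//; apply/negbTE; rewrite -ltNge.
  by rewrite (lt_le_trans s0)// sqr_ge0.
- apply: integral0_eq => x _; case: ifPn => // /=; rewrite s0 => x0.
  have /eqP -> : x == 0 by rewrite -sqrf_eq0 eq_le x0 sqr_ge0.
  by rewrite /ball_poly expr0n subrr !(mulr0, mul0r) subrr.
pose r : R := Num.sqrt s; have r0 : 0 < r by rewrite sqrtr_gt0.
have rs : r ^+ 2 = s by rewrite sqr_sqrtr// ltW.
pose F (x : R) : R := u * (s - x ^+ 2) * (a + v * x) ^+ k.
pose f (x : R) : R := ball_poly (u * v) (s - x ^+ 2) a (v * x) (u * x) k.
transitivity (\int[leb]_(x in `[(- r)%R, r]) (f x)%:E)%E.
  rewrite [RHS]integral_mkcond; apply: eq_integral => x _.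
  have xr : (`|x| <= r) = (x ^+ 2 <= s).
    rewrite -rs -(ler_pXn2r (ltn0Sn 1) (normr_ge0 x) (ltW r0)).
    by rewrite real_normK ?num_real.
  by rewrite patchE mem_setE in_itv/= -ler_norml xr; case: ifPn.
have dF (x : R) : is_derive x 1 F (f x).
  rewrite /F; notypeclasses refine (is_derive_change _ _); first by derive_rules.
  by rewrite /f /ball_poly -(mulr_natr (u * v)) /=; ring.
have cf : continuous f.
  move=> x; suff [a' df] : exists a', is_derive x 1 f a' by exact: is_derive_continuous df.
  by rewrite /f /ball_poly; eexists; derive_rules.
rewrite (is_derive_FTC2 _ dF cf) ?(lt_trans _ r0) ?oppr_lt0//.
by rewrite /F sqrrN rs subrr mulr0 !mul0r subrr.
Qed.

Definition ball_stein_fun n (s a : R) (u v : n.-tuple R) k (y : n.-tuple R) : R :=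
  if tdot y y <= s then
    ball_poly (tdot u v) (s - tdot y y) a (tdot v y) (tdot u y) k
  else 0.

(** The divergence is the sum of its parts in two blocks of coordinates; for each block, the linear
    form of the other one is a constant and joins [a]. *)
Lemma ball_poly_split (b1 b2 s a w1 w2 e1 e2 : R) k :
  ball_poly (b1 + b2) s a (w1 + w2) (e1 + e2) k =
  ball_poly b1 s (a + w2) w1 e1 k + ball_poly b2 s (a + w1) w2 e2 k.
Proof.
rewrite /ball_poly !(mulrDr, mulrDl, mulrnDl) -!addrA.
rewrite (addrC w2 w1); ring.
Qed.

Lemma measurable_ball_poly dT (T : measurableType dT) (b a : R) (s w e : T -> R) k :
  measurable_fun setT s -> measurable_fun setT w -> measurable_fun setT e ->
  measurable_fun setT (fun x => ball_poly b (s x) a (w x) (e x) k).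
Proof.
move=> ms mw me; apply: measurable_funB; apply: measurable_funM.
- exact: measurable_funM.
- by apply: measurable_funX; exact: measurable_funD.
- exact: measurable_funM.
- by apply: measurable_funX; exact: measurable_funD.
Qed.

(** [1 + |s|] dominates the square root of [s] and spares a case distinction on the sign of [s]. *)
Lemma norm_le_sqr (s x : R) : x ^+ 2 <= s -> `|x| <= 1 + `|s|.
Proof.
move=> xs; rewrite -(@ler_pXn2r _ 2)// ?nnegrE ?addr_ge0//.
rewrite real_normK ?num_real//.
have := ler_norm s; have := normr_ge0 s; nra.
Qed.

Lemma tdot_le n (u y : n.-tuple R) c : (forall i, `|tnth y i| <= c) ->
  `|tdot u y| <= (\sum_(i < n) `|tnth u i|) * c.
Proof.
move=> yc; rewrite (le_trans (ler_norm_sum _ _ _))// mulr_suml.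
by apply: ler_sum => i _; rewrite normrM ler_wpM2l.
Qed.

Lemma tdot_le_ball n (u y : n.-tuple R) s : tdot y y <= s ->
  `|tdot u y| <= (\sum_(i < n) `|tnth u i|) * (1 + `|s|).
Proof.
move=> ys; apply: tdot_le => i; apply: norm_le_sqr.
by rewrite (le_trans _ ys)// tdot_ge_sqr.
Qed.

Lemma measurable_ball n (t : R) : measurable [set y : n.-tuple R | (tdot y y <= t)%R].
Proof.
rewrite (_ : [set _ | _] = setT `&` (fun y => tdot y y) @^-1` `]-oo, t]).
  by apply: measurable_tdot_sqr.
by rewrite setTI; apply/seteqP; split=> y /=; rewrite in_itv.
Qed.

(** By induction: the ball is contained in the product of a bounded interval and a ball of one
    dimension less. *)
Lemma lebesgue_tuple_ball_lty n (s : R) :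
  (lebesgue_tuple n [set y : n.-tuple R | (tdot y y <= s)%R] < +oo)%E.
Proof.
elim: n s => [|n ih] s; first by rewrite /= diracE ltry.
rewrite /= /cons_measure /pushforward.
pose c := 1 + `|s|.
have xc x : x ^+ 2 <= s -> `|x| <= c by exact: norm_le_sqr.
apply: (@le_lt_trans _ _ ((leb \x lebesgue_tuple n)%E
    (`[(- c)%R, c]%classic `*` [set y : n.-tuple R | (tdot y y <= s)%R]))).
  apply: le_measure; rewrite ?inE//.
  - by rewrite -[X in measurable X]setTI; exact: (@measurable_tcons R n measurableT _ (@measurable_ball n.+1 s)).
  - by apply: measurableX => //; exact: measurable_ball.
  move=> [x y] /=; rewrite tdot_tcons /= in_itv/= -ler_norml => xys; split.
    by apply: xc; rewrite (le_trans _ xys)// expr2 lerDl tdot_ge0.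
  by rewrite (le_trans _ xys)// lerDr -expr2 sqr_ge0.
rewrite product_measure1E//; last exact: measurable_ball.
rewrite lte_mul_pinfty//.
by rewrite [X in X \is a fin_num]lebesgue_measure_itv/=; case: ifP.
Qed.

Lemma measurable_ball_stein_fun n s a (u v : n.-tuple R) k :
  measurable_fun setT (ball_stein_fun s a u v k).
Proof.
apply: measurable_fun_ifT => //.
  apply: measurable_fun_ler => //; exact: measurable_tdot_sqr.
apply: measurable_ball_poly; last 2 first.
- exact: measurable_tdot.
- exact: measurable_tdot.
- by apply: measurable_funB => //; exact: measurable_tdot_sqr.
Qed.

(* Integration by parts of [(s - |y|^2) (a + v.y)^k] in the direction [u]; the
   weight vanishes on the boundary of the ball. Slicing off one coordinate
   changes [s] and [a], which is why they are parameters. *)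
Lemma integral_ball_stein n (s a : R) (u v : n.-tuple R) k :
  (\int[lebesgue_tuple n]_y (ball_stein_fun s a u v k y)%:E = 0)%E.
Proof.
elim: n s a u v => [|n ih] s a u v.
  apply: integral0_eq => y _; rewrite /ball_stein_fun !tdot0 /ball_poly.
  by case: ifP => // _; rewrite mul0rn mulr0 !mul0r subrr.
rewrite (tcons_eta u) (tcons_eta v).
move: (thead u) (behead_tuple u) (thead v) (behead_tuple v) => u1 u' v1 v' {u v}.
pose f1 (p : R * n.-tuple R) : R := let s' := s - tdot p.2 p.2 in
  if p.1 ^+ 2 <= s' then
    ball_poly (u1 * v1) (s' - p.1 ^+ 2) (a + tdot v' p.2) (v1 * p.1) (u1 * p.1) k
  else 0.
pose f2 (p : R * n.-tuple R) : R :=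
  ball_stein_fun (s - p.1 ^+ 2) (a + v1 * p.1) u' v' k p.2.
have fE p : ball_stein_fun s a (tcons (u1, u')) (tcons (v1, v')) k (tcons p) =
    f1 p + f2 p.
  rewrite /f1 /f2 /ball_stein_fun !tdot_tcons /= -expr2.
  rewrite lerBrDr lerBrDr [tdot p.2 p.2 + _]addrC; case: ifP; last by rewrite addr0.
  move=> _; rewrite ball_poly_split.
  by congr (ball_poly _ _ _ _ _ _ + ball_poly _ _ _ _ _ _); ring.
have m2 : measurable_fun setT (fun p : R * n.-tuple R => tdot p.2 p.2).
  exact: (measurableT_comp (@measurable_tdot_sqr R n)).
have m1 : measurable_fun setT (fun p : R * n.-tuple R => p.1 ^+ 2).
  exact: measurable_funX.
have mt (w : n.-tuple R) : measurable_fun setT (fun p : R * n.-tuple R => tdot w p.2).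
  exact: (measurableT_comp (measurable_tdot w)).
have mf1 : measurable_fun setT f1.
  apply: measurable_fun_ifT => //.
    by apply: measurable_fun_ler => //; exact: measurable_funB.
  rewrite (_ : (fun _ => _) = fun p : R * n.-tuple R =>
    ball_poly (u1 * v1) (s - tdot p.2 p.2 - p.1 ^+ 2) a
      (tdot v' p.2 + v1 * p.1) (u1 * p.1) k); last first.
    by apply/funext => p; rewrite /ball_poly addrA.
  apply: measurable_ball_poly.
  - by apply: measurable_funB => //; exact: measurable_funB.
  - by apply: measurable_funD => //; exact: measurable_funM.
  - exact: measurable_funM.
have mf2 : measurable_fun setT f2.
  apply: measurable_fun_ifT => //.
    by apply: measurable_fun_ler => //; exact: measurable_funB.
  rewrite (_ : (fun _ => _) = fun p : R * n.-tuple R =>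
    ball_poly (tdot u' v') (s - p.1 ^+ 2 - tdot p.2 p.2) a
      (v1 * p.1 + tdot v' p.2) (tdot u' p.2) k); last first.
    by apply/funext => p; rewrite /ball_poly addrA.
  apply: measurable_ball_poly => //.
  - by apply: measurable_funB => //; exact: measurable_funB.
  - by apply: measurable_funD => //; exact: measurable_funM.
pose K := @tcons R n @^-1` [set y | tdot y y <= s].
have mK : measurable K.
  rewrite -[X in measurable X]setTI.
  exact: (@measurable_tcons R n measurableT _ (@measurable_ball n.+1 s)).
have Koo : ((leb \x lebesgue_tuple n) K < +oo)%E.
  exact: (lebesgue_tuple_ball_lty n.+1 s).
pose c := 1 + `|s|.
pose W := `|v1| * c + (\sum_(i < n) `|tnth v' i|) * c.
have KP p : K p -> [/\ p.1 ^+ 2 + tdot p.2 p.2 <= s, `|p.1| <= c &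
    forall w, `|tdot w p.2| <= (\sum_(i < n) `|tnth w i|) * c].
  rewrite /K/= tdot_tcons -expr2 => ps; split=> //.
    by apply: norm_le_sqr; rewrite (le_trans _ ps)// lerDl tdot_ge0.
  by move=> w; apply: tdot_le_ball; rewrite (le_trans _ ps)// lerDr sqr_ge0.
have i1 : (leb \x lebesgue_tuple n)%E.-integrable setT (EFin \o f1).
  apply: (@integrable_bounded_support _ (measurableTypeR R * n.-tuple R)%type (leb \x lebesgue_tuple n)%E K f1 _ mK Koo mf1).
    move=> p /KP[ps pc pw]; rewrite /f1 lerBrDr ps.
    rewrite (_ : ball_poly _ _ _ _ _ _ = ball_poly (u1 * v1)
      (s - tdot p.2 p.2 - p.1 ^+ 2) a (v1 * p.1 + tdot v' p.2) (u1 * p.1) k).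
      apply: (@ball_poly_bound _ _ _ _ _ `|s| W (`|u1| * c)).
      + by rewrite ger0_norm ?(le_trans _ (ler_norm s)); have := tdot_ge0 p.2; nra.
      + by rewrite (le_trans (ler_normD _ _))// lerD// normrM ler_wpM2l.
      + by rewrite normrM ler_wpM2l.
    by rewrite /ball_poly; congr (_ * _ ^+ _ - _ * _ ^+ _); ring.
  by move=> p; rewrite /K/= tdot_tcons -expr2 /f1 lerBrDr => /negP/negbTE ->.
have i2 : (leb \x lebesgue_tuple n)%E.-integrable setT (EFin \o f2).
  apply: (@integrable_bounded_support _ (measurableTypeR R * n.-tuple R)%type (leb \x lebesgue_tuple n)%E K f2 _ mK Koo mf2).
    move=> p /KP[ps pc pw]; rewrite /f2 /ball_stein_fun lerBrDr addrC ps.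
    rewrite (_ : ball_poly _ _ _ _ _ _ = ball_poly (tdot u' v')
      (s - p.1 ^+ 2 - tdot p.2 p.2) a (v1 * p.1 + tdot v' p.2) (tdot u' p.2) k).
      apply: (@ball_poly_bound _ _ _ _ _ `|s| W ((\sum_(i < n) `|tnth u' i|) * c)).
      + by rewrite ger0_norm ?(le_trans _ (ler_norm s)); have := tdot_ge0 p.2; nra.
      + by rewrite (le_trans (ler_normD _ _))// lerD// normrM ler_wpM2l.
      + exact: pw.
    by rewrite /ball_poly; congr (_ * _ ^+ _ - _ * _ ^+ _); ring.
  move=> p; rewrite /K/= tdot_tcons -expr2 /f2 /ball_stein_fun lerBrDr addrC.
  by move=> /negP/negbTE ->.
have fEE : (EFin \o ball_stein_fun s a (tcons (u1, u')) (tcons (v1, v')) k) \o @tcons R n =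
    (EFin \o f1) \+ (EFin \o f2).
  by apply/funext => p; rewrite /= fE.
rewrite (@integral_tcons R n (EFin \o ball_stein_fun s a (tcons (u1, u')) (tcons (v1, v')) k)).
- transitivity (\int[(leb \x lebesgue_tuple n)%E]_p ((EFin \o f1) \+ (EFin \o f2)) p)%E.
    by apply: eq_integral => p _; exact: (congr1 (fun F => F p) fEE).
  (* The two parts are integrated in opposite orders: [f1] first along the sliced coordinate, where
     the one-dimensional case applies, and [f2] first over the remaining coordinates, where the
     induction hypothesis does. *)
  rewrite integralD// -integral21_prod_meas1// -integral12_prod_meas1//.
  rewrite /fubini_F /fubini_G.
  rewrite [X in (X + _)%E](_ : _ = 0)%E; last first.
    apply: integral0_eq => y _.
    have := integral_ball_poly1 (s - tdot y y) (a + tdot v' y) k (erefl (u1 * v1)).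
    by [].
  rewrite add0e; apply: integral0_eq => x _.
  exact: (ih (s - (x : R) ^+ 2) (a + v1 * (x : R)) u' v').
- by apply/measurable_EFinP; exact: measurable_ball_stein_fun.
- by rewrite fEE; exact: integrableD.
Qed.

End ball_stein.

(** * Integrals against the image of a measure with density *)

Section density_transfer.
Context dX dY (X : measurableType dX) (Y : measurableType dY) (R : realType).
Variables (mu : {measure set X -> \bar R}) (nu : {measure set Y -> \bar R}).
Variables (phi : X -> Y) (w : X -> R).
Hypotheses (mphi : measurable_fun setT phi) (mw : measurable_fun setT w).
Hypothesis w0 : forall x, 0 <= w x.
Hypothesis nuE : forall A, measurable A ->
  nu A = (\int[mu]_(x in phi @^-1` A) (w x)%:E)%E.
Local Open Scope ereal_scope.
Import HBNNSimple.

(** By simple functions and monotone convergence. It serves twice: for the surface measure, with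
    [phi] the normalisation and [w] supported in the ball, and for the von Mises-Fisher law, with
    [phi] the identity and [w] its density. *)
Lemma ge0_integral_density (g : Y -> \bar R) :
  measurable_fun setT g -> (forall y, 0 <= g y) ->
  \int[nu]_y g y = \int[mu]_x (g (phi x) * (w x)%:E).
Proof.
move=> mg g0; pose f_ := nnsfun_approx measurableT mg.
have mpre A : measurable A -> measurable (phi @^-1` A).
  by move=> mA; rewrite -[X in measurable X]setTI; exact: mphi.
transitivity (limn (fun n => \int[nu]_x (f_ n x)%:E)).
  rewrite -monotone_convergence//.
  - by apply: eq_integral => y _; apply/esym/cvg_lim => //; exact: cvg_nnsfun_approx.
  - by move=> n; exact/measurable_EFinP/measurable_funP.
  - by move=> n y _; rewrite lee_fin.
  - by move=> y _ m n mn; rewrite lee_fin; exact/lefP/nd_nnsfun_approx.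
transitivity (limn (fun n => \int[mu]_x ((f_ n (phi x))%:E * (w x)%:E))); last first.
  rewrite -monotone_convergence//.
  - apply: eq_integral => x _; apply/cvg_lim => //.
    by apply: cvgeZr => //; exact: cvg_nnsfun_approx.
  - move=> n; apply: emeasurable_funM; apply/measurable_EFinP => //.
    exact: measurableT_comp.
  - by move=> n y _; rewrite mule_ge0// lee_fin.
  - move=> y _ m n mn; apply: lee_wpmul2r; rewrite lee_fin//.
    by exact/lefP/nd_nnsfun_approx.
congr (limn _); apply/funext => n.
transitivity (\sum_(k \in range (f_ n)) k%:E * nu (f_ n @^-1` [set k])).
  under eq_integral do rewrite fimfunE -fsumEFin//.
  rewrite ge0_integral_fsum//; last 2 first.
  - by move=> y; exact/measurable_EFinP/measurable_funM.
  - by move=> y x _; rewrite nnfun_muleindic_ge0.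
  by apply: eq_fsbigr => r _; rewrite integralZl_indic_nnsfun// integral_indic// setIT.
transitivity (\int[mu]_x \sum_(k \in range (f_ n))
    ((k * \1_(f_ n @^-1` [set k]) (phi x))%:E * (w x)%:E)); last first.
  apply: eq_integral => x _; rewrite -ge0_mule_fsuml.
    by rewrite fsumEFin// -fimfunE.
  by move=> k; exact: nnfun_muleindic_ge0.
rewrite ge0_integral_fsum//; last 2 first.
- move=> k; apply: emeasurable_funM; apply/measurable_EFinP => //.
  by apply: measurable_funM => //; exact: measurableT_comp.
- by move=> k x _; rewrite mule_ge0 ?nnfun_muleindic_ge0// lee_fin.
(* Pulling [k] out of the integral needs 0 <= k; a nonnegative simple function has empty preimages
   at negative values, so both sides are then 0. *)
apply: eq_fsbigr => k _; have [k0|k0] := ltP k 0%R.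
  rewrite preimage_nnfun0// measure0 mule0 integral0_eq// => x _.
  by rewrite indicE in_set0 mulr0 mul0e.
rewrite nuE// integral_mkcond -ge0_integralZl//; last 2 first.
- by apply: measurable_funTS; apply/(measurable_restrictT _ (mpre _ _)) => //;
    apply: measurable_funTS; exact/measurable_EFinP.
- by move=> x _; rewrite patchE; case: ifP => // _; rewrite lee_fin.
apply: eq_integral => x _; rewrite patchE indicE.
case: ifPn => xk; last first.
  have -> : (phi x \in f_ n @^-1` [set k]) = false.
    by apply/negbTE; apply: contraNN xk => /set_mem h; apply/mem_set.
  by rewrite mulr0 mul0e mule0.
have -> : phi x \in f_ n @^-1` [set k] by move: xk => /set_mem h; apply/mem_set.
by rewrite mulr1.
Qed.

Lemma integrable_density (g : Y -> R) : measurable_fun setT g ->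
  mu.-integrable setT (fun x => (g (phi x) * w x)%:E) ->
  nu.-integrable setT (EFin \o g).
Proof.
move=> mg /integrableP[_ igw]; apply/integrableP; split; first exact/measurable_EFinP.
rewrite ge0_integral_density//; last exact/measurableT_comp/measurable_EFinP.
rewrite (eq_integral (fun x => `|(g (phi x) * w x)%:E|))// => x _ /=.
by rewrite normrM (ger0_norm (w0 x)) EFinM.
Qed.

Lemma integral_density (g : Y -> R) : measurable_fun setT g ->
  mu.-integrable setT (fun x => (g (phi x) * w x)%:E) ->
  \int[nu]_y (g y)%:E = \int[mu]_x (g (phi x) * w x)%:E.
Proof.
move=> mg igw; rewrite integralE [RHS]integralE.
rewrite !ge0_integral_density; last 4 first.
- exact/measurable_funeneg/measurable_EFinP.
- exact: funeneg_ge0.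
- exact/measurable_funepos/measurable_EFinP.
- exact: funepos_ge0.
congr (_ - _); apply: eq_integral => x _.
  by rewrite !funeposE /= EFinM maxe_pMl ?lee_fin// mul0e.
by rewrite !funenegE /= maxe_pMl ?lee_fin// mul0e -EFinM mulNr.
Qed.

End density_transfer.

(** * Polar coordinates in the ball *)

Section sphere_polar.
Context {R : realType} (n : nat).
Local Notation lam := (@lebesgue_tuple R n).
Local Notation tup := (n.-tuple R).

Lemma enorm_tcol (y : tup) : enorm (tcol y) = Num.sqrt (tdot y y).
Proof. by rewrite /enorm dotv_tcol. Qed.

Lemma enorm_tcol_ge0 (y : tup) : 0 <= enorm (tcol y).
Proof. exact: sqrtr_ge0. Qed.

Lemma enorm_tcol_sqr (y : tup) : enorm (tcol y) ^+ 2 = tdot y y.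
Proof. by rewrite enorm_tcol sqr_sqrtr// tdot_ge0. Qed.

Lemma normalizeE (y : tup) : normalize y = tscale (enorm (tcol y))^-1 y.
Proof. by apply: eq_from_tnth => i; rewrite !tnth_mktuple mulrC. Qed.

Lemma tdot_tscalel r (u y : tup) : tdot (tscale r u) y = r * tdot u y.
Proof. by rewrite tdotC tdot_tscaler tdotC. Qed.

Lemma enorm_tscale r (y : tup) : 0 <= r ->
  enorm (tcol (tscale r y)) = r * enorm (tcol y).
Proof.
move=> r0; rewrite !enorm_tcol tdot_tscaler tdot_tscalel mulrA -expr2.
by rewrite sqrtrM ?sqr_ge0// sqrtr_sqr ger0_norm.
Qed.

Lemma normalize_tscale r (y : tup) : 0 < r -> normalize (tscale r y) = normalize y.
Proof.
move=> r0; rewrite !normalizeE enorm_tscale ?ltW//.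
apply: eq_from_tnth => i; rewrite !tnth_mktuple invfM.
by rewrite mulrACA mulVf ?gt_eqF// mul1r.
Qed.

Lemma tdot_normalize (u y : tup) : 0 < enorm (tcol y) ->
  enorm (tcol y) * tdot u (normalize y) = tdot u y.
Proof. by move=> y0; rewrite normalizeE tdot_tscaler mulrA divff ?mul1r// gt_eqF. Qed.

Lemma tdot_normalize_sqr (y : tup) : 0 < enorm (tcol y) ->
  tdot (normalize y) (normalize y) = 1.
Proof.
move=> y0; rewrite normalizeE tdot_tscaler tdot_tscalel -enorm_tcol_sqr mulrA.
by rewrite -expr2 -exprMn mulVf ?expr1n// gt_eqF.
Qed.

(** The set in the definition of [cone]; at the origin, which it omits, [normalize] does not land on
    the sphere. *)
Definition punctured_ball : set tup := [set y | 0 < enorm (tcol y) <= 1].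

Lemma in_punctured_ball y : (y \in punctured_ball) = (0 < enorm (tcol y) <= 1).
Proof. by apply/idP/idP => [/set_mem//|y01]; apply/mem_set. Qed.

Lemma measurable_enorm_tcol : measurable_fun setT (fun y : tup => enorm (tcol y)).
Proof. by apply: measurable_enorm; exact: mxmeasurable_tcol. Qed.

Lemma measurable_punctured_ball : measurable punctured_ball.
Proof.
rewrite (_ : punctured_ball =
    setT `&` (fun y => enorm (tcol y)) @^-1` `]0, 1]); last first.
  by rewrite setTI; apply/seteqP; split=> y /=; rewrite in_itv.
exact: measurable_enorm_tcol.
Qed.

Lemma punctured_ball_lty : (lam punctured_ball < +oo)%E.
Proof.
apply: le_lt_trans (lebesgue_tuple_ball_lty n 1).
apply: le_measure; rewrite ?inE//.
- exact: measurable_punctured_ball.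
- exact: measurable_ball.
by move=> y /= /andP[y0 y1]; rewrite -enorm_tcol_sqr expr_le1// ltW.
Qed.

Section polar.
Variables (g : tup -> \bar R) (k : nat).
Hypotheses (mg : measurable_fun setT g) (g0 : forall x, (0 <= g x)%E).
Hypothesis n0 : (0 < n)%N.
Local Open Scope ereal_scope.

Let f : tup -> \bar R := (g \o @normalize R n) \_ punctured_ball.

Let mf : measurable_fun setT f.
Proof.
apply/(measurable_restrictT _ measurable_punctured_ball); apply: measurable_funTS.
by apply: measurableT_comp => //; exact: measurable_normalize.
Qed.

Let f0 y : 0 <= f y.
Proof. by rewrite /f patchE; case: ifP => //= _; exact: g0. Qed.

Let I := \int[lam]_(y in punctured_ball) g (normalize y).

Let If : \int[lam]_y f y = I.
Proof. by rewrite /I [RHS]integral_mkcond. Qed.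

(** Inside the ball [f] is constant along rays, so its restriction to radius [r] is [f] composed
    with the scaling by 1/r, and the change of variables gives the factor r^n. *)
Let integral_small_ball (r : R) : (0 <= r)%R -> (r <= 1)%R ->
  \int[lam]_y (f y * ((enorm (tcol y) <= r)%R%:R)%:E) = (r ^+ n)%:E * I.
Proof.
move=> r0 r1; have [->|rn0] := eqVneq r 0%R.
  rewrite expr0n gtn_eqF// mul0e integral0_eq// => y _; rewrite /f patchE.
  case: ifPn => [|_]; last by rewrite mul0e.
  by move=> /set_mem/= /andP[y0 _]; rewrite leNgt y0 mule0.
have {}r0 : (0 < r)%R by rewrite lt_neqAle eq_sym rn0.
have ri0 : (0 < r^-1)%R by rewrite invr_gt0.
rewrite -If -[X in (X ^+ n)%:E](invrK r) -ge0_integral_tscale//.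
apply: eq_integral => y _; rewrite /f !patchE /= normalize_tscale//.
have -> : (tscale r^-1 y \in punctured_ball) = (0 < enorm (tcol y) <= r)%R.
  rewrite in_punctured_ball (enorm_tscale _ (ltW ri0)).
  by rewrite pmulr_rgt0// ler_pdivrMl// mulr1.
rewrite in_punctured_ball.
have [y0|y0] := boolP (0 < enorm (tcol y))%R; last by rewrite mul0e.
have [yr|yr] := boolP (enorm (tcol y) <= r)%R; last by rewrite mule0.
by rewrite (le_trans yr r1) mule1.
Qed.

Let ck : R := k%:R / (k + n)%:R.

(** Layer cake: 1 - |y|^k is the integral of k r^(k-1) over [|y|, 1], and exchanging [y] and [r]
    leaves integrals over small balls. The absolute value of [p.2] keeps [h] nonnegative for all
    [r]. *)
Let h (p : tup * R) : \bar R := f p.1 *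
  ((p.2 \in `[0%R, 1%R])%:R * (enorm (tcol p.1) <= p.2)%R%:R *
   (k%:R * `|p.2| ^+ k.-1))%:E.

Let mh : measurable_fun setT h.
Proof.
apply: emeasurable_funM; first exact: measurableT_comp.
apply/measurable_EFinP; apply: measurable_funM.
  apply: measurable_funM.
    rewrite (_ : (fun _ => _) = \1_`[0%R, 1%R] \o (@snd tup R)); last first.
      by apply/funext => p /=; rewrite indicE mem_setE.
    exact: measurableT_comp.
  rewrite (_ : (fun _ => _) = fun p : tup * R =>
      if (enorm (tcol p.1) <= p.2)%R then 1%R else 0%R); last first.
    by apply/funext => p; case: ifP.
  apply: measurable_fun_ifT => //; apply: measurable_fun_ler => //.
  exact: (measurableT_comp measurable_enorm_tcol).
apply: measurable_funM => //; apply: measurable_funX.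
exact: measurableT_comp.
Qed.

Let h0 p : 0 <= h p.
Proof. by rewrite mule_ge0// lee_fin !mulr_ge0// exprn_ge0. Qed.

Let h_inner1 y : \int[lebesgue_measure]_r h (y, r) =
  f y * (1 - enorm (tcol y) ^+ k)%:E.
Proof.
rewrite /h /= /f patchE in_punctured_ball.
case: ifPn => [/andP[y0 y1]|_]; last by rewrite mul0e integral0_eq// => r _; rewrite mul0e.
transitivity (\int[lebesgue_measure]_(r in `[enorm (tcol y), 1%R])
    (g (normalize y) * (k%:R * r ^+ k.-1)%:E)).
  rewrite [RHS]integral_mkcond; apply: eq_integral => r _.
  rewrite patchE mem_setE !in_itv/=.
  have [yr|yr]/= := boolP (enorm (tcol y) <= r)%R; last by rewrite mulr0 mul0r mule0.
  have r0 : (0 <= r)%R by rewrite (le_trans (ltW y0)).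
  rewrite r0/= ger0_norm//; case: ifPn => r1; first by rewrite !mul1r.
  by rewrite !mul0r mule0.
rewrite ge0_integralZl//; last 2 first.
- by apply/measurable_EFinP; apply: measurable_funM.
- move=> r /=; rewrite in_itv/= => /andP[yr _].
  by rewrite lee_fin mulr_ge0// exprn_ge0// (le_trans (ltW y0)).
congr (_ * _); case: (k) => [|m] /=.
  by rewrite expr0 subrr integral0_eq// => r _; rewrite mul0r.
by rewrite (integral_pow _ y1) expr1n.
Qed.

Let h_int : \int[lam]_y (f y * (1 - enorm (tcol y) ^+ k)%:E) = ck%:E * I.
Proof.
under eq_integral do rewrite -h_inner1.
rewrite (fubini_tonelli (m1 := lam) (m2 := lebesgue_measure) h)//.
transitivity (\int[lebesgue_measure]_(r in `[0%R, 1%R]) (I * (k%:R * r ^+ (k.-1 + n))%:E)).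
  rewrite [RHS]integral_mkcond; apply: eq_integral => r _.
  rewrite patchE mem_setE in_itv/=; case: ifPn => r01; last first.
    rewrite integral0_eq// => y _; rewrite /h /= in_itv/= (negbTE r01) !mul0r.
    by rewrite mule0.
  have /andP[r0 r1] := r01.
  transitivity (\int[lam]_y ((f y * ((enorm (tcol y) <= r)%R%:R)%:E) * (k%:R * r ^+ k.-1)%:E)).
    apply: eq_integral => y _; rewrite /h /= in_itv/= r01 mul1r ger0_norm//.
    by rewrite EFinM muleA.
  rewrite ge0_integralZr//; last 3 first.
  - apply: emeasurable_funM => //; apply/measurable_EFinP.
    rewrite (_ : (fun _ => _) = fun y : tup =>
        if (enorm (tcol y) <= r)%R then 1%R else 0%R); last first.
      by apply/funext => y; case: ifP.
    apply: measurable_fun_ifT => //; apply: measurable_fun_ler => //.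
    exact: measurable_enorm_tcol.
  - by move=> y _; rewrite mule_ge0// lee_fin.
  - by rewrite lee_fin mulr_ge0// exprn_ge0.
  rewrite integral_small_ball// [(_ ^+ n)%:E * I]muleC -muleA -EFinM.
  by congr (_ * _%:E); rewrite exprD mulrC mulrA.
rewrite ge0_integralZl//; last 3 first.
- by apply/measurable_EFinP; apply: measurable_funM.
- move=> r /=; rewrite in_itv/= => /andP[r0 _].
  by rewrite lee_fin mulr_ge0// exprn_ge0.
- exact: integral_ge0.
rewrite muleC; congr (_ * _); rewrite /ck; case: (k) => [|m] /=.
  by rewrite mul0r integral0_eq// => r _; rewrite mul0r.
transitivity (\int[lebesgue_measure]_(r in `[0%R, 1%R])
   ((m.+1%:R / (m + n).+1%:R : R)%:E * ((m + n).+1%:R * r ^+ (m + n))%:E)).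
  apply: eq_integral => r _; rewrite -EFinM; congr EFin.
  by rewrite mulrA divfK ?pnatr_eq0.
rewrite ge0_integralZl//; last 2 first.
- by apply/measurable_EFinP; apply: measurable_funM.
- move=> r /=; rewrite in_itv/= => /andP[r0 _].
  by rewrite lee_fin mulr_ge0// exprn_ge0.
by rewrite integral_pow// expr1n expr0n subr0 mule1 addSn.
Qed.

(** The layer cake computes the integral with weight 1 - |y|^k as k / (k + n) times [I]; subtracting
    it from [I], which must be finite, leaves n / (k + n). *)
Lemma polar_integral : \int[lam]_(y in punctured_ball) g (normalize y) < +oo ->
  \int[lam]_(y in punctured_ball) (g (normalize y) * (enorm (tcol y) ^+ k)%:E) =
  (n%:R / (k + n)%:R)%:E * I.
Proof.
move=> Ioo.
have I0 : 0 <= I by apply: integral_ge0.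
have Ifin : I \is a fin_num by rewrite ge0_fin_numE.
pose Pk := \int[lam]_y (f y * (enorm (tcol y) ^+ k)%:E).
have mek : measurable_fun setT (fun y : tup => enorm (tcol y) ^+ k)%R.
  by apply: measurable_funX; exact: measurable_enorm_tcol.
have e0 (y : tup) : 0 <= (enorm (tcol y) ^+ k)%:E.
  by rewrite lee_fin exprn_ge0// enorm_tcol_ge0.
have e1 (y : tup) : 0 <= f y * (1 - enorm (tcol y) ^+ k)%:E.
  rewrite /f patchE in_punctured_ball; case: ifP => [/andP[_ y1]|]; last by rewrite mul0e.
  by rewrite mule_ge0 ?g0// lee_fin subr_ge0 exprn_ile1// enorm_tcol_ge0.
have IE : I = Pk + ck%:E * I.
  rewrite -{1}If -h_int -ge0_integralD//; last 3 first.
  - by move=> y _; rewrite mule_ge0.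
  - by apply: emeasurable_funM => //; exact/measurable_EFinP.
  - by apply: emeasurable_funM => //; apply/measurable_EFinP; exact: measurable_funB.
  apply: eq_integral => y _; rewrite /f patchE in_punctured_ball.
  case: ifP => [/andP[_ y1]|]; last by rewrite !mul0e add0e.
  rewrite -ge0_muleDr//.
    by rewrite -EFinD addrC subrK mule1.
  by rewrite lee_fin subr_ge0 exprn_ile1// enorm_tcol_ge0.
have -> : \int[lam]_(y in punctured_ball) (g (normalize y) * (enorm (tcol y) ^+ k)%:E) = Pk.
  rewrite integral_mkcond; apply: eq_integral => y _.
  by rewrite /f !patchE; case: ifP => // _; rewrite mul0e.
have : Pk \is a fin_num.
  rewrite ge0_fin_numE; last by apply: integral_ge0 => y _; rewrite mule_ge0.
  apply: le_lt_trans Ioo; rewrite -/I [leRHS]IE leeDl// mule_ge0// lee_fin.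
  by rewrite divr_ge0.
move: IE; rewrite -(fineK Ifin) => IE Pfin; move: IE; rewrite -(fineK Pfin).
rewrite -!EFinM -EFinD => -[IE]; congr EFin.
have kn0 : ((k + n)%:R != 0 :> R)%R by rewrite pnatr_eq0 -lt0n addn_gt0 n0 orbT.
have -> : fine Pk = (fine I - ck * fine I)%R by rewrite {1}IE addrK.
by rewrite /ck; rewrite natrD in kn0 *; field.
Qed.

End polar.
End sphere_polar.

(** * Surface measure and integration by parts on the sphere *)

Section surface_integral.
Context {R : realType} (n : nat).
Local Notation lam := (@lebesgue_tuple R n).
Local Notation tup := (n.-tuple R).
Local Notation ball0 := (@punctured_ball R n).
Local Notation sigma := (@surface_area R n).

Let w (y : tup) : R := n%:R * \1_ball0 y.

Let mw : measurable_fun setT w.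
Proof.
apply: measurable_funM => //; apply: measurable_indic.
exact: measurable_punctured_ball.
Qed.

Let w0 y : 0 <= w y.
Proof. by rewrite mulr_ge0. Qed.

(** Presents the surface measure as the image under [normalize] of [n] times Lebesgue measure on the
    punctured ball. *)
Let surface_areaE A : measurable A ->
  sigma A = (\int[lam]_(y in @normalize R n @^-1` A) (w y)%:E)%E.
Proof.
move=> mA; have mN : measurable (@normalize R n @^-1` A).
  by rewrite -[X in measurable X]setTI; exact: (@measurable_normalize R n).
have mB := @measurable_punctured_ball R n.
under eq_integral do rewrite /w EFinM.
rewrite ge0_integralZl//; last first.
  by apply/measurable_EFinP; apply: measurable_funTS; exact: measurable_indic.
by rewrite integral_indic.
Qed.

(** Boundedness is asked on the sphere alone, as polynomials are unbounded on the whole space. The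
    class is closed under sums and products, and membership gives integrability. *)
Definition bounded_on_sphere (g : tup -> R) :=
  measurable_fun setT g /\ exists C, forall x, sphere n x -> `|g x| <= C.

Lemma normalize_sphere (y : tup) : 0 < enorm (tcol y) -> sphere n (normalize y).
Proof. by move=> y0; rewrite /sphere/= dotv_tcol tdot_normalize_sqr. Qed.

Lemma integrable_ball_polar g k : bounded_on_sphere g ->
  lam.-integrable setT
    (EFin \o (fun y => g (normalize y) * enorm (tcol y) ^+ k * \1_ball0 y)).
Proof.
move=> [mg [C gC]].
apply: (integrable_bounded_support (@measurable_punctured_ball R n)
  (@punctured_ball_lty R n) (C := C)).
- apply: measurable_funM; last first.
    by apply: measurable_indic; exact: (@measurable_punctured_ball R n).
  apply: measurable_funM.
    by apply: measurableT_comp => //; exact: measurable_normalize.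
  by apply: measurable_funX; exact: measurable_enorm_tcol.
- move=> y /andP[y0 y1]; rewrite indicE in_punctured_ball y0 y1 mulr1.
  rewrite normrM (ger0_norm (exprn_ge0 _ (enorm_tcol_ge0 _))).
  rewrite (le_trans _ (gC _ (normalize_sphere y0)))// ler_piMr//.
  by rewrite exprn_ile1// enorm_tcol_ge0.
- by move=> y y0; rewrite indicE memNset// mulr0.
Qed.

Lemma integrable_surface_area g : bounded_on_sphere g ->
  sigma.-integrable setT (EFin \o g).
Proof.
move=> bg; have [mg _] := bg.
apply: (integrable_density (@measurable_normalize R n) mw w0 surface_areaE mg).
rewrite (_ : (fun _ => _) = fun y => (n%:R%:E *
    (EFin \o (fun y => g (normalize y) * enorm (tcol y) ^+ 0 * \1_ball0 y)%R) y)%E).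
  by apply: integrableZl => //; exact: integrable_ball_polar.
by apply/funext => y; rewrite /w /= expr0 mulr1 -EFinM mulrCA.
Qed.

Lemma bounded_on_sphereD f g : bounded_on_sphere f -> bounded_on_sphere g ->
  bounded_on_sphere (fun x => f x + g x).
Proof.
move=> [mf [C fC]] [mg [D gD]]; split; first exact: measurable_funD.
exists (C + D) => x Sx; rewrite (le_trans (ler_normD _ _))//.
by rewrite lerD ?fC ?gD.
Qed.

Lemma bounded_on_sphereM f g : bounded_on_sphere f -> bounded_on_sphere g ->
  bounded_on_sphere (fun x => f x * g x).
Proof.
move=> [mf [C fC]] [mg [D gD]]; split; first exact: measurable_funM.
exists (C * D) => x Sx; rewrite normrM.
by rewrite ler_pM ?fC ?gD.
Qed.

Lemma bounded_on_sphere_cst c : bounded_on_sphere (fun=> c).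
Proof. by split => //; exists `|c|. Qed.

Lemma bounded_on_sphereX f k : bounded_on_sphere f ->
  bounded_on_sphere (fun x => f x ^+ k).
Proof.
move=> bf; elim: k => [|k ih]; first exact: bounded_on_sphere_cst.
by under eq_fun do rewrite exprS; exact: bounded_on_sphereM.
Qed.

Lemma bounded_on_sphere_tdot u : bounded_on_sphere (tdot u).
Proof.
split; first exact: measurable_tdot.
exists ((\sum_(i < n) `|tnth u i|) * (1 + `|1|)) => x.
by rewrite /sphere/= dotv_tcol => x1; apply: tdot_le_ball; rewrite x1.
Qed.

Hypothesis n0 : (0 < n)%N.

Let ball_polar g k (y : tup) := g (normalize y) * enorm (tcol y) ^+ k * \1_ball0 y.

Let Rintegral_surface_area g : bounded_on_sphere g ->
  \int[sigma]_x g x = n%:R * \int[lam]_y ball_polar g 0 y.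
Proof.
move=> bg; have [mg _] := bg; have ig := integrable_ball_polar 0 bg.
rewrite -RintegralZl// /Rintegral; congr fine.
have gE y : g (normalize y) * w y = n%:R * ball_polar g 0 y.
  by rewrite /w /ball_polar expr0 mulr1 mulrCA.
rewrite (integral_density (@measurable_normalize R n) mw w0 surface_areaE)//.
  by apply: eq_integral => y _; rewrite gE.
rewrite (_ : (fun _ => _) = fun y => (n%:R%:E * (EFin \o ball_polar g 0) y)%E).
  exact: integrableZl.
by apply/funext => y; rewrite gE EFinM.
Qed.

Let ge0_ball_polar h k : bounded_on_sphere h -> (forall x, 0 <= h x) ->
  \int[lam]_y ball_polar h k y = n%:R / (k + n)%:R * \int[lam]_y ball_polar h 0 y.
Proof.
move=> bh h0; have [mh _] := bh.
have intE j : (\int[lam]_y (ball_polar h j y)%:E =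
    \int[lam]_(y in ball0) ((h (normalize y))%:E * (enorm (tcol y) ^+ j)%:E))%E.
  rewrite [RHS]integral_mkcond; apply: eq_integral => y _.
  rewrite patchE /ball_polar indicE; case: ifP => _; last by rewrite mulr0.
  by rewrite mulr1 EFinM.
have int0E : (\int[lam]_y (ball_polar h 0 y)%:E =
    \int[lam]_(y in ball0) (h (normalize y))%:E)%E.
  by rewrite intE; apply: eq_integral => y _; rewrite expr0 mule1.
have fin0 : (\int[lam]_y (ball_polar h 0 y)%:E)%E \is a fin_num.
  exact: integrable_fin_num (integrable_ball_polar 0 bh).
rewrite /Rintegral intE (polar_integral (g := EFin \o h))//.
- by rewrite -int0E -(fineK fin0).
- exact/measurable_EFinP.
- by rewrite -int0E -(fineK fin0) ltry.
Qed.

(** The radial factor contributes the integral of r^(k+n-1) over [0, 1]. Signed functions are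
    reduced to nonnegative ones by their positive and negative parts. *)
Lemma Rintegral_ball_polar g k : bounded_on_sphere g ->
  \int[lam]_y (g (normalize y) * enorm (tcol y) ^+ k * \1_ball0 y) =
  (k + n)%:R^-1 * \int[sigma]_x g x.
Proof.
move=> bg; have [mg [C gC]] := bg.
pose gp x := maxr (g x) 0; pose gn x := maxr (- g x) 0.
have bgp : bounded_on_sphere gp.
  split; first exact: measurable_maxr.
  exists C => x Sx; rewrite /gp; case: (leP (g x) 0) => _; last exact: gC.
  by rewrite normr0 (le_trans _ (gC _ Sx)).
have bgn : bounded_on_sphere gn.
  split; first by apply: measurable_maxr => //; exact: measurableT_comp.
  exists C => x Sx; rewrite /gn; case: (leP (- g x) 0) => _; last by rewrite normrN gC.
  by rewrite normr0 (le_trans _ (gC _ Sx)).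
have gE j : \int[lam]_y ball_polar g j y =
    \int[lam]_y ball_polar gp j y - \int[lam]_y ball_polar gn j y.
  have ip := integrable_ball_polar j bgp; have im := integrable_ball_polar j bgn.
  rewrite -RintegralB//; apply: eq_Rintegral => y _.
  rewrite /ball_polar -mulrBl -mulrBl /gp /gn.
  by congr (_ * _ * _); have [|] := leP (g _) 0; have [|] := leP (- g _) 0; lra.
rewrite Rintegral_surface_area// mulrA [_^-1 * _]mulrC gE.
have gp0 x : 0 <= gp x by rewrite le_max lexx orbT.
have gn0 x : 0 <= gn x by rewrite le_max lexx orbT.
rewrite -/(ball_polar g k) gE (ge0_ball_polar k bgp gp0) (ge0_ball_polar k bgn gn0).
by rewrite mulrBr.
Qed.

End surface_integral.

Section sphere_stein.
Context {R : realType} (n : nat).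
Hypothesis n0 : (0 < n)%N.
Local Notation lam := (@lebesgue_tuple R n).
Local Notation tup := (n.-tuple R).
Local Notation ball0 := (@punctured_ball R n).
Local Notation sigma := (@surface_area R n).

Let origin : set tup := [set y | tdot y y <= 0].

(** Scaling by 2 preserves the origin but multiplies integrals by 2^-n < 1, so its finite mass is
    0. *)
Let lam_origin : lam origin = 0%E.
Proof.
have mZ : measurable origin by exact: measurable_ball.
have Zfin : lam origin \is a fin_num.
  by rewrite ge0_fin_numE// lebesgue_tuple_ball_lty.
have two0 : (0 : R) < 2 by [].
have := ge0_integral_tscale (n := n) (f := EFin \o \1_origin) two0.
have intZ : (\int[lam]_y (EFin \o \1_origin) y)%E = lam origin.
  by rewrite (_ : (fun _ => _) = fun y => (\1_origin y)%:E)// integral_indic// setIT.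
rewrite intZ (_ : (\int[lam]_y (EFin \o \1_origin) (tscale 2 y))%E = lam origin); last first.
  rewrite -intZ; apply: eq_integral => y _ /=.
  rewrite !indicE (_ : (tscale 2 y \in origin) = (y \in origin))//.
  by apply/idP/idP => /set_mem zy; apply/mem_set; move: zy;
    rewrite /origin/= tdot_tscalel tdot_tscaler; have := tdot_ge0 y; lra.
rewrite -(fineK Zfin) -EFinM => h.
have m1 : measurable_fun setT (EFin \o \1_origin : tup -> \bar R).
  by apply/measurable_EFinP; exact: measurable_indic.
have p1 (y : tup) : (0 <= (EFin \o \1_origin : tup -> \bar R) y)%E by rewrite lee_fin.
move: (congr1 fine (h m1 p1)) => /= /eqP; rewrite -subr_eq0 -{1}(mul1r (fine _)) -mulrBl mulf_eq0.
case/orP => [|/eqP ->//]; rewrite subr_eq0 => /eqP h1.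
have : (2^-1 : R) ^+ n < 1 by rewrite exprn_ilt1// ?invf_lt1// ?ltr1n// -lt0n.
by rewrite -h1 ltxx.
Qed.

(** The ball identity for s = 1 and a = 0, split by radial degree: the terms of degree k - 1 and k +
    1 give the surface integrals with factors 1 / (k - 1 + n) and 1 / (k + 1 + n), and clearing
    denominators yields the claim. The origin, where this splitting fails, is null. *)
Lemma Rintegral_sphere_stein (u v : tup) k :
  ((k + n)%:R - 1) * (\int[sigma]_x (tdot u x * tdot v x ^+ k)) =
  k%:R * tdot u v * \int[sigma]_x (tdot v x ^+ k.-1).
Proof.
pose q1 x := tdot v x ^+ k.-1; pose q2 x := tdot u x * tdot v x ^+ k.
have bq1 : bounded_on_sphere q1 by apply/bounded_on_sphereX/bounded_on_sphere_tdot.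
have bq2 : bounded_on_sphere q2.
  apply: bounded_on_sphereM; first exact: bounded_on_sphere_tdot.
  exact/bounded_on_sphereX/bounded_on_sphere_tdot.
pose F := ball_stein_fun 1 0 u v k.
pose e (y : tup) := enorm (tcol y).
pose bp g j (y : tup) := g (normalize y) * e y ^+ j * \1_ball0 y.
have FE y : ~ origin y -> F y = k%:R * tdot u v * (bp q1 k.-1 y - bp q1 k.+1 y) -
    2 * bp q2 k.+1 y.
  move=> /negP; rewrite -ltNge => y0.
  have ey0 : 0 < e y by rewrite /e enorm_tcol sqrtr_gt0.
  rewrite /F /ball_stein_fun /bp indicE in_punctured_ball -/(e y) ey0/=.
  have -> : (tdot y y <= 1) = (e y <= 1).
    by rewrite -enorm_tcol_sqr expr_le1// ltW.
  case: ifPn => _; last by rewrite !mulr0 subrr mulr0 subrr.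
  rewrite !mulr1 /ball_poly !add0r -enorm_tcol_sqr -/(e y) /q1 /q2.
  rewrite -(tdot_normalize u ey0) -(tdot_normalize v ey0) -/(e y) -mulr_natr !exprMn.
  case: (k) => [|j] /=; rewrite ?mulr0 ?mul0r ?expr0 ?expr1; last by rewrite !exprS; ring.
  by ring.
have F0 : \int[lam]_y F y = 0.
  by rewrite /Rintegral integral_ball_stein.
have iq1 j : lam.-integrable setT (EFin \o bp q1 j) by exact: integrable_ball_polar.
have iq2 j : lam.-integrable setT (EFin \o bp q2 j) by exact: integrable_ball_polar.
have iB : lam.-integrable setT (EFin \o (fun y => bp q1 k.-1 y - bp q1 k.+1 y)).
  exact: (integrableB _ (iq1 k.-1) (iq1 k.+1)).
have iZ1 : lam.-integrable setT
    (EFin \o (fun y => k%:R * tdot u v * (bp q1 k.-1 y - bp q1 k.+1 y))).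
  exact: (integrableZl _ (k%:R * tdot u v) iB).
have iZ2 : lam.-integrable setT (EFin \o (fun y => 2 * bp q2 k.+1 y)).
  exact: (integrableZl _ 2 (iq2 k.+1)).
have : \int[lam]_y F y =
    \int[lam]_y (k%:R * tdot u v * (bp q1 k.-1 y - bp q1 k.+1 y) - 2 * bp q2 k.+1 y).
  congr fine; apply: ae_eq_integral => //.
  - by apply/measurable_EFinP; exact: measurable_ball_stein_fun.
  - have /integrableB/(_ iZ2) := iZ1.
    by move=> /(_ measurableT) /measurable_int.
  - exists origin; split => //; first exact: measurable_ball.
    by move=> y /= hy; apply: contrapT => oy; apply: hy => _; rewrite FE.
rewrite F0 (RintegralB _ iZ1 iZ2)// (RintegralZl _ _ iB)// (RintegralZl _ _ (iq2 _))//.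
rewrite (RintegralB _ (iq1 _) (iq1 _))// /bp !Rintegral_ball_polar//.
move: (\int[sigma]_x q1 x) (\int[sigma]_x q2 x) => Q1 Q2.
move: (tdot u v) => c {iZ1 iZ2 iB iq1 iq2 F0 FE F bq1 bq2 q1 q2 bp}.
(* For k = 0 the truncated [k.-1] is not k - 1, but its term carries the factor [k]; what remains is
   that the integral of u.x is 0. *)
case: k => [|j] /=; rewrite !addSn.
  move=> /eqP; rewrite !mul0r sub0r eq_sym oppr_eq0 !mulf_eq0 invr_eq0 !pnatr_eq0/=.
  by move=> /eqP ->; rewrite mulr0.
have s0 : (j + n)%:R != 0 :> R by rewrite pnatr_eq0 -lt0n addn_gt0 n0 orbT.
have s2 : (j + n).+2%:R != 0 :> R by rewrite pnatr_eq0.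
rewrite -(natr1 (j + n)) addrK => h; apply/eqP; rewrite -subr_eq0; apply/eqP.
move: h; rewrite -(natr1 (j + n).+1) -(natr1 (j + n)) in s2 *.
move: (j + n)%:R s0 s2 => s s0 s2 h.
rewrite (_ : s * Q2 - j.+1%:R * c * Q1 = - (s * (s + 1 + 1) / 2) *
  (j.+1%:R * c * (s^-1 * Q1 - (s + 1 + 1)^-1 * Q1) - 2 * ((s + 1 + 1)^-1 * Q2))).
  by rewrite -h mulr0.
by field; rewrite s0 s2.
Qed.

End sphere_stein.

(** * Gamma and Bessel functions *)

Section gamma_function.
Context {R : realType}.
Local Notation leb := (@lebesgue_measure R).

Lemma powR_cvg_at_right0 (p : R) : 0 <= p -> t `^ p @[t --> 0^'+] --> (0 : R) `^ p.
Proof.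
rewrite le_eqVlt => /predU1P[<-|p0].
  by under eq_fun do rewrite powRr0; rewrite powRr0; exact: cvg_cst.
by rewrite powR0 ?gt_eqF//; exact: powR_cvg0.
Qed.

Lemma is_derive_powR_expRN (p x : R) : 0 < x ->
  is_derive x 1 (fun t => t `^ p * expR (- t))
    (p * (x `^ (p - 1) * expR (- x)) - x `^ p * expR (- x)).
Proof.
move=> x0; notypeclasses refine (is_derive_change _ _).
  notypeclasses refine (is_derive_fM _ _); first exact: is_derive1_powR.
  notypeclasses refine (is_derive_fexp (f := fun t => - t) _).
  by derive_rules.
by rewrite /=; ring.
Qed.

Lemma continuous_within_powR_expRN (p b : R) : 0 <= p -> 0 < b ->
  {within `[0, b], continuous (fun t => t `^ p * expR (- t))}.
Proof.
move=> p0 b0; apply/continuous_within_itvP => //; split.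
- move=> x; rewrite in_itv/= => /andP[x0 _].
  exact: is_derive_continuous (is_derive_powR_expRN p x0).
- apply: cvgM; first exact: powR_cvg_at_right0.
  apply: cvg_at_right_filter.
  by apply: (@is_derive_continuous _ (fun t => expR (- t)) _ _); derive_rules.
- apply: cvg_at_left_filter.
  exact: is_derive_continuous (is_derive_powR_expRN p b0).
Qed.

(** With an integer k >= p, the bound e^n >= n^(k+1) / (k+1)! dominates the sequence by (k+1)! /
    n. *)
Lemma cvg_powR_expRN (p : R) : n%:R `^ p * expR (- n%:R) @[n --> \oo] --> (0 : R).
Proof.
have [k kp] : exists k : nat, p <= k%:R.
  exists (Num.truncn `|p|).+1; rewrite (le_trans (ler_norm p))//.
  by apply/ltW; exact: truncnS_gt.
apply: (@squeeze_cvgr _ _ _ _ (fun=> 0) (fun n : nat => k.+1`!%:R * n%:R^-1)).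
- near=> n; rewrite mulr_ge0 ?powR_ge0 ?expR_ge0//=.
  have n0 : (0 < n%:R :> R) by rewrite ltr0n; near: n; exact: nbhs_infty_gt.
  have n1 : (1 <= n%:R :> R) by rewrite ler1n -(ltr0n R).
  have np : n%:R `^ p <= (n%:R : R) ^+ k.
    by rewrite -powR_mulrn ?ler0n// ler_powR.
  rewrite expRN ler_pdivrMr ?expR_gt0//.
  rewrite (le_trans np)// mulrAC ler_pdivlMr// -exprSr mulrC -ler_pdivrMr ?ltr0n ?fact_gt0//.
  by apply: le_trans (expR_ge1Dxn k (ltW n0)); rewrite lerDr.
- exact: cvg_cst.
- rewrite -(mulr0 (k.+1`!%:R)); apply: cvgMr.
  by rewrite -cvg_shiftS; exact: cvg_harmonic.
Unshelve. all: by end_near. Qed.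

Let g (p t : R) := t `^ p * expR (- t).

Let mg p : measurable_fun setT (g p).
Proof.
apply: measurable_funM; first exact: measurable_powR.
by apply: measurableT_comp => //; exact: measurableT_comp.
Qed.

Let g0 p t : 0 <= g p t.
Proof. by rewrite mulr_ge0 ?powR_ge0 ?expR_ge0. Qed.

Let ig (p : R) n : 0 <= p ->
  leb.-integrable `[0, n.+1%:R] (EFin \o g p).
Proof.
move=> p0; apply: continuous_compact_integrable; first exact: segment_compact.
by apply: continuous_within_powR_expRN.
Qed.

(** Integration by parts on a compact interval, where the fundamental theorem applies; there is no
    boundary term at 0 because s > 0. *)
Let truncated_gamma (s : R) n : 1 <= s ->
  (s%:E * \int[leb]_(t in `[0%R, n.+1%:R]) (g (s - 1) t)%:E =
  \int[leb]_(t in `[0%R, n.+1%:R]) (g s t)%:E + (g s n.+1%:R)%:E)%E.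
Proof.
move=> s1; have s0 : 0 <= s by rewrite (le_trans _ s1).
have s10 : 0 <= s - 1 by rewrite subr_ge0.
have n0 : 0 < n.+1%:R :> R by [].
have i1 := ig n s10; have i2 := ig n s0.
rewrite -integralZl//.
have i1s : leb.-integrable `[0, n.+1%:R] (fun t => s%:E * (g (s - 1) t)%:E)%E.
  exact: integrableZl.
have fin2 : (\int[leb]_(t in `[0%R, n.+1%:R]) (g s t)%:E)%E \is a fin_num.
  exact: integrable_fin_num.
rewrite -[LHS](subeK _ fin2) addeC; congr (_ + _)%E.
rewrite -integralB//.
have := @continuous_FTC2 _ (fun t => s * g (s - 1) t - g s t) (g s) _ _ n0.
rewrite /g powR0 ?gt_eqF ?(lt_le_trans _ s1)// mul0r sube0 => <- //.
- have c1 := continuous_within_powR_expRN s10 n0.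
  have c2 := continuous_within_powR_expRN s0 n0.
  by move=> x; apply: cvgB; [apply: cvgMr; exact: c1|exact: c2].
- split.
  + move=> x; rewrite in_itv/= => /andP[x0 _].
    by have [] := is_derive_powR_expRN s x0.
  + apply: cvgM; first exact: powR_cvg_at_right0.
    apply: cvg_at_right_filter.
    by apply: (@is_derive_continuous _ (fun t => expR (- t)) _ _); derive_rules.
  + apply: cvg_at_left_filter.
    exact: is_derive_continuous (is_derive_powR_expRN s n0).
- move=> x; rewrite in_itv/= => /andP[x0 _].
  by rewrite derive1E; have [_ ->] := is_derive_powR_expRN s x0.
Qed.

Let gamma_ereal (s : R) : 1 <= s ->
  (s%:E * \int[leb]_(t in `[0%R, +oo[) (g (s - 1) t)%:E =
  \int[leb]_(t in `[0%R, +oo[) (g s t)%:E)%E.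
Proof.
move=> s1; have s0 : 0 <= s by rewrite (le_trans _ s1).
have cv p := ge0_cvgn_integral (mu := leb) (g0 p) (mg p).
have c1 := cvgeZl (y := s%:E) isT (cv (s - 1)).
have c2 : ((\int[leb]_(t in `[0%R, n%:R]) (g s t)%:E + (g s n%:R)%:E) @[n --> \oo] -->
    \int[leb]_(t in `[0%R, +oo[) (g s t)%:E + 0%:E)%E.
  apply: cvgeD => //; first by rewrite fin_num_adde_defl.
  by apply: cvg_EFin; [exact: nearW|exact: cvg_powR_expRN].
rewrite adde0 in c2; apply: (cvg_unique _ _ c2) => //.
move: c1; rewrite -cvg_shiftS -[X in _ -> X]cvg_shiftS.
by under eq_fun do rewrite /= truncated_gamma//.
Qed.

(** The range 1 <= s keeps the integrand continuous at 0, and it contains all the arguments i + n/2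
    with n >= 2 that occur below. *)
Lemma GammaS (s : R) : 1 <= s -> Gamma (s + 1) = s * Gamma s.
Proof.
move=> s1; have s0 : 0 < s by rewrite (lt_le_trans _ s1).
have GE p : Gamma p = fine (\int[leb]_(t in `[0%R, +oo[) (g (p - 1) t)%:E)%E.
  rewrite /Gamma /Rintegral; congr fine.
  rewrite integral_itv_obnd_cbnd//.
  by apply/measurable_EFinP; apply: measurable_funTS; exact: mg.
rewrite !GE addrK -gamma_ereal//.
(* No finiteness has to be proved: [fine] sends an infinite value to 0 on both sides. *)
case: (\int[leb]_(t in `[0%R, +oo[) (g (s - 1) t)%:E)%E => [r||] //=.
- by rewrite mulry gtr0_sg// mul1e mulr0.
- by rewrite mulrNy gtr0_sg// mul1e mulr0.
Qed.

End gamma_function.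

Section exponential_series.
Context {R : realType} (n : nat).
Local Notation tup := (n.-tuple R).
Local Notation sigma := (@surface_area R n).

Lemma measurable_sphere : measurable (sphere n : set tup).
Proof.
rewrite (_ : sphere n = setT `&` (fun y : tup => tdot y y) @^-1` [set 1]).
  by apply: measurable_tdot_sqr => //; exact: measurable_set1.
by rewrite setTI; apply/seteqP; split=> y; rewrite /sphere/= dotv_tcol.
Qed.

Lemma surface_area_sphereC : sigma (~` sphere n) = 0%E.
Proof.
rewrite /surface_area /cone (_ : _ `&` _ = set0) ?measure0 ?mule0//.
by rewrite -subset0 => y /= [/andP[y0 _]] []; exact: normalize_sphere.
Qed.

Lemma sphere_ae (Q : tup -> Prop) : (forall x, sphere n x -> Q x) -> {ae sigma, forall x, Q x}.
Proof.
move=> SQ; exists (~` sphere n); split.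
- by apply: measurableC; exact: measurable_sphere.
- exact: surface_area_sphereC.
- by move=> x /= nQ /SQ.
Qed.

Lemma bounded_on_sphere_exp (k : R) (v : tup) :
  bounded_on_sphere (fun x => expR (k * tdot v x)).
Proof.
have [m [C vC]] := bounded_on_sphere_tdot v; split.
  by apply: measurableT_comp => //; exact: measurable_funM.
exists (expR (`|k| * C)) => x Sx; rewrite ger0_norm ?expR_ge0// ler_expR.
by rewrite (le_trans (ler_norm _))// normrM ler_wpM2l// vC.
Qed.

Lemma series_exp_coeff_le (x : R) N : `|series (exp_coeff x) N| <= expR `|x|.
Proof.
rewrite /series/= (le_trans (ler_norm_sum _ _ _))//.
rewrite (_ : \sum_(0 <= i < N) _ = series (exp_coeff `|x|) N); last first.
  by apply: eq_bigr => i _; rewrite /exp_coeff/= normrM normrX normfV normr_nat.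
apply: nondecreasing_cvgn_le; last exact: is_cvg_series_exp_coeff.
by apply: nondecreasing_series => i _ _; exact: exp_coeff_ge0.
Qed.

(** Dominated convergence on the sphere; the partial sums of the exponential series at x are bounded
    by exp |x|. *)
Lemma cvg_exponential_series (g : tup -> R) (k : R) (v : tup) : bounded_on_sphere g ->
  series (fun i => k ^+ i / i`!%:R * \int[sigma]_x (g x * tdot v x ^+ i)) @ \oo -->
  \int[sigma]_x (g x * expR (k * tdot v x)).
Proof.
move=> bg; have [mg _] := bg.
pose f_ N x := g x * series (exp_coeff (k * tdot v x)) N.
have bE := bounded_on_sphere_exp k v.
have iE := integrable_surface_area (bounded_on_sphereM bg bE).
have bt i : bounded_on_sphere (fun x => g x * tdot v x ^+ i).
  by apply: bounded_on_sphereM => //; exact/bounded_on_sphereX/bounded_on_sphere_tdot.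
have mt : measurable_fun setT (fun x : tup => k * tdot v x).
  by apply: measurable_funM => //; exact: measurable_tdot.
have bf N : bounded_on_sphere (f_ N).
  rewrite /f_ /series/=; elim: N => [|N ih].
    by under eq_fun do rewrite big_nil mulr0; exact: bounded_on_sphere_cst.
  under eq_fun do rewrite big_nat_recr//= mulrDr.
  apply: bounded_on_sphereD => //; apply: bounded_on_sphereM => //.
  apply: bounded_on_sphereM; last exact: bounded_on_sphere_cst.
  apply: bounded_on_sphereX; apply: bounded_on_sphereM.
    exact: bounded_on_sphere_cst.
  exact: bounded_on_sphere_tdot.
have serE N : series (fun i => k ^+ i / i`!%:R * \int[sigma]_x (g x * tdot v x ^+ i)) N =
    \int[sigma]_x f_ N x.
  elim: N => [|N ih].
    rewrite /series/= big_nil /f_ /Rintegral integral0_eq// => x _.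
    by rewrite /series/= big_nil mulr0.
  rewrite seriesSr ih -RintegralZl//; last exact: integrable_surface_area.
  rewrite -RintegralD//; last 2 first.
  - exact: integrable_surface_area.
  - exact: (integrableZl _ (k ^+ N / N`!%:R) (integrable_surface_area (bt N))).
  apply: eq_Rintegral => x _; rewrite /f_ seriesSr mulrDr; congr (_ + _).
  by rewrite /exp_coeff/= exprMn; ring.
rewrite (_ : series _ = fun N => \int[sigma]_x f_ N x); last exact/funext.
have bG : bounded_on_sphere (fun x => `|g x| * expR `|k * tdot v x|).
  have [_ [D eD]] := bounded_on_sphere_exp `|k| v.
  have [_ [C gC]] := bg; have [_ [E tE]] := bounded_on_sphere_tdot v.
  split.
    apply: measurable_funM; first exact: measurableT_comp.
    by apply: measurableT_comp => //; exact: measurableT_comp.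
  exists (C * expR (`|k| * E)) => x Sx; rewrite normrM normr_id.
  rewrite ler_pM ?gC// ger0_norm ?expR_ge0// ler_expR normrM ler_wpM2l//.
  exact: tE.
have [| | | | |_ _] := @dominated_convergence _ _ _ sigma setT measurableT
  (fun N x => (f_ N x)%:E) (fun x => (g x * expR (k * tdot v x))%:E)
  (fun x => (`|g x| * expR `|k * tdot v x|)%:E).
- by move=> N; apply/measurable_EFinP; have [] := bf N.
- by apply/measurable_EFinP; apply: measurable_funM => //; have [] := bE.
- apply: sphere_ae => x _ _; apply: cvg_EFin; first exact: nearW.
  by apply: cvgMr; exact: is_cvg_series_exp_coeff.
- exact: integrable_surface_area.
- apply: sphere_ae => x _ N _; rewrite lee_fin normrM ler_wpM2l//.
  exact: series_exp_coeff_le.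
have finE : (\int[sigma]_x (g x * expR (k * tdot v x))%:E)%E \is a fin_num.
  exact: integrable_fin_num iE.
by rewrite -(fineK finE) => /fine_cvg.
Qed.

End exponential_series.

(** * Moments of the surface measure weighted by exp (k mu.x) *)

Section exponential_moments.
Context {R : realType} (n : nat).
Local Notation tup := (n.-tuple R).
Local Notation sigma := (@surface_area R n).
Variables (mu : tup) (k : R).
Hypotheses (n2 : (2 <= n)%N) (mu1 : tdot mu mu = 1).

Let n0 : (0 < n)%N. Proof. exact: ltnW. Qed.

Definition exp_moment j := \int[sigma]_x (tdot mu x ^+ j * expR (k * tdot mu x)).

Definition sphere_moment j := \int[sigma]_x (tdot mu x ^+ j).

Local Notation F := exp_moment.
Local Notation m := sphere_moment.

Let c i : R := k ^+ i / i`!%:R.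

Let cS i : c i.+1 * i.+1%:R = k * c i.
Proof. by rewrite /c exprS factS natrM invfM; field; rewrite ?nat1r !pnatr_eq0 -lt0n fact_gt0. Qed.

Let sum_shift (a : nat -> R) N :
  series (fun i => c i * (i%:R * a i)) N.+1 = k * series (fun i => c i * a i.+1) N.
Proof.
rewrite /series/= big_nat_recl// mul0r mulr0 add0r mulr_sumr.
apply: eq_bigr => i _; transitivity (c i.+1 * i.+1%:R * a i.+1); first by rewrite mulrA.
by rewrite cS mulrA.
Qed.

Lemma bounded_on_sphere_tdotX (u : tup) j : bounded_on_sphere (fun x => tdot u x ^+ j).
Proof. exact/bounded_on_sphereX/bounded_on_sphere_tdot. Qed.

Lemma cvg_exp_moment j : series (fun i => c i * m (j + i)) @ \oo --> F j.
Proof.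
have := cvg_exponential_series (k := k) (v := mu) (bounded_on_sphere_tdotX mu j).
rewrite (_ : series _ = series (fun i => c i * m (j + i)))//; congr series.
apply/funext => i; rewrite /m; congr (_ * _).
by apply: eq_Rintegral => x _; rewrite exprD.
Qed.

Lemma sphere_momentS i : ((i + n)%:R - 1) * m i.+1 = i%:R * m i.-1.
Proof.
have := Rintegral_sphere_stein n0 mu mu i; rewrite mu1 mulr1 => <-.
by congr (_ * _); apply: eq_Rintegral => x _; rewrite exprS.
Qed.

(** The polynomial identity in degree j + i, multiplied by k^i / i! and summed over i; the weight
    [i] shifts the series and produces the factor [k]. *)
Lemma exp_moment_stein j :
  (j%:R + n%:R - 1) * F j.+1 + k * F j.+2 = j%:R * F j.-1 + k * F j.
Proof.
(* The truncations at [N.+1] and [N] compensate the shift of index, so that the two sides agree for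
   every [N] and not only in the limit. *)
have c1 : (fun N => ((j%:R + n%:R - 1) * series (fun i => c i * m (j.+1 + i)) N.+1 +
    k * series (fun i => c i * m (j.+2 + i)) N)) @ \oo -->
    (j%:R + n%:R - 1) * F j.+1 + k * F j.+2.
  by apply: cvgD; apply: cvgMr; [rewrite cvg_shiftS|]; exact: cvg_exp_moment.
have c2 : (fun N => (j%:R * series (fun i => c i * m (j.-1 + i)) N.+1 +
    k * series (fun i => c i * m (j + i)) N)) @ \oo -->
    j%:R * F j.-1 + k * F j.
  by apply: cvgD; apply: cvgMr; [rewrite cvg_shiftS|]; exact: cvg_exp_moment.
rewrite -(cvg_lim _ c1)// -(cvg_lim _ c2)//; congr (limn _); apply/funext => N.
rewrite (_ : (fun i => c i * m (j.+2 + i)) = (fun i => c i * m (j + i.+1).+1)); last first.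
  by apply/funext => i; rewrite addnS !addSn.
rewrite (_ : (fun i => c i * m (j + i)) = (fun i => c i * m (j + i.+1).-1)); last first.
  by apply/funext => i; rewrite addnS.
rewrite -!(sum_shift (fun i => m (j + i).+1)) -!(sum_shift (fun i => m (j + i).-1)).
rewrite /series/= !mulr_sumr -!big_split/=; apply: eq_bigr => i _.
have := sphere_momentS (j + i); rewrite !natrD => h.
have -> : j%:R * (c i * m (j.-1 + i)) = c i * (j%:R * m (j + i).-1).
  by case: (j) => [|j']; rewrite ?mul0r ?mulr0//= mulrCA.
transitivity (c i * ((j%:R + i%:R + n%:R - 1) * m (j + i).+1)); last by rewrite h; ring.
by rewrite addSn; ring.
Qed.

(** Every term of the series vanishes by Stein's identity, since u.mu = 0 and the factor j + i + n -
    1 is nonzero for n >= 2. *)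
Lemma exp_moment_orthogonal (u : tup) j : tdot u mu = 0 ->
  \int[sigma]_x (tdot u x * tdot mu x ^+ j * expR (k * tdot mu x)) = 0.
Proof.
move=> u0.
have bg : bounded_on_sphere (fun x => tdot u x * tdot mu x ^+ j).
  by apply: bounded_on_sphereM; [exact: bounded_on_sphere_tdot|exact: bounded_on_sphere_tdotX].
have := cvg_exponential_series (k := k) (v := mu) bg.
rewrite (_ : series _ = fun=> 0); first by move/(cvg_unique _ (cvg_cst _)) => <-.
apply/funext => N; rewrite /series/= big1// => i _.
rewrite (_ : \int[sigma]_x _ = \int[sigma]_x (tdot u x * tdot mu x ^+ (j + i))); last first.
  by apply: eq_Rintegral => x _; rewrite exprD mulrA.
have := Rintegral_sphere_stein n0 u mu (j + i); rewrite u0 mulr0 mul0r => /eqP.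
rewrite mulf_eq0 subr_eq0 pnatr_eq1 => /orP[|/eqP ->]; last by rewrite mulr0.
by rewrite gtn_eqF// (leq_trans n2)// leq_addl.
Qed.

Hypothesis k0 : 0 < k.
Let h : R := n%:R / 2.

Let G i := Gamma (i%:R + h).

Let GS i : G i.+1 = (i%:R + h) * G i.
Proof.
rewrite /G -natr1 addrAC GammaS// /h ler_wpDl// ler_pdivlMr// mul1r.
by rewrite ler_nat.
Qed.

(** The even moments are m 0 times (2i)! Gamma(h) / (i! 4^i Gamma(i + h)), stated without division
    because the nonvanishing of Gamma is derived only later. *)
Let even_moment i : m i.*2 * (i`!%:R * G i * 4 ^+ i) = (i.*2)`!%:R * (m 0 * G 0).
Proof.
elim: i => [|i ih]; first by rewrite fact0 expr0 !mul1r mulr1.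
have := sphere_momentS i.*2.+1; rewrite /= addSn -natr1 addrK natrD => mS.
have -> : m i.+1.*2 * (i.+1`!%:R * G i.+1 * 4 ^+ i.+1) =
   (((i.*2)%:R + n%:R) * m i.*2.+2) * (2 * i.+1%:R * (i`!%:R * G i * 4 ^+ i)).
  rewrite doubleS GS factS natrM exprS /h -(mul2n i) natrM.
  by field.
rewrite mS mulrAC -mulrA.
transitivity (i.*2.+1%:R * (2 * i.+1%:R) * (m i.*2 * (i`!%:R * G i * 4 ^+ i))).
  by ring.
rewrite ih doubleS !factS !natrM -(doubleS i) -(mul2n i.+1) natrM.
by ring.
Qed.

Let odd_moment i : m i.*2.+1 = 0.
Proof.
elim: i => [|i ih].
  have := sphere_momentS 0; rewrite add0n mul0r => /eqP; rewrite mulf_eq0.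
  by rewrite subr_eq0 pnatr_eq1 gtn_eqF//= => /eqP.
have := sphere_momentS i.*2.+2; rewrite /= ih mulr0 => /eqP; rewrite mulf_eq0.
by rewrite subr_eq0 pnatr_eq1 gtn_eqF ?(leq_trans n2) ?leq_addl//= => /eqP.
Qed.

Let bterm nu i := (k / 2) `^ (i.*2%:R + nu) / (i`!%:R * Gamma (i%:R + nu + 1)).

Let k20 : 0 < k / 2. Proof. by rewrite divr_gt0. Qed.

Let powk i nu : (k / 2) `^ (i%:R + nu) = (k / 2) ^+ i * (k / 2) `^ nu.
Proof.
rewrite powRD; first by rewrite powR_mulrn// ltW.
by rewrite (gt_eqF k20) implybT.
Qed.

(** Up to one common constant [C], the series of [F 0] and of [F 1] are the Bessel series of orders
    h - 1 and h: only even moments survive, and multiplying by t shifts them by one degree. *)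
Lemma exp_moment_bessel : F 0 != 0 -> besselI (h - 1) k != 0 ->
  F 1 * besselI (h - 1) k = F 0 * besselI h k.
Proof.
move=> F00 I00.
(* If [G 0] were 0, the recursion would make every [G i] vanish; inverses of 0 being 0, all terms of
   the Bessel series would be 0, against [I00]. *)
have G00 : G 0 != 0.
  apply: contraNneq I00 => G00; rewrite /besselI.
  rewrite (_ : series _ = fun=> 0); first by rewrite lim_cst.
  apply/funext => N; rewrite /series/= big1// => i _.
  rewrite (_ : i%:R + (h - 1) + 1 = i%:R + h); last by ring.
  have Gi0 : G i = 0 by elim: i => [|i ih]; [exact: G00|rewrite GS ih mulr0].
  by rewrite -/(G i) Gi0 mulr0 invr0 mulr0.
have Gn0 i : G i != 0.
  elim: i => [|i ih]; first exact: G00.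
  have ih0 : i%:R + h != 0 by rewrite gt_eqF// ltr_wpDl// divr_gt0// ltr0n.
  by rewrite GS; exact: mulf_neq0 ih0 ih.
pose C := m 0 * G 0 * (k / 2) `^ (1 - h).
have pw1 : (k / 2) `^ (1 - h) * (k / 2) `^ (h - 1) = 1.
  rewrite -powRD; first by rewrite addrA subrK subrr powRr0.
  by rewrite (gt_eqF k20) implybT.
have pwh : (k / 2) `^ h = k / 2 * (k / 2) `^ (h - 1).
  have := powk 1 (h - 1); rewrite expr1 => <-.
  by congr (_ `^ _); ring.
have f0 i : i`!%:R != 0 :> R by rewrite pnatr_eq0 -lt0n fact_gt0.
have four0 i : 4 ^+ i != 0 :> R by rewrite expf_neq0// pnatr_eq0.
have k2X i : (k / 2) ^+ i.*2 = k ^+ i.*2 / 4 ^+ i.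
  rewrite expr_div_n; congr (_ / _).
  by rewrite -mul2n exprM; congr (_ ^+ _); rewrite expr2 -natrM.
have mE i : m i.*2 = (i.*2)`!%:R * (m 0 * G 0) / (i`!%:R * G i * 4 ^+ i).
  apply: (canRL (mulfK _)); last exact: even_moment.
  exact: mulf_neq0 (mulf_neq0 (f0 i) (Gn0 i)) (four0 i).
move: pw1 pwh; set Q := (k / 2) `^ (1 - h); set P := (k / 2) `^ (h - 1) => pw1 pwh.
have Q0 : Q != 0 by apply: contraTneq (oner_neq0 R) => Q0; rewrite -pw1 Q0 mul0r eqxx.
have PE : P = Q^-1 by rewrite -[LHS]mul1r -(mulVf Q0) -mulrA pw1 mulr1.
(* Terms 2i and 2i + 1 are taken together. Exactly one of the two contains an even moment: the first
   for j = 0, the second for j = 1. *)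
have t0 i : C * bterm (h - 1) i = c i.*2 * m (0 + i.*2) + c i.*2.+1 * m (0 + i.*2.+1).
  rewrite !add0n odd_moment mulr0 addr0 /bterm.
  rewrite (_ : i%:R + (h - 1) + 1 = i%:R + h); last by ring.
  rewrite -/(G i) powk -/P PE /C -/Q /c mE k2X.
  have fi := f0 i; have fo := f0 i.*2; have gi := Gn0 i; have p4 := four0 i.
  move: (i`!%:R : R) (i.*2`!%:R : R) (G i) (4 ^+ i : R)
    (m 0 * G 0) fi fo gi p4 => x2 x3 x4 x5 x6 ? ? ? ?.
  by field; do ?[apply/andP; split].
have t1 i : C * bterm h i = c i.*2 * m (1 + i.*2) + c i.*2.+1 * m (1 + i.*2.+1).
  rewrite add1n odd_moment mulr0 add0r /bterm.
  rewrite (_ : i%:R + h + 1 = i.+1%:R + h); last by rewrite -natr1; ring.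
  rewrite -/(G i.+1) powk pwh PE /C -/Q /c add1n -doubleS mE k2X doubleS.
  have i1 : i.+1%:R != 0 :> R by rewrite pnatr_eq0.
  have e1 : i.+1`!%:R = i.+1%:R * i`!%:R :> R by rewrite factS natrM.
  have e2 : i.*2.+2`!%:R = 2 * i.+1%:R * i.*2.+1`!%:R :> R.
    by rewrite factS natrM -doubleS -mul2n natrM.
  have fi := f0 i; have fo := f0 i.*2.+1; have gi := Gn0 i.+1; have p4 := four0 i.
  rewrite e1 e2 (exprS 4) (exprS k).
  move: (i.+1%:R : R) (i`!%:R : R) (i.*2.+1`!%:R : R) (G i.+1) (4 ^+ i : R)
    (m 0 * G 0) i1 fi fo gi p4 => x1 x2 x3 x4 x5 x6 ? ? ? ? ?.
  by field; do ?[apply/andP; split].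
(* The sums of pairs are the partial sums of even length, a subsequence with the same limit. *)
have dbl (a : nat -> R) N : series a N.*2 = series (fun i => a i.*2 + a i.*2.+1) N.
  elim: N => [|N ih]; first by rewrite /series/= !big_nil.
  by rewrite doubleS !seriesSr ih addrA.
have sub (a : nat -> R) (l : R) : series a @ \oo --> l ->
    series (fun i => a i.*2 + a i.*2.+1) @ \oo --> l.
  move=> al; rewrite (_ : series _ = series a \o muln 2); last first.
    by apply/funext => N /=; rewrite mul2n dbl.
  by apply: cvg_comp al; exact: cvg_mulnl.
have scal (a : nat -> R) N : series (fun i => C * a i) N = C * series a N.
  by rewrite /series/= mulr_sumr.
have lim0 j nu : (forall i, C * bterm nu i =
      c i.*2 * m (j + i.*2) + c i.*2.+1 * m (j + i.*2.+1)) ->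
    C * series (bterm nu) N @[N --> \oo] --> F j.
  move=> t; have := sub _ _ (@cvg_exp_moment j).
  rewrite (_ : series _ = fun N => C * series (bterm nu) N)//.
  by apply/funext => N; rewrite -scal; apply: eq_bigr => i _; rewrite t.
have l0 := lim0 _ _ t0; have l1 := lim0 _ _ t1.
have C0 : C != 0.
  apply: contraNneq F00 => C0; apply/eqP.
  by rewrite -(cvg_lim _ l0)// C0; under eq_fun do rewrite mul0r; rewrite lim_cst.
have bess nu (l : R) : C * series (bterm nu) N @[N --> \oo] --> l -> besselI nu k = C^-1 * l.
  move=> cl; apply/cvg_lim => //.
  rewrite (_ : series _ = fun N => C^-1 * (C * series (bterm nu) N)).
    exact: cvgMr.
  by apply/funext => N; rewrite mulKf.
by rewrite (bess _ _ l0) (bess _ _ l1) mulrCA mulrC; ring.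
Qed.

End exponential_moments.

(** * Moments of the von Mises-Fisher distribution *)

Section sphere_order.
Context {R : realType} (n : nat).
Hypothesis n0 : (0 < n)%N.
Local Notation sigma := (@surface_area R n).

(** Turns facts known on the sphere alone into pointwise ones, as [normalize] maps the punctured
    ball into the sphere. *)
Let Rintegral_polar0 (g : n.-tuple R -> R) : bounded_on_sphere g ->
  \int[sigma]_x g x =
  n%:R * \int[lebesgue_tuple n]_y (g (normalize y) * \1_(@punctured_ball R n) y).
Proof.
move=> bg; have := Rintegral_ball_polar n0 0 bg; rewrite add0n.
under eq_Rintegral do rewrite expr0 mulr1.
by move=> ->; rewrite mulVKf// pnatr_eq0 -lt0n.
Qed.

Lemma Rintegral_sphere_ge0 (g : n.-tuple R -> R) : bounded_on_sphere g ->
  (forall x, sphere n x -> 0 <= g x) -> 0 <= \int[sigma]_x g x.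
Proof.
move=> bg g0; rewrite Rintegral_polar0// mulr_ge0//; apply: Rintegral_ge0 => y _.
rewrite indicE; have [|] := boolP (y \in _); rewrite ?mulr0// mulr1.
by rewrite in_punctured_ball => /andP[y0 _]; exact/g0/normalize_sphere.
Qed.

Lemma eq_Rintegral_sphere (f g : n.-tuple R -> R) : bounded_on_sphere f ->
  bounded_on_sphere g -> (forall x, sphere n x -> f x = g x) ->
  \int[sigma]_x f x = \int[sigma]_x g x.
Proof.
move=> bf bg fg; rewrite !Rintegral_polar0//; congr (_ * _).
apply: eq_Rintegral => y _; rewrite indicE.
have [|] := boolP (y \in _); rewrite ?mulr0// !mulr1.
by rewrite in_punctured_ball => /andP[y0 _]; exact/fg/normalize_sphere.
Qed.

End sphere_order.

Section vmf_law.
Context {R : realType} (n : nat).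
Local Notation tup := (n.-tuple R).
Local Notation sigma := (@surface_area R n).
Variables (mu : tup) (k : R) (Q : probability tup R).
Hypotheses (n2 : (2 <= n)%N) (mu1 : tdot mu mu = 1) (k0 : 0 < k).
Hypothesis QE : forall A, measurable A -> Q A = vmf mu k A.

Let n0 : (0 < n)%N. Proof. exact: ltnW. Qed.

Local Notation F := (exp_moment mu k).

Let c : R := k `^ (n%:R / 2 - 1) / ((2 * pi) `^ (n%:R / 2) * besselI (n%:R / 2 - 1) k).

Let pdfE x : vmf_pdf mu k x = c * expR (k * tdot mu x).
Proof. by rewrite /vmf_pdf dotv_tcol. Qed.

Let bexp := bounded_on_sphere_exp k mu.

(** The assumed law has total mass 1. Hence [F 0] and [c] are positive, and the Bessel value in the
    denominator of [c] cannot be 0, as [c] would then be 0. *)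
Let cF0 : c * F 0 = 1.
Proof.
have := QE measurableT; rewrite probability_setT /vmf.
rewrite (_ : (\int[sigma]_x (vmf_pdf mu k x)%:E)%E = (c * F 0)%:E); first by case.
rewrite /exp_moment (_ : \int[sigma]_x _ = \int[sigma]_x expR (k * tdot mu x)); last first.
  by apply: eq_Rintegral => x _; rewrite expr0 mul1r.
rewrite -RintegralZl//; last exact: integrable_surface_area.
rewrite /Rintegral fineK.
  by apply: eq_integral => x _; rewrite pdfE.
apply: integrable_fin_num => //.
exact: (integrableZl _ c (integrable_surface_area bexp)).
Qed.

Let F00 : 0 < F 0.
Proof.
have : 0 <= F 0.
  by apply: Rintegral_ge0 => x _; rewrite expr0 mul1r expR_ge0.
rewrite le_eqVlt => /predU1P[F00|//].
by have := cF0; rewrite -F00 mulr0 => /eqP; rewrite eq_sym oner_eq0.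
Qed.

Let c0 : 0 < c.
Proof. by rewrite -(pmulr_lgt0 _ F00) cF0. Qed.

Let bessel0 : besselI (n%:R / 2 - 1) k != 0.
Proof. by apply: contraTneq c0 => b0; rewrite /c b0 mulr0 invr0 mulr0 ltxx. Qed.

Let mpdf : measurable_fun setT (vmf_pdf mu k).
Proof.
rewrite (_ : vmf_pdf _ _ = fun x => c * expR (k * tdot mu x)).
  by apply: measurable_funM => //; have [] := bexp.
by apply/funext => x; rewrite pdfE.
Qed.

Let pdf0 x : 0 <= vmf_pdf mu k x.
Proof. by rewrite pdfE mulr_ge0 ?expR_ge0// ltW. Qed.

Let ipdf (g : tup -> R) : bounded_on_sphere g ->
  sigma.-integrable setT (fun x => (g x * vmf_pdf mu k x)%:E).
Proof.
move=> bg; rewrite (_ : (fun _ => _) = (fun x => c%:E * (EFin \o (fun x => g x * expR (k * tdot mu x))%R) x)%E).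
  by apply: integrableZl => //; exact: integrable_surface_area (bounded_on_sphereM bg bexp).
by apply/funext => x; rewrite pdfE /= -EFinM mulrCA.
Qed.

Lemma integrable_vmf (g : tup -> R) : bounded_on_sphere g ->
  Q.-integrable setT (EFin \o g).
Proof.
move=> bg; have [mg _] := bg.
by apply: (integrable_density (@measurable_id _ tup setT) mpdf pdf0 QE mg); exact: ipdf.
Qed.

Lemma Rintegral_vmf (g : tup -> R) : bounded_on_sphere g ->
  \int[Q]_x g x = (\int[sigma]_x (g x * expR (k * tdot mu x))) / F 0.
Proof.
move=> bg; have [mg _] := bg.
have -> : (F 0)^-1 = c by rewrite -[LHS]mul1r -cF0 mulfK// gt_eqF.
rewrite mulrC -RintegralZl//; last exact: integrable_surface_area (bounded_on_sphereM bg bexp).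
rewrite /Rintegral (integral_density (@measurable_id _ tup setT) mpdf pdf0 QE mg (ipdf bg)).
by congr fine; apply: eq_integral => x _; rewrite pdfE mulrCA.
Qed.

Lemma Rintegral_vmf_ge0 (g : tup -> R) : bounded_on_sphere g ->
  (forall x, sphere n x -> 0 <= g x) -> 0 <= \int[Q]_x g x.
Proof.
move=> bg g0; rewrite Rintegral_vmf//; apply: divr_ge0; last exact: ltW.
apply: Rintegral_sphere_ge0 => //; first exact: bounded_on_sphereM.
by move=> x Sx; rewrite mulr_ge0 ?expR_ge0// g0.
Qed.

Lemma eq_Rintegral_vmf (f g : tup -> R) : bounded_on_sphere f -> bounded_on_sphere g ->
  (forall x, sphere n x -> f x = g x) -> \int[Q]_x f x = \int[Q]_x g x.
Proof.
move=> bf bg fg; rewrite !Rintegral_vmf//; congr (_ / _).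
apply: eq_Rintegral_sphere => //; try exact: bounded_on_sphereM.
by move=> x Sx; rewrite fg.
Qed.

Let M j := \int[Q]_x (tdot mu x ^+ j).

Let ME j : M j = F j / F 0.
Proof. by rewrite /M Rintegral_vmf//; exact: bounded_on_sphere_tdotX. Qed.

Let M0 : M 0 = 1.
Proof. by rewrite ME divff// gt_eqF. Qed.

Let Mstein j : (j%:R + n%:R - 1) * M j.+1 + k * M j.+2 = j%:R * M j.-1 + k * M j.
Proof.
by rewrite !ME !mulrA -!mulrDl exp_moment_stein.
Qed.

Lemma vmf_mean_bessel :
  \int[Q]_x tdot mu x = besselI (n%:R / 2) k / besselI (n%:R / 2 - 1) k.
Proof.
have := ME 1; rewrite /M.
under eq_Rintegral do rewrite expr1.
move=> ->; apply/eqP; rewrite eqr_div//; last exact: lt0r_neq0.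
apply/eqP; rewrite [RHS]mulrC.
by apply: exp_moment_bessel => //; exact: lt0r_neq0.
Qed.

Definition vmf_tangent := \int[Q]_x (1 - tdot mu x ^+ 2).

Local Notation m := vmf_tangent.

Let iX j : Q.-integrable setT (EFin \o (fun x => tdot mu x ^+ j)).
Proof. by apply: integrable_vmf; exact: bounded_on_sphere_tdotX. Qed.

Let mE : m = 1 - M 2.
Proof.
transitivity (\int[Q]_x (tdot mu x ^+ 0 - tdot mu x ^+ 2)).
  by apply: eq_Rintegral => x _; rewrite expr0.
by rewrite (RintegralB _ (iX 0) (iX 2))// -/(M 0) M0.
Qed.

Let M1E : M 1 = \int[Q]_x tdot mu x.
Proof. by apply: eq_Rintegral => x _; rewrite expr1. Qed.

Lemma vmf_mean_tangent : (n%:R - 1) * \int[Q]_x tdot mu x = k * m.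
Proof. by have := Mstein 0; rewrite M0 mE -M1E; lra. Qed.

(** Cauchy-Schwarz: |x - t mu|^2 with t = mu.x equals 1 - t^2 on the sphere. *)
Lemma sphere_tdot_sqr_le1 x : sphere n x -> tdot mu x ^+ 2 <= 1.
Proof.
rewrite /sphere/= dotv_tcol => x1.
have : 0 <= \sum_(i < n) (tnth x i - tdot mu x * tnth mu i) ^+ 2.
  by apply: sumr_ge0 => i _; exact: sqr_ge0.
have key (t : R) : \sum_(i < n) (tnth x i - t * tnth mu i) ^+ 2 =
    tdot x x - 2 * t * tdot mu x + t ^+ 2 * tdot mu mu.
  rewrite /tdot !mulr_sumr -sumrB -big_split/=.
  by apply: eq_bigr => i _; ring.
by rewrite key x1 mu1; nra.
Qed.

Let lin (a0 a1 a2 a3 a4 : R) :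
  \int[Q]_x (a0 + a1 * tdot mu x + a2 * tdot mu x ^+ 2 + a3 * tdot mu x ^+ 3 + a4 * tdot mu x ^+ 4)
  = a0 + a1 * M 1 + a2 * M 2 + a3 * M 3 + a4 * M 4.
Proof.
have bX j (a : R) : bounded_on_sphere (fun x => a * tdot mu x ^+ j).
  by apply: bounded_on_sphereM; [exact: bounded_on_sphere_cst|exact: bounded_on_sphere_tdotX].
have Z j (a : R) : \int[Q]_x (a * tdot mu x ^+ j) = a * M j by rewrite RintegralZl.
have step f j (a : R) : bounded_on_sphere f ->
    \int[Q]_x (f x + a * tdot mu x ^+ j) = \int[Q]_x f x + a * M j.
  by move=> bf; rewrite RintegralD ?Z//; exact: integrable_vmf.
have b0 := bounded_on_sphere_cst n a0.
have b1 := bounded_on_sphereD b0 (bX 1 a1).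
have b2 := bounded_on_sphereD b1 (bX 2 a2).
have b3 := bounded_on_sphereD b2 (bX 3 a3).
rewrite step// step// step//; congr (_ + _ + _ + _).
have := step _ 1 a1 b0; under eq_Rintegral do rewrite expr1.
move=> ->; congr (_ + _).
have -> : \int[Q]_x a0 = a0 * M 0.
  by rewrite -Z; apply: eq_Rintegral => x _; rewrite expr0 mulr1.
by rewrite M0 mulr1.
Qed.

(** No almost-everywhere argument is needed: E [(1 - t) (1 - t^2)] >= 0, together with Stein's
    identity for g = t, gives (n + k) m >= n - 1 > 0. *)
Lemma vmf_tangent_gt0 : 0 < m.
Proof.
have : 0 <= \int[Q]_x ((1 - tdot mu x) * (1 - tdot mu x ^+ 2)).
  apply: Rintegral_vmf_ge0 => [|x Sx].
    have bt := bounded_on_sphere_tdotX mu 2; have b1 := bounded_on_sphere_tdot mu.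
    have bN (f : tup -> R) : bounded_on_sphere f -> bounded_on_sphere (fun x => 1 - f x).
      move=> bf; under eq_fun do rewrite -mulN1r.
      apply: bounded_on_sphereD; first exact: bounded_on_sphere_cst.
      by apply: bounded_on_sphereM => //; exact: bounded_on_sphere_cst.
    by apply: bounded_on_sphereM; exact: bN.
  have x1 := sphere_tdot_sqr_le1 Sx.
  by rewrite mulr_ge0 ?subr_ge0//; nra.
rewrite (_ : \int[Q]_x _ = 1 + (-1) * M 1 + (-1) * M 2 + 1 * M 3 + 0 * M 4); last first.
  by rewrite -lin; apply: eq_Rintegral => x _; ring.
have := Mstein 1 => /=; rewrite M0 mE => h1 h2.
have n1 : 2 <= n%:R :> R by rewrite ler_nat.
suff : 0 < (n%:R + k) * (1 - M 2) by rewrite pmulr_rgt0// addr_gt0// (lt_le_trans _ n1).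
have : k * (M 1 - M 3) <= k * (1 - M 2) by rewrite ler_pM2l//; lra.
lra.
Qed.

Definition vmf_score x := k * (1 - tdot mu x ^+ 2) - (n%:R - 1) * tdot mu x.

Lemma vmf_score_mean : \int[Q]_x vmf_score x = 0.
Proof.
rewrite (_ : \int[Q]_x _ = k + (- (n%:R - 1)) * M 1 + (- k) * M 2 + 0 * M 3 + 0 * M 4); last first.
  by rewrite -lin; apply: eq_Rintegral => x _; rewrite /vmf_score; ring.
by have := Mstein 0; rewrite M0; lra.
Qed.

(** The value a = 0 gives the variance of the score, and a = m the square whose positivity bounds it
    from below. *)
Let score_sqr (a : R) : \int[Q]_x ((vmf_score x + a * tdot mu x) ^+ 2) =
  k ^+ 2 + (- 2 * k * (n%:R - 1 - a)) * M 1 +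
  ((n%:R - 1 - a) ^+ 2 - 2 * k ^+ 2) * M 2 +
  (2 * k * (n%:R - 1 - a)) * M 3 + k ^+ 2 * M 4.
Proof. by rewrite -lin; apply: eq_Rintegral => x _; rewrite /vmf_score; ring. Qed.

Let stein0 : (n%:R - 1) * M 1 + k * M 2 - k = 0.
Proof. by have := Mstein 0; rewrite M0; lra. Qed.

Let stein1 : n%:R * M 2 + k * M 3 - 1 - k * M 1 = 0.
Proof. by have /= := Mstein 1; rewrite M0; lra. Qed.

Let stein2 : (n%:R + 1) * M 3 + k * M 4 - 2 * M 1 - k * M 2 = 0.
Proof. by have /= := Mstein 2; lra. Qed.

Lemma vmf_score_variance : \int[Q]_x (vmf_score x ^+ 2) = 2 * (n%:R - 1) - (n%:R + 1) * m.
Proof.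
have -> : \int[Q]_x (vmf_score x ^+ 2) = \int[Q]_x ((vmf_score x + 0 * tdot mu x) ^+ 2).
  by apply: eq_Rintegral => x _; rewrite mul0r addr0.
rewrite score_sqr mE; apply/eqP; rewrite -subr_eq0; apply/eqP.
(* The coefficients k, n - 3 and -k of the three identities are determined by eliminating [M 4],
   [M 3] and [M 1] in this order. *)
transitivity (k * ((n%:R + 1) * M 3 + k * M 4 - 2 * M 1 - k * M 2) +
  (n%:R - 3) * (n%:R * M 2 + k * M 3 - 1 - k * M 1) -
  k * ((n%:R - 1) * M 1 + k * M 2 - k)); first by ring.
by rewrite stein0 stein1 stein2 !mulr0 addr0 subr0.
Qed.

(* The score is correlated with [t]: its covariance with [t] is [-m], so it
   cannot vanish almost surely. *)
Lemma vmf_score_variance_gt0 : 0 < \int[Q]_x (vmf_score x ^+ 2).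
Proof.
have : 0 <= \int[Q]_x ((vmf_score x + m * tdot mu x) ^+ 2).
  by apply: Rintegral_ge0 => x _; exact: sqr_ge0.
have m0 := vmf_tangent_gt0.
have -> : \int[Q]_x (vmf_score x ^+ 2) = \int[Q]_x ((vmf_score x + 0 * tdot mu x) ^+ 2).
  by apply: eq_Rintegral => x _; rewrite mul0r addr0.
rewrite !score_sqr => q0.
have M2E : M 2 = 1 - m by rewrite mE; ring.
have kM : k * (M 1 - M 3) = n%:R * M 2 - 1 by have := stein1; lra.
(* As E [s t] = -m and [M 2] = 1 - m, the mean of (s + m t)^2 is Var s - m^2 - m^3; its
   nonnegativity gives this lower bound. *)
have mm0 : 0 < m ^+ 2 + m ^+ 3 by rewrite addr_gt0// exprn_gt0.
apply: (lt_le_trans mm0); rewrite -subr_ge0.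
rewrite (_ : _ - _ = k ^+ 2 + - 2 * k * (n%:R - 1 - m) * M 1 +
  ((n%:R - 1 - m) ^+ 2 - 2 * k ^+ 2) * M 2 + 2 * k * (n%:R - 1 - m) * M 3 +
  k ^+ 2 * M 4)//.
transitivity (k ^+ 2 + - 2 * k * (n%:R - 1 - m) * M 1 +
  ((n%:R - 1 - m) ^+ 2 - 2 * k ^+ 2) * M 2 + 2 * k * (n%:R - 1 - m) * M 3 +
  k ^+ 2 * M 4 - 2 * m * (k * (M 1 - M 3)) +
  (2 * m * (n%:R - 1) - m ^+ 2) * M 2 - m ^+ 2 - m ^+ 3); first by ring.
by rewrite kM M2E; ring.
Qed.

Lemma vmf_orthogonal (u : tup) j : tdot u mu = 0 ->
  \int[Q]_x (tdot u x * tdot mu x ^+ j) = 0.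
Proof.
move=> u0; rewrite Rintegral_vmf.
  by rewrite exp_moment_orthogonal// mul0r.
by apply: bounded_on_sphereM; [exact: bounded_on_sphere_tdot|exact: bounded_on_sphere_tdotX].
Qed.

End vmf_law.

(** * Sums of independent bounded variables *)

Section bounded_expectation.
Context d0 (T0 : measurableType d0) (R : realType) (P0 : probability T0 R).

Lemma integrable_bounded (f : T0 -> R) (C : R) :
  measurable_fun setT f -> (forall x, `|f x| <= C) -> P0.-integrable setT (EFin \o f).
Proof.
move=> mf fC; apply: (@integrable_bounded_support R _ _ P0 setT f C) => //; last by move=> x [].
by rewrite (le_lt_trans (probability_le1 P0 measurableT))// ltry.
Qed.

Lemma Rintegral_cst_prob (c : R) :
  \int[P0]_x c = c.
Proof. rewrite /Rintegral integral_cst// [X in (_ * X)%E](_ : _ = 1%E) ?mule1//.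
exact: probability_setT. Qed.

Lemma RintegralDc (f : T0 -> R) (C c : R) :
  measurable_fun setT f -> (forall x, `|f x| <= C) ->
  \int[P0]_x (f x + c) = \int[P0]_x f x + c.
Proof.
move=> mf fC; rewrite RintegralD ?Rintegral_cst_prob//.
  exact: integrable_bounded fC.
by apply: (integrable_bounded (C := `|c|)).
Qed.

Lemma normr_Rintegral_bounded (f : T0 -> R) (C : R) :
  measurable_fun setT f -> (forall x, `|f x| <= C) -> `|\int[P0]_x f x| <= C.
Proof.
move=> mf fC; have fi := integrable_bounded mf fC.
rewrite (le_trans (le_normr_Rintegral _ fi))//.
rewrite -[leRHS](Rintegral_cst_prob C); apply: le_Rintegral => //.
- apply: (integrable_bounded (C := C)); first exact: measurableT_comp.
  by move=> x; rewrite normr_id.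
- exact: (integrable_bounded (C := `|C|)).
Qed.

End bounded_expectation.
Arguments integrable_bounded {d0 T0 R} P0 {f C}.
Arguments RintegralDc {d0 T0 R} P0 {f} C c.
Arguments normr_Rintegral_bounded {d0 T0 R} P0 {f C}.

Section independent_sums.
Context dT (T : measurableType dT) (R : realType) (P : probability T R).
Context dX (T' : measurableType dX) (X : nat -> {RV P >-> T'}).
Variables (Q : probability T' R) (z : T' -> R).
Hypothesis X_indep : mutually_independent X.
Hypothesis X_law : forall i A, measurable A -> P (X i @^-1` A) = Q A.
Hypothesis mz : measurable_fun setT z.

Definition partial_sum k (w : T) : R := \sum_(i < k) z (X i w).

Local Notation S := partial_sum.

Lemma measurable_partial_sum k : measurable_fun setT (S k).
Proof.
by apply: measurable_sum => i; apply: measurableT_comp.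
Qed.

Let mS k B : measurable B -> measurable (S k @^-1` B).
Proof. by move=> mB; rewrite -[X in measurable X]setTI; exact: measurable_partial_sum. Qed.

Let mXA i A : measurable A -> measurable (X i @^-1` A).
Proof. by move=> mA; rewrite -[X in measurable X]setTI; exact: measurable_funP. Qed.

Definition rv_event (J : {fset nat}) (A : nat -> set T') : set T :=
  \bigcap_(i in [set` J]) (X i @^-1` A i).

Let mE (J : {fset nat}) A : (forall i, measurable (A i)) -> measurable (rv_event J A).
Proof.
move=> mA; apply: fin_bigcap_measurable; first exact: finite_fset.
by move=> i _; exact: mXA.
Qed.

Let partial_sumS k w : S k.+1 w = S k w + z (X k w).
Proof. by rewrite /partial_sum big_ord_recr. Qed.

Let sum_mfun k : {mfun T >-> R} := HB.pack (S k)
  (isMeasurableFun.Build _ _ _ _ _ (measurable_partial_sum k)).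

Let pair_sum k (w : T) : R * T' := (S k w, X k w).

Let mpair k : measurable_fun setT (pair_sum k).
Proof. by apply/measurable_fun_pair => //; exact: measurable_partial_sum. Qed.

Let pair_mfun k : {mfun T >-> (R * T')%type} := HB.pack (pair_sum k)
  (isMeasurableFun.Build _ _ _ _ _ (mpair k)).

Definition law_partial_sum k := distribution P (sum_mfun k).

Local Notation law := law_partial_sum.

(** The partial sum is independent of finitely many later observations jointly; this form is strong
    enough to move one observation from the event into the sum. *)
Let indep k := forall (J : {fset nat}) A B, (forall i, i \in J -> (k <= i)%N) ->
  (forall i, measurable (A i)) -> measurable B ->
  P (S k @^-1` B `&` rv_event J A) = (P (S k @^-1` B) * P (rv_event J A))%E.

Let rv_event_fsetU1 k (J : {fset nat}) (A : nat -> set T') B : k \notin J ->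
  rv_event (k |` J)%fset (fun i => if i == k then B else A i) =
  X k @^-1` B `&` rv_event J A.
Proof.
move=> kJ; apply/seteqP; split => [w h|w [hk h] i] /=.
  split; first by have /= := h k; rewrite eqxx !inE eqxx; exact.
  move=> i /= iJ; have /= := h i; rewrite !inE iJ orbT ifF; first exact.
  by apply: contraNF kJ => /eqP <-.
rewrite !inE => /orP[/eqP ->|iJ]; first by rewrite eqxx.
by rewrite ifF; [exact: h|apply: contraNF kJ => /eqP <-].
Qed.

(** Conditionally on the later event, the pair has the product law: the normalised restriction of
    [P] agrees with it on rectangles, and product measures are unique. *)
Let joint_law k : indep k -> forall (J : {fset nat}) A,
  (forall i, i \in J -> (k < i)%N) -> (forall i, measurable (A i)) ->
  forall C : set (R * T'), measurable C ->
  P (pair_sum k @^-1` C `&` rv_event J A) =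
  (P (rv_event J A) * (law k \x Q) C)%E.
Proof.
move=> ik J A kJ mA C mC; have mEJ := mE J mA.
have kJ' : k \notin J by apply/negP => /kJ; rewrite ltnn.
have Efin : P (rv_event J A) \is a fin_num by exact: fin_num_measure.
(* A null event cannot be conditioned on; both sides are then 0. *)
have [PE0|PE0] := eqVneq (P (rv_event J A)) 0%E.
  rewrite PE0 mul0e; apply/eqP; rewrite eq_le measure_ge0 andbT -PE0.
  have mCE : measurable (pair_sum k @^-1` C `&` rv_event J A).
    by apply: measurableI => //; rewrite -[X in measurable X]setTI; exact: mpair.
  by apply: le_measure; rewrite ?inE//; exact: subIsetr.
pose c : R := fine (P (rv_event J A)).
have c0 : 0 < c.
  by rewrite fine_gt0// lt0e PE0 measure_ge0/= -ge0_fin_numE.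
have ci0 : 0 <= c^-1 by rewrite invr_ge0 ltW.
have PEc : P (rv_event J A) = c%:E by rewrite /c fineK.
rewrite (@product_measure_unique _ _ _ _ _ (law k) Q
  (mscale (NngNum ci0) (pushforward (mrestr P mEJ) (pair_mfun k)))) //; last first.
  move=> B1 B2 mB1 mB2; rewrite /= /mscale/= /pushforward /mrestr.
  rewrite (_ : _ `&` _ = S k @^-1` B1 `&`
    rv_event (k |` J)%fset (fun i => if i == k then B2 else A i)); last first.
    by rewrite rv_event_fsetU1// setIA.
  rewrite ik//; last 2 first.
  - by move=> i; rewrite !inE => /orP[/eqP ->//|/kJ /ltnW].
  - by move=> i; case: ifP.
  rewrite [P (rv_event (k |` J)%fset _)]X_indep; last by move=> i; case: ifP.
  rewrite big_fsetU1//= eqxx X_law//.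
  rewrite (_ : (\prod_(i <- J) _)%E = P (rv_event J A)); last first.
    rewrite [RHS]X_indep//; apply: eq_big_seq => i iJ; rewrite ifF//.
    by apply: contraNF kJ' => /eqP <-.
  by rewrite PEc (muleC (Q B2)) (muleCA (P _)) !muleA -EFinM mulVf ?gt_eqF// mul1e.
rewrite /= /mscale/= /pushforward /mrestr PEc muleA -EFinM divff ?gt_eqF//.
by rewrite mul1e.
Qed.

(** An event on the next sum is an event on the pair of the current sum and [X k]. [joint_law] is
    used with the later event, and with the empty index set to identify the law of the pair. *)
Let indep_all k : indep k.
Proof.
elim: k => [|k ih] J A B kJ mA mB.
  have [B0|B0] := pselect (B 0).
    rewrite (_ : S 0 @^-1` B = setT) ?setTI ?probability_setT ?mul1e//.
    by apply/seteqP; split => // w _; rewrite /= /partial_sum big_ord0.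
  rewrite (_ : S 0 @^-1` B = set0) ?set0I ?measure0 ?mul0e//.
  by rewrite -subset0 => w /=; rewrite /partial_sum big_ord0.
pose C := [set p : R * T' | B (p.1 + z p.2)].
have mC : measurable C.
  rewrite (_ : C = setT `&` (fun p : R * T' => p.1 + z p.2) @^-1` B); last by rewrite setTI.
  have : measurable_fun setT (fun p : R * T' => p.1 + z p.2).
    by apply: measurable_funD => //; exact: measurableT_comp.
  exact.
have SC : S k.+1 @^-1` B = pair_sum k @^-1` C.
  by apply/seteqP; split => w /=; rewrite /C/= partial_sumS.
rewrite SC (joint_law ih)//.
have := @joint_law k ih fset0 (fun=> setT) _ _ C mC.
rewrite (_ : rv_event fset0 (fun=> setT) = setT); last first.
  by apply/seteqP; split.
rewrite setIT probability_setT mul1e => ->//.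
by rewrite muleC.
Qed.

Lemma law_partial_sum_pair k C : measurable C ->
  P (pair_sum k @^-1` C) = (law k \x Q)%E C.
Proof.
move=> mC; have := @joint_law k (@indep_all k) fset0 (fun=> setT) _ _ C mC.
rewrite (_ : rv_event fset0 (fun=> setT) = setT); last by apply/seteqP; split.
by rewrite setIT probability_setT mul1e => ->.
Qed.

Lemma ge0_expectation_partial_sumS k (g : R -> \bar R) : measurable_fun setT g ->
  (forall s, 0 <= g s)%E ->
  (\int[P]_w g (S k.+1 w) = \int[P]_w \int[Q]_x g (S k w + z x)%R)%E.
Proof.
move=> mg g0.
have mgz : measurable_fun setT (fun p : R * T' => g (p.1 + z p.2)).
  apply: measurableT_comp => //.
  by apply: measurable_funD => //; exact: measurableT_comp.
transitivity (\int[pushforward P (pair_mfun k)]_p g (p.1 + z p.2)%R)%E.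
  rewrite ge0_integral_pushforward//.
  by apply: eq_integral => w _ /=; rewrite partial_sumS.
rewrite (eq_measure_integral (law k \x Q)%E); last first.
  by move=> C mC _; exact: law_partial_sum_pair.
rewrite fubini_tonelli1//= ge0_integral_pushforward//.
- exact: (@measurable_fun_fubini_tonelli_F _ _ _ _ _ Q _ mgz).
- by move=> s _; apply: integral_ge0 => x _; exact: g0.
Qed.

(** Adding the bound [C] makes the integrand nonnegative, as Tonelli's theorem requires; [C] is
    subtracted at the end. *)
Lemma measurable_Rintegral_shift (g : R -> R) (C : R) : measurable_fun setT g ->
  (forall s, `|g s| <= C) -> measurable_fun setT (fun s : R => \int[Q]_x g (s + z x)).
Proof.
move=> mg gC.
have mgs s : measurable_fun setT (fun x => g (s + z x)).
  by apply: measurableT_comp => //; exact: measurable_funD.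
have mg' : measurable_fun setT (fun p : R * T' => (g (p.1 + z p.2) + C)%:E).
  apply/measurable_EFinP; apply: measurable_funD => //; apply: measurableT_comp => //.
  by apply: measurable_funD => //; exact: measurableT_comp.
have g'0 (p : R * T') : (0 <= (g (p.1 + z p.2) + C)%:E)%E.
  by rewrite lee_fin -lerBlDr sub0r; have := gC (p.1 + z p.2); rewrite ler_norml => /andP[].
have := @measurable_fun_fubini_tonelli_F _ _ _ _ _ Q _ mg' g'0.
rewrite /fubini_F (_ : (fun s => _) = EFin \o (fun s => \int[Q]_x g (s + z x) + C)).
  move=> /measurable_EFinP mh.
  rewrite (_ : (fun s => _) = fun s => \int[Q]_x g (s + z x) + C - C).
    exact: measurable_funB.
  by apply/funext => s; rewrite addrK.
apply/funext => s /=; rewrite -(RintegralDc Q C C (mgs s) (fun x => gC _)).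
rewrite /Rintegral fineK//; apply: integrable_fin_num => //.
apply: (integrable_bounded Q (C := C + `|C|)); first exact: measurable_funD.
by move=> x; rewrite (le_trans (ler_normD _ _))// lerD.
Qed.

(** Again reduced to the nonnegative case by adding [C] to both sides. *)
Lemma expectation_partial_sumS k (g : R -> R) (C : R) : measurable_fun setT g ->
  (forall s, `|g s| <= C) ->
  \int[P]_w g (S k.+1 w) = \int[P]_w \int[Q]_x g (S k w + z x).
Proof.
move=> mg gC.
have mSk j := measurable_partial_sum j.
have mgs s : measurable_fun setT (fun x => g (s + z x)).
  by apply: measurableT_comp => //; exact: measurable_funD.
have g'0 s : (0 <= (g s + C)%:E)%E.
  by rewrite lee_fin -lerBlDr sub0r; have := gC s; rewrite ler_norml => /andP[].
have mg' : measurable_fun setT (fun s => (g s + C)%:E).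
  by apply/measurable_EFinP; exact: measurable_funD.
apply: (addIr C); rewrite -(RintegralDc P C C (measurableT_comp mg (mSk _)) (fun w => gC _)).
have mh := measurable_Rintegral_shift mg gC.
rewrite -(RintegralDc P C C (measurableT_comp mh (mSk k))
  (fun w => normr_Rintegral_bounded Q (mgs _) (fun x => gC _))).
rewrite /Rintegral (ge0_expectation_partial_sumS k mg' g'0); congr fine.
apply: eq_integral => w _ /=; rewrite -(RintegralDc Q C C (mgs (S k w)) (fun x => gC _)).
rewrite /Rintegral fineK//; apply: integrable_fin_num => //.
apply: (integrable_bounded Q (C := C + `|C|)); first exact: measurable_funD.
by move=> x; rewrite (le_trans (ler_normD _ _))// lerD.
Qed.

Variable B : R.
Hypothesis zB : forall x, `|z x| <= B.
Hypothesis z_mean : \int[Q]_x z x = 0.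

(** Squaring is unbounded on the line, so the recursion for nonnegative functions is the one that
    applies; the cross term vanishes because [z] is centred. *)
Lemma second_moment_partial_sum k :
  (\int[P]_w (S k w ^+ 2)%:E = (k%:R * \int[Q]_x (z x ^+ 2))%:E)%E.
Proof.
have mz2 : measurable_fun setT (fun x => z x ^+ 2) by exact: measurable_funX.
have z2B x : `|z x ^+ 2| <= B ^+ 2.
  by rewrite normrX lerXn2r// nnegrE (le_trans _ (zB x)).
elim: k => [|k ih].
  by rewrite mul0r integral0_eq// => w _; rewrite /partial_sum big_ord0 expr0n.
rewrite (@ge0_expectation_partial_sumS k (fun s => (s ^+ 2)%:E)); last 2 first.
- by apply/measurable_EFinP; exact: measurable_funX.
- by move=> s; rewrite lee_fin sqr_ge0.
have inner s : (\int[Q]_x ((s + z x) ^+ 2)%:E = (s ^+ 2)%:E + (\int[Q]_x (z x ^+ 2))%:E)%E.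
  have i1 : Q.-integrable setT (EFin \o (fun x => 2 * s * z x)).
    exact: (integrableZl _ (2 * s) (integrable_bounded Q mz zB)).
  have i2 := integrable_bounded Q mz2 z2B.
  have E : \int[Q]_x ((s + z x) ^+ 2) = s ^+ 2 + \int[Q]_x (z x ^+ 2).
    transitivity (\int[Q]_x (s ^+ 2 + 2 * s * z x + z x ^+ 2)).
      by apply: eq_Rintegral => x _; ring.
    have i0 : Q.-integrable setT (EFin \o (fun=> s ^+ 2)).
      by apply: (integrable_bounded Q (C := `|s ^+ 2|)).
    have i01 : Q.-integrable setT (EFin \o (fun x => s ^+ 2 + 2 * s * z x)).
      exact: (integrableD _ i0 i1).
    rewrite (RintegralD _ i01 i2)// (RintegralD _ i0 i1)// Rintegral_cst_prob RintegralZl ?z_mean ?mulr0 ?addr0//.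
    exact: integrable_bounded zB.
  rewrite -EFinD -E /Rintegral fineK//; apply: integrable_fin_num => //.
  apply: (integrable_bounded Q (C := (`|s| + B) ^+ 2)).
    by apply: measurable_funX; exact: measurable_funD.
  move=> x; rewrite normrX lerXn2r// ?nnegrE ?addr_ge0//.
    by rewrite (le_trans _ (zB x)).
  by rewrite (le_trans (ler_normD _ _))// lerD2l.
under eq_integral do rewrite inner.
rewrite ge0_integralD//=.
- rewrite ih integral_cst// [X in (_ * X)%E](_ : _ = 1%E) ?mule1; last exact: probability_setT.
  rewrite -EFinD; congr EFin.
  by rewrite -natr1; ring.
- by move=> w _; rewrite lee_fin sqr_ge0.
- by apply/measurable_EFinP; apply: measurable_funX; exact: measurable_partial_sum.
- by move=> w _; rewrite lee_fin; apply: Rintegral_ge0 => x _; exact: sqr_ge0.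
Qed.

End independent_sums.

(** * Smoothed Gaussian distribution functions *)

Section taylor_bounds.
Context {R : realType}.

Lemma derive_le_lipschitz (f df : R -> R) (K a b : R) :
  (forall x, minr a b <= x <= maxr a b -> is_derive x 1 f (df x)) ->
  (forall x, minr a b <= x <= maxr a b -> `|df x| <= K) ->
  `|f b - f a| <= K * `|b - a|.
Proof.
wlog ab : a b / a <= b.
  move=> h; have [ab|] := boolP (a <= b); first exact: h.
  by rewrite -ltNge distrC (distrC b) minC maxC => /ltW; exact: h.
rewrite (min_idPl ab) (max_idPr ab) => dfE dfK.
move: ab; rewrite le_eqVlt => /predU1P[->|ab]; first by rewrite !subrr !normr0 mulr0.
have [||c cab ->] := @MVT R f df a b ab.
- by move=> x; rewrite in_itv/= => /andP[/ltW ax /ltW xb]; apply: dfE; rewrite ax.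
- apply: derivable_within_continuous => x; rewrite in_itv/= => xab.
  by have [] := dfE x xab.
rewrite normrM ler_wpM2r//; apply: dfK.
by move: cab; rewrite in_itv/= => /andP[/ltW -> /ltW ->].
Qed.

(** Three nested mean value bounds; the sharp factor 1/6 is not sought. *)
Lemma taylor3 (f f1 f2 f3 : R -> R) (K s z : R) :
  (forall x : R, is_derive x 1 f (f1 x)) -> (forall x : R, is_derive x 1 f1 (f2 x)) ->
  (forall x : R, is_derive x 1 f2 (f3 x)) -> (forall x, `|f3 x| <= K) ->
  `|f (s + z) - f s - z * f1 s - z ^+ 2 / 2 * f2 s| <= K * `|z| ^+ 3.
Proof.
move=> d1 d2 d3 fK; have K0 : 0 <= K by rewrite (le_trans _ (fK 0)).
have between (w x : R) : minr 0 w <= x <= maxr 0 w -> `|x| <= `|w|.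
  by case: (leP 0 w) => w0 /andP[x1 x2]; [rewrite !ger0_norm|rewrite !ler0_norm]; lra.
have shift (g dg : R -> R) : (forall x : R, is_derive x 1 g (dg x)) ->
    forall x : R, is_derive x 1 (fun y => g (s + y)) (dg (s + x)).
  move=> dgE x; notypeclasses refine (is_derive_change _ _).
    notypeclasses refine (is_derive_fcomp (g := fun y => s + y) (dgE _) _); derive_rules.
  by rewrite add0r mulr1.
have b2 x : `|f2 (s + x) - f2 s| <= K * `|x|.
  have := @derive_le_lipschitz f2 f3 K s (s + x) (fun y _ => d3 y) (fun y _ => fK y).
  by rewrite addrAC subrr add0r.
have b1 x : `|f1 (s + x) - f1 s - x * f2 s| <= K * `|x| ^+ 2.
  pose g y := f1 (s + y) - f1 s - y * f2 s.
  have dg (y : R) : is_derive y 1 g (f2 (s + y) - f2 s).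
    notypeclasses refine (is_derive_change (is_derive_fB (is_derive_fB
      (shift _ _ d2 y) (is_derive_fcst y (f1 s)))
      (is_derive_fM (is_derive_fid y) (is_derive_fcst y (f2 s)))) _).
    by ring.
  have := @derive_le_lipschitz g _ (K * `|x|) 0 x (fun y _ => dg y).
  rewrite /g addr0 mul0r !subrr !subr0 expr2 mulrA; apply=> y /between yx.
  by rewrite (le_trans (b2 y))// ler_wpM2l.
pose g y := f (s + y) - f s - y * f1 s - y ^+ 2 / 2 * f2 s.
have dg (y : R) : is_derive y 1 g (f1 (s + y) - f1 s - y * f2 s).
  notypeclasses refine (is_derive_change (is_derive_fB (is_derive_fB (is_derive_fB
    (shift _ _ d1 y) (is_derive_fcst y (f s)))
    (is_derive_fM (is_derive_fid y) (is_derive_fcst y (f1 s))))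
    (is_derive_fM (is_derive_fM (is_derive_fX 2 (is_derive_fid y))
      (is_derive_fcst y 2^-1)) (is_derive_fcst y (f2 s)))) _).
  by rewrite /=; field.
have := @derive_le_lipschitz g _ (K * `|z| ^+ 2) 0 z (fun y _ => dg y).
have g0 : g 0 = 0 by rewrite /g addr0; ring.
rewrite g0 !subr0 -mulrA -exprSr; apply=> y /between yz.
by rewrite (le_trans (b1 y))// ler_wpM2l// lerXn2r// nnegrE.
Qed.

(** One-sided, for use in the time variable, where derivatives are available at positive times and
    bounded only away from 0. *)
Lemma taylor2 (f f1 f2 : R -> R) (K s h : R) : 0 <= h ->
  (forall x, s <= x -> is_derive x 1 f (f1 x)) ->
  (forall x, s <= x -> is_derive x 1 f1 (f2 x)) ->
  (forall x, s <= x -> `|f2 x| <= K) ->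
  `|f (s + h) - f s - h * f1 s| <= K * h ^+ 2.
Proof.
move=> h0 d1 d2 fK; have K0 : 0 <= K by rewrite (le_trans _ (fK s (lexx s))).
have b1 x : s <= x -> `|f1 x - f1 s| <= K * `|x - s|.
  move=> sx; have := @derive_le_lipschitz f1 f2 K s x.
  by rewrite (min_idPl sx) (max_idPr sx); apply=> y /andP[sy _]; [exact: d2|exact: fK].
pose g y := f y - y * f1 s.
have dg (y : R) : s <= y -> is_derive y 1 g (f1 y - f1 s).
  move=> sy; notypeclasses refine (is_derive_change (is_derive_fB (d1 y sy)
    (is_derive_fM (is_derive_fid y) (is_derive_fcst y (f1 s)))) _).
  by ring.
have sh : s <= s + h by rewrite lerDl.
have := @derive_le_lipschitz g (fun y => f1 y - f1 s) (K * h) s (s + h).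
have -> : s + h - s = h by ring.
have -> : g (s + h) - g s = f (s + h) - f s - h * f1 s by rewrite /g; ring.
rewrite (min_idPl sh) (max_idPr sh) (ger0_norm h0) -mulrA -expr2; apply=> x /andP[sx xh]; first exact: dg.
rewrite (le_trans (b1 x sx))// ler_wpM2l// ger0_norm; last by rewrite subr_ge0.
by rewrite lerBlDl.
Qed.

End taylor_bounds.

Section heat_kernel.
Context {R : realType}.
Variable sg : R.
Hypothesis sg0 : 0 < sg.

Definition gauss_cdf (x : R) : R := fine (normal_prob 0 sg `]-oo, x]%classic).

Local Notation Phi := gauss_cdf.
Local Notation p := (normal_pdf 0 sg).

Lemma is_derive_gauss_cdf (x : R) : is_derive x 1 Phi (p x).
Proof.
have [] := @continuous_FTC1 R p -oo%O x (x + 1).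
- by rewrite ltrDl.
- apply: (integrableS measurableT) => //; exact: integrable_normal_pdf.
- by rewrite ltNyr.
- by apply: continuous_normal_pdf; rewrite gt_eqF.
by rewrite derive1E => dF <-; split.
Qed.

Let pE y : p y = normal_peak sg * expR (- (y ^+ 2 / (2 * sg ^+ 2))).
Proof.
rewrite normal_pdfE ?gt_eqF// /normal_fun subr0 mulNr; congr (_ * expR (- (_ / _))).
by rewrite mulr2n; ring.
Qed.

Lemma is_derive_normal_pdf (y : R) : is_derive y 1 p (- y / sg ^+ 2 * p y).
Proof.
rewrite (_ : p = fun y => normal_peak sg * expR (- (y ^+ 2 / (2 * sg ^+ 2)))); last exact/funext.
notypeclasses refine (is_derive_change _ _); first by derive_rules.
by rewrite /=; field; rewrite gt_eqF.
Qed.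

(** Set u = y^2 / (2 sg^2). Then |y|^j <= 1 + y^4 = 1 + 4 sg^4 u^2, and u^2 exp(-u) <= 2 because exp
    u >= 1 + u^2 / 2; hence the factor 1 + 8 sg^4. *)
Lemma normal_pdf_moment_bound : exists2 K, 0 <= K &
  forall (y : R) j, (j <= 4)%N -> `|y ^+ j * p y| <= K.
Proof.
pose c := normal_peak sg; have c0 : 0 <= c by exact: normal_peak_ge0.
exists (c * (1 + 8 * sg ^+ 4)) => [|y j j4].
  by rewrite mulr_ge0// addr_ge0// mulr_ge0// exprn_ge0// ltW.
pose u := y ^+ 2 / (2 * sg ^+ 2); pose e := expR (- u).
have u0 : 0 <= u by rewrite divr_ge0 ?sqr_ge0// mulr_ge0// sqr_ge0.
have e0 : 0 < e by exact: expR_gt0.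
have eu : (1 + u ^+ 2 / 2) * e <= 1.
  rewrite /e expRN ler_pdivrMr ?expR_gt0// mul1r.
  exact: (expR_ge1Dxn 1 u0).
have y4 : y ^+ 4 = 4 * sg ^+ 4 * u ^+ 2 by rewrite /u; field; rewrite gt_eqF.
have yj : `|y| ^+ j <= 1 + y ^+ 4.
  have y40 : 0 <= y ^+ 4 by rewrite exprn_even_ge0.
  have [y1|/ltW y1] := leP `|y| 1.
    by rewrite (le_trans (exprn_ile1 _ _ y1))// lerDl.
  rewrite -[y ^+ 4]ger0_norm// normrX (le_trans (ler_weXn2l y1 j4))//.
  by rewrite lerDr.
rewrite pE -/c -/u -/e normrM normrX (ger0_norm (mulr_ge0 c0 (ltW e0))) mulrCA.
rewrite ler_wpM2l// (le_trans (ler_wpM2r (ltW e0) yj))// y4.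
have s4 : 0 <= sg ^+ 4 by rewrite exprn_ge0// ltW.
have u2e : u ^+ 2 * e <= 2 by nra.
have e1 : e <= 1 by nra.
have : sg ^+ 4 * (u ^+ 2 * e) <= sg ^+ 4 * 2 by rewrite ler_wpM2l.
lra.
Qed.

(** A real power, so that the derivative of [powR] and the laws of exponents apply. *)
Definition inv_sqrt (t : R) : R := t `^ (- 2^-1).

Local Notation v := inv_sqrt.

Lemma is_derive_inv_sqrt (t : R) : 0 < t -> is_derive t 1 v (- (v t ^+ 3) / 2).
Proof.
move=> t0; notypeclasses refine (is_derive_change (is_derive1_powR (- 2^-1) t0) _).
have -> : v t ^+ 3 = t `^ (- 2^-1 - 1).
  rewrite -powR_mulrn ?powR_ge0// /v -powRrM; congr (_ `^ _).
  by field.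
by field.
Qed.

Lemma inv_sqrt_gt0 (t : R) : 0 < t -> 0 < v t.
Proof. exact: powR_gt0. Qed.

Lemma inv_sqrt_sqr (t : R) : 0 < t -> v t ^+ 2 = t^-1.
Proof.
move=> t0; rewrite -powR_mulrn ?powR_ge0// /v -powRrM -[RHS]powR_inv1 ?ltW//.
by congr (_ `^ _); field.
Qed.

Lemma inv_sqrt_le (s t : R) : 0 < s -> s <= t -> v t <= v s.
Proof.
move=> s0 st; have t0 : 0 < t by rewrite (lt_le_trans s0).
have vs := ltW (inv_sqrt_gt0 s0); have vt := ltW (inv_sqrt_gt0 t0).
by rewrite -(@ler_pXn2r _ 2)// !inv_sqrt_sqr// lef_pV2.
Qed.

Section heat.
Variable a : R.

(** The probability that [x] plus a centred Gaussian of variance sg^2 t is at most [a]: the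
    indicator of ]-oo, a] smoothed for time [t]. *)
Definition heat (t x : R) := Phi ((a - x) * v t).
Definition heat_x (t x : R) := - v t * p ((a - x) * v t).
Definition heat_xx (t x : R) :=
  v t ^+ 2 * (- ((a - x) * v t) / sg ^+ 2 * p ((a - x) * v t)).

Definition heat_xxx (t x : R) := let q := (a - x) * v t in
  v t ^+ 3 * (1 / sg ^+ 2 * p q - 1 / sg ^+ 4 * (q ^+ 2 * p q)).

Definition heat_tt (t x : R) := let q := (a - x) * v t in
  v t ^+ 4 * (3 / 4 * (q * p q) - 1 / (4 * sg ^+ 2) * (q ^+ 3 * p q)).

Lemma is_derive_scaled (t x : R) : is_derive x 1 (fun y => (a - y) * v t) (- v t).
Proof.
notypeclasses refine (is_derive_change _ _); first by derive_rules.
by rewrite /=; ring.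
Qed.

Lemma is_derive_normal_pdf_scaled (t x : R) : is_derive x 1 (fun y => p ((a - y) * v t))
  (- ((a - x) * v t) / sg ^+ 2 * p ((a - x) * v t) * - v t).
Proof. exact: is_derive_fcomp (is_derive_normal_pdf _) (is_derive_scaled t x). Qed.

Let sgn0 : sg != 0. Proof. by rewrite gt_eqF. Qed.

Lemma is_derive_heat (t x : R) : is_derive x 1 (heat t) (heat_x t x).
Proof.
notypeclasses refine (is_derive_change
  (is_derive_fcomp (is_derive_gauss_cdf _) (is_derive_scaled t x)) _).
by rewrite /heat_x; ring.
Qed.

Lemma is_derive_heat_x (t x : R) : is_derive x 1 (heat_x t) (heat_xx t x).
Proof.
notypeclasses refine (is_derive_change (is_derive_fM (is_derive_fcst x (- v t)) (is_derive_normal_pdf_scaled t x)) _).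
by rewrite /heat_xx; ring.
Qed.

Lemma is_derive_heat_xx (t x : R) : is_derive x 1 (heat_xx t) (heat_xxx t x).
Proof.
notypeclasses refine (is_derive_change (is_derive_fM (is_derive_fcst x (v t ^+ 2))
  (is_derive_fM (is_derive_fM (is_derive_fN (is_derive_scaled t x))
    (is_derive_fcst x (sg ^+ 2)^-1)) (is_derive_normal_pdf_scaled t x))) _).
by rewrite /heat_xxx; field.
Qed.

Lemma is_derive_scaled_t (t x : R) : 0 < t ->
  is_derive t 1 (fun s => (a - x) * v s) (- ((a - x) * v t) * v t ^+ 2 / 2).
Proof.
move=> t0; notypeclasses refine (is_derive_change
  (is_derive_fM (is_derive_fcst t (a - x)) (is_derive_inv_sqrt t0)) _).
by rewrite /=; field.
Qed.

Lemma is_derive_heat_t (t x : R) : 0 < t ->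
  is_derive t 1 (heat ^~ x) (sg ^+ 2 / 2 * heat_xx t x).
Proof.
move=> t0; notypeclasses refine (is_derive_change
  (is_derive_fcomp (is_derive_gauss_cdf _) (is_derive_scaled_t x t0)) _).
by rewrite /heat_xx; field.
Qed.

Lemma is_derive_heat_tt (t x : R) : 0 < t ->
  is_derive t 1 (fun s => sg ^+ 2 / 2 * heat_xx s x) (heat_tt t x).
Proof.
move=> t0; have dq := is_derive_scaled_t x t0.
notypeclasses refine (is_derive_change (is_derive_fM (is_derive_fcst t (sg ^+ 2 / 2))
  (is_derive_fM (is_derive_fX 2 (is_derive_inv_sqrt t0))
  (is_derive_fM (is_derive_fM (is_derive_fN dq)
    (is_derive_fcst t (sg ^+ 2)^-1)) (is_derive_fcomp (is_derive_normal_pdf _) dq)))) _).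
by rewrite /heat_tt /=; field.
Qed.

End heat.

(* [heat] solves the heat equation, so that to second order a centred increment
   [z] of variance [sg^2 h] compensates the time step [h]. *)
Lemma heat_step t0 : 0 < t0 -> exists2 C, 0 <= C &
  forall a t h x z, t0 <= t -> 0 <= h ->
  `|heat a t (x + z) - heat a (t + h) x - z * heat_x a t x
    - (z ^+ 2 - sg ^+ 2 * h) / 2 * heat_xx a t x| <= C * (`|z| ^+ 3 + h ^+ 2).
Proof.
move=> t00; have [K K0 pK] := normal_pdf_moment_bound.
pose V := v t0; have V0 : 0 <= V by rewrite ltW// inv_sqrt_gt0.
pose C1 := V ^+ 3 * (1 / sg ^+ 2 * K + 1 / sg ^+ 4 * K).
pose C2 := V ^+ 4 * (3 / 4 * K + 1 / (4 * sg ^+ 2) * K).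
have s2 : 0 <= 1 / sg ^+ 2 by rewrite divr_ge0// exprn_ge0// ltW.
have s4 : 0 <= 1 / sg ^+ 4 by rewrite divr_ge0// exprn_ge0// ltW.
have s42 : 0 <= 1 / (4 * sg ^+ 2) by rewrite divr_ge0// mulr_ge0// exprn_ge0// ltW.
have C10 : 0 <= C1 by rewrite mulr_ge0 ?exprn_ge0// addr_ge0// mulr_ge0.
have C20 : 0 <= C2 by rewrite mulr_ge0 ?exprn_ge0// addr_ge0// mulr_ge0.
exists (C1 + C2) => [|a t h x z tt h0]; first exact: addr_ge0.
have t_gt0 : 0 < t by rewrite (lt_le_trans t00).
have vV u : t0 <= u -> 0 <= v u <= V.
  move=> tu; rewrite (inv_sqrt_le t00 tu) andbT ltW// inv_sqrt_gt0//.
  exact: lt_le_trans tu.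
have b3 y : `|heat_xxx a t y| <= C1.
  have /andP[vt0 vtV] := vV t tt.
  rewrite /heat_xxx normrM normrX (ger0_norm vt0); apply: ler_pM => //.
  - by rewrite exprn_ge0.
  - by rewrite lerXn2r.
  rewrite (le_trans (ler_normB _ _))// lerD// normrM (ger0_norm (_ : 0 <= _)) ?ler_wpM2l//.
    by have := pK ((a - y) * v t) 0 isT; rewrite expr0 mul1r.
  exact: pK.
have b2 u : t <= u -> `|heat_tt a u x| <= C2.
  move=> tu; have /andP[vt0 vtV] := vV u (le_trans tt tu).
  rewrite /heat_tt normrM normrX (ger0_norm vt0); apply: ler_pM => //.
  - by rewrite exprn_ge0.
  - by rewrite lerXn2r.
  rewrite (le_trans (ler_normB _ _))// lerD// normrM (ger0_norm (_ : 0 <= _)) ?ler_wpM2l//.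
    by have := pK ((a - x) * v u) 1 isT; rewrite expr1.
  exact: pK.
have T3 := taylor3 x z (is_derive_heat a t) (is_derive_heat_x a t) (is_derive_heat_xx a t) b3.
have T2 := taylor2 h0 (fun u tu => is_derive_heat_t a x (lt_le_trans t_gt0 tu))
  (fun u tu => is_derive_heat_tt a x (lt_le_trans t_gt0 tu)) b2.
move: T3 T2; move: (heat a t (x + z)) (heat a (t + h) x) (heat a t x)
  (heat_x a t x) (heat_xx a t x) => A B D E F T3 T2.
(* The third-order expansion in space minus the second-order one in time; the heat equation has
   turned the time derivative into a multiple of [F]. *)
have -> : A - B - z * E - (z ^+ 2 - sg ^+ 2 * h) / 2 * F =
  (A - D - z * E - z ^+ 2 / 2 * F) - (B - D - h * (sg ^+ 2 / 2 * F)) by field.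
rewrite (le_trans (ler_normB _ _))// (le_trans (lerD T3 T2))// mulrDr.
have z3 : 0 <= `|z| ^+ 3 by rewrite exprn_ge0.
by rewrite lerD// ler_wpM2r// ?lerDl ?lerDr// sqr_ge0.
Qed.

Lemma gauss_cdf_fin x : (gauss_cdf x)%:E = normal_prob 0 sg `]-oo, x]%classic.
Proof. by rewrite /gauss_cdf fineK// fin_num_measure. Qed.

Lemma gauss_cdf_ge0 x : 0 <= Phi x.
Proof. by rewrite -lee_fin gauss_cdf_fin. Qed.

Lemma gauss_cdf_le1 x : Phi x <= 1.
Proof. by rewrite -lee_fin gauss_cdf_fin probability_le1. Qed.

Lemma gauss_cdf_le x y : x <= y -> Phi x <= Phi y.
Proof.
move=> xy; rewrite -lee_fin !gauss_cdf_fin le_measure ?inE//.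
exact: subitvPr.
Qed.

Lemma continuous_gauss_cdf : continuous Phi.
Proof. by move=> x; exact: is_derive_continuous (is_derive_gauss_cdf x). Qed.

Lemma measurable_gauss_cdf : measurable_fun setT Phi.
Proof. by apply: continuous_measurable_fun; exact: continuous_gauss_cdf. Qed.

(** The identity as a random variable under the normal law; its distribution function is [Phi], so
    the general limits of distribution functions at infinity apply. *)
Let idTR : measurableTypeR R -> R := idfun.

#[local] HB.instance Definition _ :=
  @isMeasurableFun.Build _ _ _ _ idTR (@measurable_id _ _ setT).

Lemma gauss_cdf_cvgy : Phi x @[x --> +oo] --> (1 : R).
Proof.
have := @cvg_cdfy1 _ _ R (normal_prob 0 sg) (idTR : {RV (normal_prob 0 sg) >-> R}).
rewrite (_ : cdf _ = EFin \o Phi); last first.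
  by apply/funext => x; rewrite /= gauss_cdf_fin.
by move/fine_cvg.
Qed.

Lemma gauss_cdf_cvgNy : Phi x @[x --> -oo] --> (0 : R).
Proof.
have := @cvg_cdfNy0 _ _ R (normal_prob 0 sg) (idTR : {RV (normal_prob 0 sg) >-> R}).
rewrite (_ : cdf _ = EFin \o Phi); last first.
  by apply/funext => x; rewrite /= gauss_cdf_fin.
by move/fine_cvg.
Qed.

End heat_kernel.

(** * Central limit theorem *)

Section heat_partial_sum.
Context dT (T : measurableType dT) (R : realType) (P : probability T R).
Context dX (T' : measurableType dX) (X : nat -> {RV P >-> T'}).
Variables (Q : probability T' R) (sg : R).
Hypothesis X_indep : mutually_independent X.
Hypothesis X_law : forall i A, measurable A -> P (X i @^-1` A) = Q A.
Hypothesis sg0 : 0 < sg.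

Let heat_bounded (a t x : R) : `|heat sg a t x| <= 1.
Proof. by rewrite /heat ger0_norm ?gauss_cdf_ge0// gauss_cdf_le1. Qed.

Let measurable_heat (a t : R) : measurable_fun setT (heat sg a t).
Proof.
apply: measurableT_comp; first exact: measurable_gauss_cdf.
by apply: measurable_funM => //; exact: measurable_funB.
Qed.

(** Lindeberg replacement: each step removes the last summand and advances time by [h], with an
    error given by [heat_step]; times only increase and so stay above [t0]. [C] is chosen before
    [z], [b] and [h], which will be rescaled with the sample size. *)
Lemma expectation_heat_partial_sum t0 : 0 < t0 -> exists2 C, 0 <= C &
  forall (z : T' -> R) (b h : R), measurable_fun setT z -> (forall x, `|z x| <= b) ->
  \int[Q]_x z x = 0 -> \int[Q]_x (z x ^+ 2) = sg ^+ 2 * h -> 0 <= h ->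
  forall k (a t : R), t0 <= t ->
  `|\int[P]_w heat sg a t (partial_sum X z k w) - heat sg a (t + k%:R * h) 0|
    <= k%:R * (C * (b ^+ 3 + h ^+ 2)).
Proof.
move=> t00; have [C C0 step] := heat_step sg0 t00.
exists C => // z b h mz zb z_mean z_var h0.
have mz2 : measurable_fun setT (fun x => z x ^+ 2) by exact: measurable_funX.
have z2b x : `|z x ^+ 2| <= b ^+ 2.
  by rewrite normrX lerXn2r// nnegrE (le_trans _ (zb x)).
have mS k := measurable_partial_sum X mz k.
have mgs a t s : measurable_fun setT (fun x => heat sg a t (s + z x)).
  by apply: measurableT_comp => //; exact: measurable_funD.
have inner a t s : t0 <= t ->
    `|\int[Q]_x heat sg a t (s + z x) - heat sg a (t + h) s| <= C * (b ^+ 3 + h ^+ 2).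
  move=> tt.
  have i1 : Q.-integrable setT (EFin \o (fun x => heat sg a t (s + z x))).
    exact: integrable_bounded (mgs a t s) (fun x => heat_bounded _ _ _).
  have ic (c : R) : Q.-integrable setT (EFin \o (fun=> c)).
    exact: (integrable_bounded Q (C := `|c|)).
  have i3 : Q.-integrable setT (EFin \o (fun x => heat_x sg a t s * z x)).
    exact: (integrableZl _ _ (integrable_bounded Q mz zb)).
  have i4 : Q.-integrable setT (EFin \o (fun x => heat_xx sg a t s / 2 * z x ^+ 2)).
    exact: (integrableZl _ _ (integrable_bounded Q mz2 z2b)).
  have i12 : Q.-integrable setT (EFin \o (fun x => heat sg a t (s + z x)
      - (heat sg a (t + h) s - sg ^+ 2 * h / 2 * heat_xx sg a t s))).
    exact: (integrableB _ i1 (ic _)).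
  have i123 : Q.-integrable setT (EFin \o (fun x => heat sg a t (s + z x)
      - (heat sg a (t + h) s - sg ^+ 2 * h / 2 * heat_xx sg a t s) - heat_x sg a t s * z x)).
    exact: (integrableB _ i12 i3).
  (* The remainder in [heat_step]. Its mean is the replacement error, since [z] has mean 0 and
     second moment sg^2 h. *)
  pose r x := heat sg a t (s + z x)
      - (heat sg a (t + h) s - sg ^+ 2 * h / 2 * heat_xx sg a t s)
      - heat_x sg a t s * z x - heat_xx sg a t s / 2 * z x ^+ 2.
  have -> : \int[Q]_x heat sg a t (s + z x) - heat sg a (t + h) s = \int[Q]_x r x.
    rewrite /r (RintegralB _ i123 i4)// (RintegralB _ i12 i3)// (RintegralB _ i1 (ic _))//.
    rewrite !RintegralZl// ?z_mean ?z_var ?Rintegral_cst_prob; first by field.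
      exact: integrable_bounded mz zb.
    exact: integrable_bounded mz2 z2b.
  apply: normr_Rintegral_bounded => [|x].
    apply: measurable_funB; last by apply: measurable_funM.
    apply: measurable_funB; last by apply: measurable_funM.
    exact: measurable_funB.
  have -> : r x = heat sg a t (s + z x) - heat sg a (t + h) s - z x * heat_x sg a t s
      - (z x ^+ 2 - sg ^+ 2 * h) / 2 * heat_xx sg a t s.
    rewrite /r; move: (heat sg a t _) (heat sg a (t + h) s) (heat_x sg a t s) (heat_xx sg a t s).
    by move=> *; field.
  rewrite (le_trans (step a t h s (z x) tt h0))// ler_wpM2l// lerD2r.
  by rewrite lerXn2r// nnegrE (le_trans _ (zb x)).
elim=> [|k ih] a t tt.
  have -> : \int[P]_w heat sg a t (partial_sum X z 0 w) = heat sg a t 0.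
    rewrite -[RHS](Rintegral_cst_prob P); apply: eq_Rintegral => w _.
    by rewrite /partial_sum big_ord0.
  by rewrite mul0r addr0 subrr normr0 mul0r.
have bound : 0 <= C * (b ^+ 3 + h ^+ 2).
  exact: le_trans (normr_ge0 _) (inner 0 t 0 tt).
have tth : t0 <= t + h by rewrite (le_trans tt)// lerDl.
rewrite (expectation_partial_sumS X_indep X_law mz k (measurable_heat a t) (heat_bounded a t)).
have mI : measurable_fun setT
    (fun w => \int[Q]_x heat sg a t (partial_sum X z k w + z x)).
  exact: (measurableT_comp (measurable_Rintegral_shift Q mz (measurable_heat a t) (heat_bounded a t)) (mS k)).
have mH : measurable_fun setT (fun w => heat sg a (t + h) (partial_sum X z k w)).
  exact: measurableT_comp (measurable_heat _ _) (mS k).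
have IB : `|\int[P]_w (\int[Q]_x heat sg a t (partial_sum X z k w + z x)
    - heat sg a (t + h) (partial_sum X z k w))| <= C * (b ^+ 3 + h ^+ 2).
  apply: normr_Rintegral_bounded => [|w]; first exact: measurable_funB.
  exact: inner.
rewrite RintegralB// in IB; last 2 first.
- apply: (integrable_bounded P (C := 1)) => // w.
  exact: normr_Rintegral_bounded (mgs _ _ _) (fun x => heat_bounded _ _ _).
- by apply: (integrable_bounded P (C := 1)) => // w; exact: heat_bounded.
have -> : t + k.+1%:R * h = t + h + k%:R * h by rewrite -natr1; ring.
have := ih a (t + h) tth; move: IB.
rewrite -[k.+1%:R]natr1 mulrDl mul1r => IB IH.
by rewrite (le_trans (ler_distD (\int[P]_w heat sg a (t + h) (partial_sum X z k w)) _ _))// addrC lerD.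
Qed.

Variables (z : T' -> R) (B : R).
Hypothesis mz : measurable_fun setT z.
Hypothesis zB : forall x, `|z x| <= B.
Hypothesis z_mean : \int[Q]_x z x = 0.
Hypothesis z_var : \int[Q]_x (z x ^+ 2) = sg ^+ 2.

(** Here n steps of length 1/n are made with summands bounded by B / sqrt n; the errors add up to at
    most C (B^3 + 1/sqrt n) / sqrt n. *)
Lemma smoothed_clt (a t : R) : 0 < t ->
  \int[P]_w heat sg a t (partial_sum X z n w / Num.sqrt n%:R) @[n --> \oo]
    --> heat sg a (t + 1) 0.
Proof.
move=> t0; have [C C0 bound] := expectation_heat_partial_sum t0.
apply/cvgrPdist_le => e e0.
pose K := C * (`|B| ^+ 3 + 1).
have K0 : 0 <= K by rewrite mulr_ge0// addr_ge0// exprn_ge0.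
near=> n.
have n0 : (0 < n)%N by near: n; exact: nbhs_infty_gt.
have nR0 : 0 < n%:R :> R by rewrite ltr0n.
pose s : R := (Num.sqrt n%:R)^-1.
have s0 : 0 < s by rewrite invr_gt0 sqrtr_gt0.
have s2 : s ^+ 2 = n%:R^-1 by rewrite exprVn sqr_sqrtr// ltW.
have s1 : s <= 1.
  by rewrite invf_le1 ?sqrtr_gt0// -[leLHS]sqrtr1 ler_sqrt// ler1n.
pose zn x := s * z x.
have -> : \int[P]_w heat sg a t (partial_sum X z n w / Num.sqrt n%:R) =
    \int[P]_w heat sg a t (partial_sum X zn n w).
  apply: eq_Rintegral => w _; congr heat.
  by rewrite /partial_sum mulr_suml; apply: eq_bigr => i _; rewrite mulrC.
have mzn : measurable_fun setT zn by exact: measurable_funM.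
have znB x : `|zn x| <= s * B.
  by rewrite normrM (gtr0_norm s0) ler_wpM2l// ltW.
have zn_mean : \int[Q]_x zn x = 0.
  by rewrite RintegralZl ?z_mean ?mulr0//; exact: integrable_bounded zB.
have zn_var : \int[Q]_x (zn x ^+ 2) = sg ^+ 2 * s ^+ 2.
  under eq_Rintegral do rewrite exprMn.
  rewrite RintegralZl ?z_var 1?mulrC//.
  apply: (integrable_bounded Q (C := B ^+ 2)); first exact: measurable_funX.
  by move=> x; rewrite normrX lerXn2r// nnegrE (le_trans _ (zB x)).
have s20 : 0 <= s ^+ 2 by exact: sqr_ge0.
have := bound zn _ _ mzn znB zn_mean zn_var s20 n a t (lexx t).
have -> : t + n%:R * s ^+ 2 = t + 1 by rewrite s2 mulfV// gt_eqF.
rewrite distrC => /le_trans; apply.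
have -> : n%:R * (C * ((s * B) ^+ 3 + (s ^+ 2) ^+ 2)) = (n%:R * s ^+ 2) * (C * (B ^+ 3 + s) * s).
  by ring.
rewrite s2 mulfV ?gt_eqF// mul1r.
have Ks : C * (B ^+ 3 + s) <= K.
  rewrite ler_wpM2l// lerD//.
  by rewrite (le_trans (ler_norm _))// normrX.
rewrite (le_trans (ler_wpM2r (ltW s0) Ks))//.
rewrite /s ler_pdivrMr ?sqrtr_gt0//.
rewrite -ler_pdivrMl// mulrC -(ler_pXn2r (n := 2))// ?nnegrE ?divr_ge0// ?(ltW e0)// ?sqrtr_ge0//.
rewrite sqr_sqrtr ?ltW//.
near: n; exact: nbhs_infty_gtr.
Unshelve. all: by end_near. Qed.

Variable Y : nat -> {RV P >-> R}.
Hypothesis Y_negl : forall dl : R, 0 < dl ->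
  fine (P [set w | dl < `|Y n w - partial_sum X z n w / Num.sqrt n%:R|]) @[n --> \oo] --> (0 : R).

Let mL n : measurable_fun setT (fun w => partial_sum X z n w / Num.sqrt n%:R).
Proof. by apply: measurable_funM => //; exact: measurable_partial_sum. Qed.

Let far n dl := [set w | dl < `|Y n w - partial_sum X z n w / Num.sqrt n%:R|].

Let mfar n dl : measurable (far n dl).
Proof.
have m : measurable_fun setT (fun w => `|Y n w - partial_sum X z n w / Num.sqrt n%:R|).
  by apply: measurableT_comp => //; apply: measurable_funB => //; exact: mL.
rewrite (_ : far n dl = setT `&`
  (fun w => `|Y n w - partial_sum X z n w / Num.sqrt n%:R|) @^-1` `]dl, +oo[%classic).
  exact: m.
by rewrite setTI; apply/seteqP; split=> w /=; rewrite in_itv/= andbT.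
Qed.

Let low n x : set T := Y n @^-1` `]-oo, x]%classic.

Let mlow n x : measurable (low n x).
Proof. by rewrite -[X in measurable X]setTI; exact: measurable_funP. Qed.

Let integrable_indicP (A : set T) : measurable A -> P.-integrable setT (EFin \o (\1_A : T -> R)).
Proof.
move=> mA; apply: (integrable_bounded P (C := 1)); first exact: measurable_indic.
by move=> w; rewrite indicE; case: (_ \in _); rewrite ?normr1 ?normr0.
Qed.

Let Rintegral_indicP (A : set T) : measurable A -> \int[P]_w (\1_A w : R) = fine (P A).
Proof. by move=> mA; rewrite /Rintegral integral_indic// setIT. Qed.

Let iheat n (a t : R) : P.-integrable setT (EFin \o
  (fun w => heat sg a t (partial_sum X z n w / Num.sqrt n%:R))).
Proof.
apply: (integrable_bounded P (C := 1)) => [|w]; last exact: heat_bounded.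
exact: measurableT_comp (measurable_heat _ _) (mL n).
Qed.

(** Off the event [far], Y <= x forces the normalised sum below x + dl. The indicator smoothed at x
    + 2 dl is there at least Phi(dl / sqrt t). *)
Let upper n (x dl t : R) : 0 < dl -> 0 < t -> fine (P (low n x)) <= fine (P (far n dl)) +
  \int[P]_w heat sg (x + 2 * dl) t (partial_sum X z n w / Num.sqrt n%:R) +
  (1 - gauss_cdf sg (dl * inv_sqrt t)).
Proof.
move=> dl0 t0; have v0 := inv_sqrt_gt0 t0.
have i2 := integrableD measurableT (integrable_indicP (mfar n dl)) (iheat n (x + 2 * dl) t).
have ic (c : R) : P.-integrable setT (EFin \o (fun=> c)).
  exact: (integrable_bounded P (C := `|c|)).
rewrite -!Rintegral_indicP// -RintegralD//; try exact: integrable_indicP.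
rewrite -[X in _ <= _ + X](Rintegral_cst_prob P) -RintegralD//.
apply: le_Rintegral => //; first exact: integrable_indicP.
  exact: (integrableD _ i2 (ic _)).
move=> w _ /=; rewrite !indicE /heat.
set L := partial_sum X z n w / _.
have p1 := gauss_cdf_le1 sg (dl * inv_sqrt t).
have p0 := gauss_cdf_ge0 sg ((x + 2 * dl - L) * inv_sqrt t).
have [|lw] := boolP (w \in low n x); rewrite ?inE/=; last by case: (_ \in _) => /=; lra.
rewrite /low/= in_itv/= => Yx.
have [|nf] := boolP (w \in far n dl); first by move=> _ /=; lra.
suff : gauss_cdf sg (dl * inv_sqrt t) <= gauss_cdf sg ((x + 2 * dl - L) * inv_sqrt t).
  by rewrite /=; lra.
apply: gauss_cdf_le => //; rewrite ler_pM2r//.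
move: nf; rewrite notin_setE /far/= => /negP; rewrite -leNgt ler_norml => /andP[].
by rewrite -/L; lra.
Qed.

(** Symmetric to [upper]: off [far], Y > x puts the sum above x - dl, where the indicator smoothed
    at x - 2 dl is at most Phi(- dl / sqrt t). *)
Let lower n (x dl t : R) : 0 < dl -> 0 < t ->
  \int[P]_w heat sg (x - 2 * dl) t (partial_sum X z n w / Num.sqrt n%:R) <=
  fine (P (low n x)) + fine (P (far n dl)) + gauss_cdf sg (- (dl * inv_sqrt t)).
Proof.
move=> dl0 t0; have v0 := inv_sqrt_gt0 t0.
have i2 := integrableD measurableT (integrable_indicP (mlow n x)) (integrable_indicP (mfar n dl)).
have ic (c : R) : P.-integrable setT (EFin \o (fun=> c)).
  exact: (integrable_bounded P (C := `|c|)).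
rewrite -!Rintegral_indicP// -RintegralD//; try exact: integrable_indicP.
rewrite -[X in _ <= _ + X](Rintegral_cst_prob P) -RintegralD//.
apply: le_Rintegral => //.
  exact: (integrableD _ i2 (ic _)).
move=> w _ /=; rewrite !indicE /heat.
set L := partial_sum X z n w / _.
have p1 := gauss_cdf_le1 sg ((x - 2 * dl - L) * inv_sqrt t).
have p0 := gauss_cdf_ge0 sg (- (dl * inv_sqrt t)).
have [_|lw] := boolP (w \in low n x); first by case: (_ \in _) => /=; lra.
have [_|nf] := boolP (w \in far n dl); first by rewrite /=; lra.
suff : gauss_cdf sg ((x - 2 * dl - L) * inv_sqrt t) <= gauss_cdf sg (- (dl * inv_sqrt t)).
  by rewrite /=; lra.
apply: gauss_cdf_le => //; rewrite -[leRHS]mulNr ler_pM2r//.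
move: lw; rewrite notin_setE /low/= in_itv/= => /negP; rewrite -ltNge => Yx.
move: nf; rewrite notin_setE /far/= => /negP; rewrite -leNgt ler_norml => /andP[].
by rewrite -/L; lra.
Qed.

(** The smoothing time is dl^4: the tails in [upper] and [lower] become Phi at 1/dl and at -1/dl,
    which tend to 1 and 0, while the limits Phi((x +- 2 dl) / sqrt (1 + dl^4)) tend to Phi(x). *)
Lemma clt_slutsky : cvg_in_distribution Y (normal_prob 0 sg).
Proof.
move=> x _; rewrite [X in _ --> X](_ : _ = (gauss_cdf sg x)%:E); last by rewrite gauss_cdf_fin.
rewrite (_ : (fun n => _) = EFin \o (fun n => fine (P (low n x)))); last first.
  by apply/funext => n; rewrite /= fineK// fin_num_measure.
apply: cvg_EFin; first by near=> n.
apply/cvgrPdist_le => e e0.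
have e40 : 0 < e / 4 by rewrite divr_gt0.
have v1 : inv_sqrt 1 = 1 :> R by rewrite /inv_sqrt powR1.
have cv : {for 1, continuous (@inv_sqrt R)}.
  exact: is_derive_continuous (is_derive_inv_sqrt ltr01).
have c4 : (dl ^+ 4 + 1 : R) @[dl --> 0^'+] --> (1 : R).
  rewrite -[X in _ --> X](_ : (0 : R) ^+ 4 + 1 = 1); last by rewrite expr0n add0r.
  apply: cvg_at_right_filter; apply: cvgD; last exact: cvg_cst.
  exact: exprn_continuous.
have cheat (c : R) : heat sg (x + c * dl) (dl ^+ 4 + 1) 0 @[dl --> 0^'+] --> gauss_cdf sg x.
  apply: continuous_cvg; first exact: continuous_gauss_cdf.
  rewrite -[X in _ --> X](_ : (x + c * 0 - 0) * inv_sqrt 1 = x); last first.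
    by rewrite mulr0 addr0 subr0 v1 mulr1.
  apply: cvgM; last exact: continuous_cvg c4.
  apply: cvg_at_right_filter; apply: cvgB; last exact: cvg_cst.
  by apply: cvgD; [exact: cvg_cst|apply: cvgM; [exact: cvg_cst|exact: cvg_id]].
have cinv : (fun dl : R => dl^-1) dl @[dl --> 0^'+] --> +oo.
  apply/gtr0_cvgV0.
    near=> dl; rewrite invr_gt0; near: dl; exact: nbhs_right_gt.
  rewrite (_ : unstable.inv_fun _ = idfun); last by apply/funext => y; exact: invrK.
  by apply: cvg_at_right_filter; exact: cvg_id.
have chi : gauss_cdf sg dl^-1 @[dl --> 0^'+] --> (1 : R).
  exact: (cvg_comp _ _ cinv (gauss_cdf_cvgy sg)).
have clo : gauss_cdf sg (- dl^-1) @[dl --> 0^'+] --> (0 : R).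
  exact: (cvg_comp _ _ cinv ((cvgNy_compNP _ _).1 (gauss_cdf_cvgNy sg))).
(* [dl] is fixed here, before [n] grows. Each side of the sandwich then uses four errors of e/4:
   threshold, tail, smoothed limit theorem, and the event [far]. *)
near (0 : R)^'+ => dl.
have dl0 : 0 < dl by near: dl; exact: nbhs_right_gt.
have t0 : 0 < dl ^+ 4 by rewrite exprn_gt0.
have vdl : dl * inv_sqrt (dl ^+ 4) = dl^-1.
  rewrite /inv_sqrt powRN -powR_mulrn ?ltW// -powRrM.
  rewrite (_ : 4%:R * 2^-1 = 2%:R); last by field.
  by rewrite powR_mulrn ?ltW//; field; rewrite gt_eqF.
have h1 : `|gauss_cdf sg x - heat sg (x + 2 * dl) (dl ^+ 4 + 1) 0| <= e / 4.
  by near: dl; have /cvgrPdist_le/(_ _ e40) := cheat 2.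
have h2 : `|gauss_cdf sg x - heat sg (x + (- 2) * dl) (dl ^+ 4 + 1) 0| <= e / 4.
  by near: dl; have /cvgrPdist_le/(_ _ e40) := cheat (- 2).
have h3 : `|1 - gauss_cdf sg dl^-1| <= e / 4.
  by near: dl; have /cvgrPdist_le/(_ _ e40) := chi.
have h4 : `|0 - gauss_cdf sg (- dl^-1)| <= e / 4.
  by near: dl; have /cvgrPdist_le/(_ _ e40) := clo.
have /cvgrPdist_le/(_ _ e40) n5 := @smoothed_clt (x + 2 * dl) _ t0.
have /cvgrPdist_le/(_ _ e40) n6 := @smoothed_clt (x - 2 * dl) _ t0.
have /cvgrPdist_le/(_ _ e40) n7 := Y_negl dl0.
apply: filterS3 n5 n6 n7 => n h5 h6 h7 /=.
have := upper n x dl0 t0; have := lower n x dl0 t0; rewrite vdl.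
move: h1 h2 h3 h4 h5 h6 h7; rewrite mulNr -/(far n dl).
move: (heat _ _ _ _) (heat _ _ _ _) (\int[P]_w _) (\int[P]_w _) => a1 a2 a3 a4.
move: (gauss_cdf sg x) (gauss_cdf sg dl^-1) (gauss_cdf sg (- dl^-1)) => g1 g2 g3.
rewrite !ler_norml; lra.
Unshelve. all: by end_near. Qed.

End heat_partial_sum.

(** * Expansion of the estimator *)

Section asymptotic_order.
Context {R : realType} {H : Type}.
Variable eta : H -> R.
Hypothesis eta0 : forall h, 0 <= eta h.

(** The order eta^k near eta = 0. The condition r <= 1 makes higher powers of eta smaller, so that
    higher order implies lower order. *)
Definition isO k (f : H -> R) := exists C r : R,
  [/\ 0 <= C, 0 < r, r <= 1 & forall h, eta h <= r -> `|f h| <= C * eta h ^+ k].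

Lemma isO_eq k f g : f =1 g -> isO k g -> isO k f.
Proof.
by move=> fg [C [r [? ? ? gC]]]; exists C, r; split => // h /gC; rewrite fg.
Qed.

Lemma isOD k f g : isO k f -> isO k g -> isO k (fun h => f h + g h).
Proof.
move=> [C [r [C0 r0 r1 fC]]] [D [s [D0 s0 s1 gD]]].
exists (C + D), (minr r s); split; rewrite ?addr_ge0 ?lt_min ?r0 ?ge_min ?r1// => h.
rewrite le_min => /andP[/fC hf /gD hg].
by rewrite mulrDl (le_trans (ler_normD _ _))// lerD.
Qed.

Lemma isOM k l f g : isO k f -> isO l g -> isO (k + l) (fun h => f h * g h).
Proof.
move=> [C [r [C0 r0 r1 fC]]] [D [s [D0 s0 s1 gD]]].
exists (C * D), (minr r s); split; rewrite ?mulr_ge0 ?lt_min ?r0 ?ge_min ?r1// => h.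
rewrite le_min => /andP[/fC hf /gD hg].
by rewrite normrM exprD mulrACA ler_pM.
Qed.

Lemma isO_le k l f : (k <= l)%N -> isO l f -> isO k f.
Proof.
move=> kl [C [r [C0 r0 r1 fC]]]; exists C, r; split => // h hr.
by rewrite (le_trans (fC h hr))// ler_wpM2l// ler_wiXn2l// (le_trans hr).
Qed.

Lemma isO_cst (c : R) : isO 0 (fun=> c).
Proof. by exists `|c|, 1; split => // h _; rewrite expr0 mulr1. Qed.

Lemma isO0 k : isO k (fun=> 0).
Proof. by exists 0, 1; split => // h _; rewrite normr0 mul0r. Qed.

Lemma isOZ k (c : R) f : isO k f -> isO k (fun h => c * f h).
Proof. exact: isOM (isO_cst c). Qed.

Lemma isON k f : isO k f -> isO k (fun h => - f h).
Proof. by move=> /(isOZ (-1)); apply: isO_eq => h; rewrite mulN1r. Qed.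

Lemma isOB k f g : isO k f -> isO k g -> isO k (fun h => f h - g h).
Proof. by move=> fk /isON; exact: isOD. Qed.

Lemma isO_sum k (I : Type) (s : seq I) (f : I -> H -> R) : (forall i, isO k (f i)) ->
  isO k (fun h => \sum_(i <- s) f i h).
Proof.
move=> fk; elim: s => [|i s ih].
  by apply: isO_eq (isO0 k) => h; rewrite big_nil.
by apply: isO_eq (isOD (fk i) ih) => h; rewrite big_cons.
Qed.

(** A first-order expansion with quadratic error. For the calculus it is enough that [l] be of order
    eta, so linearity is not asked. *)
Definition jet (f : H -> R) (c : R) (l : H -> R) :=
  isO 1 l /\ isO 2 (fun h => f h - c - l h).

Lemma jet_isO1 f c l : jet f c l -> isO 1 (fun h => f h - c).
Proof.
move=> [l1 /(isO_le (leqnSn 1)) f2]; apply: isO_eq (isOD f2 l1) => h /=; ring.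
Qed.

Lemma jet_isO0 f c l : jet f c l -> isO 0 f.
Proof.
move=> /jet_isO1 /(isO_le (leqnSn 0)) f1; apply: isO_eq (isOD f1 (isO_cst c)) => h /=; ring.
Qed.

Lemma jetZ (a : R) f c l : jet f c l -> jet (fun h => a * f h) (a * c) (fun h => a * l h).
Proof.
move=> [l1 f2]; split; first exact: isOZ.
by apply: isO_eq (isOZ a f2) => h /=; ring.
Qed.

Lemma jetM f c l g c' l' : jet f c l -> jet g c' l' ->
  jet (fun h => f h * g h) (c * c') (fun h => c * l' h + c' * l h).
Proof.
move=> jf jg; have [l1 f2] := jf; have [l1' g2] := jg.
split; first by apply: isOD; exact: isOZ.
apply: isO_eq (isOD (isOD (isOM f2 (jet_isO0 jg)) (isOM l1 (jet_isO1 jg))) (isOZ c g2)) => h /=.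
by ring.
Qed.

(** Shrinking the neighbourhood keeps f >= c/2, which bounds the inverse. *)
Lemma jetV f c l : 0 < c -> jet f c l ->
  jet (fun h => (f h)^-1) c^-1 (fun h => - (c ^- 2) * l h).
Proof.
move=> c0 jf; have [l1 f2] := jf; split; first exact: isOZ.
have c20 : 0 < c / 2 by rewrite divr_gt0.
have [C [r [C0 r0 r1 fC]]] := jet_isO1 jf.
pose s := minr r (c / 2 / (C + 1)).
have s0 : 0 < s by rewrite lt_min r0 divr_gt0// ltr_wpDl.
have f_ge h : eta h <= s -> c / 2 <= f h.
  rewrite le_min => /andP[/fC hf he].
  have : `|f h - c| <= c / 2.
    apply: (le_trans hf); rewrite expr1 (@le_trans _ _ ((C + 1) * eta h))//.
      by rewrite ler_wpM2r// lerDl.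
    by rewrite mulrC -ler_pdivlMr// ltr_wpDl.
  by rewrite ler_norml; lra.
have fV : isO 0 (fun h => (f h)^-1).
  exists (c / 2)^-1, s; split => //; first by rewrite invr_ge0 ltW.
    by rewrite ge_min r1.
  move=> h /f_ge hf; have fh0 := lt_le_trans c20 hf.
  by rewrite expr0 mulr1 gtr0_norm ?invr_gt0// lef_pV2.
(* The error is (l (f - c) - c (f - c - l)) / (c^2 f). This identity divides by [f h], which is
   known to be nonzero only for eta <= s, so [isO_eq] cannot be used and the radius is cut down. *)
clearbody s; have [D [u [D0 u0 u1 gD]]] := isOM fV (isOZ (c ^- 2) (isOD (isOZ (- c) f2) (isOM l1 (jet_isO1 jf)))).
exists D, (minr u s); split => //; first by rewrite lt_min u0.
  by rewrite ge_min u1.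
move=> h; rewrite le_min => /andP[hu hs]; apply: le_trans (gD h hu); rewrite le_eqVlt; apply/orP; left.
apply/eqP; congr (`|_|) => /=; field.
by rewrite !gt_eqF// (lt_le_trans c20)// f_ge.
Qed.

(** sqrt f - c = (f - c^2) / (sqrt f + c) is of first order, and the error equals ((f - c^2 - l) -
    (sqrt f - c)^2) / (2 c). *)
Lemma jet_sqrt f c l : 0 < c -> (forall h, 0 <= f h) -> jet f (c ^+ 2) l ->
  jet (fun h => Num.sqrt (f h)) c (fun h => l h / (2 * c)).
Proof.
move=> c0 f0 jf; have [l1 f2] := jf; split.
  by apply: isO_eq (isOZ (2 * c)^-1 l1) => h; rewrite mulrC.
have gV : isO 0 (fun h => (Num.sqrt (f h) + c)^-1).
  exists c^-1, 1; split => // [|h _]; first by rewrite invr_ge0 ltW.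
  have gc : c <= Num.sqrt (f h) + c by rewrite lerDr sqrtr_ge0.
  have gc0 := lt_le_trans c0 gc.
  by rewrite expr0 mulr1 gtr0_norm ?invr_gt0// lef_pV2.
have g1 : isO 1 (fun h => Num.sqrt (f h) - c).
  apply: isO_eq (isOM gV (jet_isO1 jf)) => h /=.
  rewrite -{3}(sqr_sqrtr (f0 h)); field.
  by rewrite gt_eqF// ltr_wpDl// sqrtr_ge0.
apply: isO_eq (isOZ (2 * c)^-1 (isOB f2 (isOM g1 g1))) => h /=.
rewrite -{2}(sqr_sqrtr (f0 h)); field; rewrite gt_eqF//.
Qed.

Definition visO d k (u : H -> 'cV[R]_d) := forall i, isO k (fun h => u h i 0).

Lemma isO_dotv d k l (u v : H -> 'cV[R]_d) : visO k u -> visO l v ->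
  isO (k + l) (fun h => dotv (u h) (v h)).
Proof.
move=> uk vl; apply: isO_eq (isO_sum (index_enum 'I_d) (fun i => isOM (uk i) (vl i))) => h.
by rewrite /dotv mxE; apply: eq_bigr => i _; rewrite mxE.
Qed.

Lemma visO_mulmx d k l (M : H -> 'M[R]_d) (u : H -> 'cV[R]_d) :
  (forall i j, isO k (fun h => M h i j)) -> visO l u -> visO (k + l) (fun h => M h *m u h).
Proof.
move=> Mk ul i; apply: isO_eq (isO_sum (index_enum 'I_d) (fun j => isOM (Mk i j) (ul j))) => h.
by rewrite mxE.
Qed.

Lemma visO_cst d (u : 'cV[R]_d) : visO 0 (fun=> u).
Proof. by move=> i; exact: isO_cst. Qed.

Lemma visOZ d k (c : R) (u : H -> 'cV[R]_d) : visO k u -> visO k (fun h => c *: u h).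
Proof. by move=> uk i; apply: isO_eq (isOZ c (uk i)) => h; rewrite mxE. Qed.

Lemma visOB d k (u v : H -> 'cV[R]_d) : visO k u -> visO k v -> visO k (fun h => u h - v h).
Proof. by move=> uk vk i; apply: isO_eq (isOB (uk i) (vk i)) => h; rewrite !mxE. Qed.

End asymptotic_order.

Section delta_method.
Context {R : realType} (d : nat).
Implicit Types (u v : 'cV[R]_d) (M : 'M[R]_d).

Lemma dotvC u v : dotv u v = dotv v u.
Proof.
by rewrite /dotv !mxE; apply: eq_bigr => i _; rewrite !mxE mulrC.
Qed.

Lemma dotvDr u v v' : dotv u (v + v') = dotv u v + dotv u v'.
Proof. by rewrite /dotv mulmxDr mxE. Qed.

Lemma dotvZr (c : R) u v : dotv u (c *: v) = c * dotv u v.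
Proof. by rewrite /dotv -scalemxAr mxE. Qed.

Lemma dotvNr u v : dotv u (- v) = - dotv u v.
Proof. by rewrite -scaleN1r dotvZr mulN1r. Qed.

Lemma dotvDl u u' v : dotv (u + u') v = dotv u v + dotv u' v.
Proof. by rewrite !(dotvC _ v) dotvDr. Qed.

Lemma dotvZl (c : R) u v : dotv (c *: u) v = c * dotv u v.
Proof. by rewrite !(dotvC _ v) dotvZr. Qed.

Lemma dotvv_ge0 u : 0 <= dotv u u.
Proof.
by rewrite /dotv mxE sumr_ge0// => i _; rewrite mxE -expr2 sqr_ge0.
Qed.

Lemma dotv_mulmx M u v : M^T = M -> dotv u (M *m v) = dotv (M *m u) v.
Proof. by move=> MT; rewrite /dotv trmx_mul MT mulmxA. Qed.

(** The estimator as a function of the sample mean and of a symmetric [M], after clearing the norms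
    hidden in [mu_hat]; no inverse of the norm of [Y] remains. *)
Definition kappa_fun (Y : 'cV[R]_d) M : R :=
  (d%:R - 1) * (enorm Y * dotv Y (M *m Y)) / dotv (M *m Y) (M *m Y).

(* Both sides are [0] when the sample mean vanishes. *)
Lemma kappa_STE n (x : nat -> d.-tuple R) :
  kappa_ST n x = kappa_fun (sample_mean n x) (1%:M - sample_moment2 n x).
Proof.
have ST : (sample_moment2 n x)^T = sample_moment2 n x.
  rewrite /sample_moment2 linearZ/= linear_sum/=; congr (_ *: _).
  by apply: eq_bigr => i _; rewrite trmx_mul trmxK.
rewrite /kappa_ST /kappa_fun /mu_hat.
set M := 1%:M - _; set Y := sample_mean n x; set rho := enorm Y.
have MT : M^T = M by rewrite /M linearB/= trmx1 ST.
have num u v : (u^T *m M *m v) 0 0 = dotv u (M *m v) by rewrite /dotv mulmxA.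
have den u : (u^T *m (M *m M) *m u) 0 0 = dotv (M *m u) (M *m u).
  by rewrite -(dotv_mulmx _ _ MT) /dotv !mulmxA.
rewrite num den; clearbody M; clearbody rho; clearbody Y.
rewrite -!scalemxAr !dotvZl !dotvZr.
have [->|rho0] := eqVneq rho 0; first by rewrite invr0 !mul0r mulr0 !mul0r.
by rewrite !invfM !invrK; move: (dotv _ _) (dotv _ _)^-1 => a b; field.
Qed.

(** The Euclidean norm of all the entries: its square is a sum of squares, whose mean is computed
    from second moments. *)
Definition perturbation_size (h : 'cV[R]_d * 'M[R]_d) : R :=
  Num.sqrt (\sum_i h.1 i 0 ^+ 2 + \sum_(p : 'I_d * 'I_d) h.2 p.1 p.2 ^+ 2).

Local Notation eta := perturbation_size.

Let eta0 h : 0 <= eta h. Proof. exact: sqrtr_ge0. Qed.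

Let sum1_ge0 (h : 'cV[R]_d * 'M[R]_d) : 0 <= \sum_i h.1 i 0 ^+ 2.
Proof. by rewrite sumr_ge0// => i _; rewrite sqr_ge0. Qed.

Let sum2_ge0 (h : 'cV[R]_d * 'M[R]_d) : 0 <= \sum_(p : 'I_d * 'I_d) h.2 p.1 p.2 ^+ 2.
Proof. by rewrite sumr_ge0// => i _; rewrite sqr_ge0. Qed.

Lemma perturbation_size_sqr h : eta h ^+ 2 =
  \sum_i h.1 i 0 ^+ 2 + \sum_(p : 'I_d * 'I_d) h.2 p.1 p.2 ^+ 2.
Proof. by rewrite sqr_sqrtr// addr_ge0. Qed.

Let visO_fst : visO eta 1 (fun h => h.1).
Proof.
move=> i; exists 1, 1; split => // h _.
rewrite expr1 mul1r -sqrtr_sqr ler_wsqrtr// (bigD1 i)//= -addrA lerDl addr_ge0//.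
by rewrite sumr_ge0// => j _; rewrite sqr_ge0.
Qed.

Let isO_snd i j : isO eta 1 (fun h => h.2 i j).
Proof.
exists 1, 1; split => // h _.
rewrite expr1 mul1r -sqrtr_sqr ler_wsqrtr// addrC (bigD1 (i, j))//= -addrA lerDl addr_ge0//.
by rewrite sumr_ge0// => p _; rewrite sqr_ge0.
Qed.

Variables (mu : 'cV[R]_d) (M0 : 'M[R]_d) (A m k : R).
Hypothesis mu1 : dotv mu mu = 1.
Hypothesis M0T : M0^T = M0.
Hypothesis M0mu : M0 *m mu = m *: mu.
Hypothesis A0 : 0 < A.
Hypothesis m0 : 0 < m.
Hypothesis Ak : (d%:R - 1) * A = k * m.

(* The perturbation [h] is the pair of [Y - A mu] and [M0 - M]. *)
Lemma kappa_fun_expansion : isO eta 2 (fun h =>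
  kappa_fun (A *: mu + h.1) (M0 - h.2) - k
    - ((d%:R - 1) * dotv mu h.1 + k * dotv mu (h.2 *m mu)) / m).
Proof.
pose Y (h : 'cV[R]_d * 'M[R]_d) := A *: mu + h.1.
pose a (h : 'cV[R]_d * 'M[R]_d) := dotv mu h.1.
pose b (h : 'cV[R]_d * 'M[R]_d) := dotv mu (h.2 *m mu).
(* [w] and [- r] are the first-order and the quadratic parts of the perturbation of M Y around A m
   mu. *)
pose w (h : 'cV[R]_d * 'M[R]_d) := M0 *m h.1 - A *: (h.2 *m mu).
pose r (h : 'cV[R]_d * 'M[R]_d) := h.2 *m h.1.
have vE h : (M0 - h.2) *m Y h = (A * m) *: mu + (w h - r h).
  rewrite /Y /w /r mulmxBl !mulmxDr -!scalemxAr M0mu scalerA.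
  by rewrite opprD -!addrA; congr (_ + _); rewrite addrCA !addrA.
have a1 : isO eta 1 a by exact: isO_dotv (visO_cst _ mu) visO_fst.
have dmu : visO eta 1 (fun h => h.2 *m mu) by exact: visO_mulmx isO_snd (visO_cst _ mu).
have b1 : isO eta 1 b by exact: isO_dotv (visO_cst _ mu) dmu.
have w1 : visO eta 1 w.
  apply: visOB; last exact: visOZ.
  exact: (visO_mulmx (M := fun=> M0) (fun i j => isO_cst eta (M0 i j)) visO_fst).
have r2 : visO eta 2 r by exact: visO_mulmx isO_snd visO_fst.
have wr1 : visO eta 1 (fun h => w h - r h).
  by apply: visOB => // i; apply: isO_le (r2 i).
(* As M Y is close to a multiple of mu, only the component of [w] along mu enters at first order;
   [M0] being symmetric with eigenvector mu, it depends on [a] and [b] alone. *)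
have muw h : dotv mu (w h) = m * a h - A * b h.
  by rewrite /w dotvDr dotvNr dotvZr dotv_mulmx// M0mu dotvZl.
have mur2 : isO eta 2 (fun h => dotv mu (r h)) by exact: isO_dotv (visO_cst _ mu) r2.
clearbody w r.
have jp : jet eta (fun h => dotv (Y h) (Y h)) (A ^+ 2) (fun h => 2 * A * a h).
  split; first exact: isOZ.
  apply: isO_eq (isO_dotv visO_fst visO_fst) => h /=.
  by rewrite /Y !(dotvDl, dotvDr, dotvZl, dotvZr) mu1 (dotvC h.1) /a; ring.
have jN : jet eta (fun h => dotv (Y h) ((M0 - h.2) *m Y h)) (A ^+ 2 * m)
    (fun h => 2 * A * m * a h - A ^+ 2 * b h).
  split; first by apply: isOB; exact: isOZ.
  apply: isO_eq (isOB (isO_dotv visO_fst wr1) (isOZ A mur2)) => h /=.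
  rewrite vE /Y !(dotvDl, dotvDr, dotvZl, dotvZr, dotvNr) mu1 (dotvC h.1 mu) muw /a.
  by ring.
have jD : jet eta (fun h => dotv ((M0 - h.2) *m Y h) ((M0 - h.2) *m Y h)) (A ^+ 2 * m ^+ 2)
    (fun h => 2 * A * m * (m * a h - A * b h)).
  split; first by apply: isOZ; apply: isOB; exact: isOZ.
  apply: isO_eq (isOB (isO_dotv wr1 wr1) (isOZ (2 * A * m) mur2)) => h /=.
  rewrite vE; set q := w h - r h.
  have : dotv mu q = m * a h - A * b h - dotv mu (r h) by rewrite /q dotvDr dotvNr muw.
  clearbody q => muq.
  by rewrite !(dotvDl, dotvDr, dotvZl, dotvZr) mu1 (dotvC q mu) muq; ring.
have js := jet_sqrt eta0 A0 (fun h => dotvv_ge0 (Y h)) jp.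
have D0 : 0 < A ^+ 2 * m ^+ 2 by rewrite mulr_gt0// exprn_gt0.
have [_] := jetM eta0 (jetZ (d%:R - 1) (jetM eta0 js jN)) (jetV eta0 D0 jD).
apply: isO_eq => h; rewrite -/(a h) -/(b h) /kappa_fun -/(Y h) /enorm /=.
have -> : k = (d%:R - 1) * A / m by rewrite Ak mulfK// gt_eqF.
congr (_ - _ - _); field; first by rewrite !gt_eqF.
by rewrite !gt_eqF.
Qed.

End delta_method.

(** * Asymptotic normality of the estimator *)

Section markov_partial_sums.
Context dT (T : measurableType dT) (R : realType) (P : probability T R).
Context dX (T' : measurableType dX) (X : nat -> {RV P >-> T'}).
Variables (Q : probability T' R) (I : finType) (z : I -> T' -> R) (B : I -> R).
Hypothesis X_indep : mutually_independent X.
Hypothesis X_law : forall i A, measurable A -> P (X i @^-1` A) = Q A.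
Hypothesis mz : forall i, measurable_fun setT (z i).
Hypothesis zB : forall i x, `|z i x| <= B i.
Hypothesis z_mean : forall i, \int[Q]_x z i x = 0.

Let q n (w : T) : R := \sum_i partial_sum X (z i) n w ^+ 2.

Lemma measurable_sum_partial_sum_sqr n : measurable_fun setT (q n).
Proof.
apply: measurable_sum => i; apply: measurable_funX; exact: measurable_partial_sum.
Qed.

(** Markov's inequality: centred independent summands give second moments that grow linearly in
    [n]. *)
Lemma markov_partial_sums (c : R) n : 0 < c ->
  fine (P [set w | c <= \sum_i partial_sum X (z i) n w ^+ 2]) <=
    n%:R * (\sum_i \int[Q]_x (z i x ^+ 2)) / c.
Proof.
move=> c0; have mq := measurable_sum_partial_sum_sqr n.
set E := [set w | _].
have mE : measurable E.
  rewrite (_ : E = setT `&` q n @^-1` `[c, +oo[%classic); first exact: mq.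
  by rewrite setTI; apply/seteqP; split=> w /=; rewrite in_itv/= andbT.
rewrite ler_pdivlMr// -lee_fin EFinM fineK ?fin_num_measure//.
rewrite -[X in (X * _)%E](_ : (\int[P]_w (\1_E w)%:E)%E = _); last by rewrite integral_indic// setIT.
rewrite muleC -ge0_integralZl//; last 2 first.
- by apply/measurable_EFinP; exact: measurable_indic.
- by rewrite lee_fin ltW.
have -> : (n%:R * (\sum_i \int[Q]_x (z i x ^+ 2)))%:E = (\int[P]_w (q n w)%:E)%E.
  under eq_integral do rewrite /q -sumEFin.
  rewrite ge0_integral_sum//; last 2 first.
  - move=> i; apply/measurable_EFinP; apply: measurable_funX.
    exact: measurable_partial_sum.
  - by move=> i w _; rewrite lee_fin sqr_ge0.
  rewrite mulr_sumr -sumEFin; apply: eq_bigr => i _.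
  by rewrite (second_moment_partial_sum X_indep X_law (mz i) (zB i) (z_mean i)).
apply: ge0_le_integral => //.
- by move=> w _; rewrite -EFinM lee_fin mulr_ge0// ltW.
- by apply/measurable_EFinP; apply: measurable_funM => //; exact: measurable_indic.
- by apply/measurable_EFinP.
move=> w _; rewrite -EFinM lee_fin indicE.
have [|_] := boolP (w \in E); first by rewrite inE mulr1.
by rewrite mulr0 sumr_ge0// => i _; rewrite sqr_ge0.
Qed.

End markov_partial_sums.

Section remainder.
Context dT (T : measurableType dT) (R : realType) (P : probability T R).

Lemma fine_measure_le_ae (A B : set T) (G : T -> Prop) :
  measurable A -> measurable B -> {ae P, forall w, G w} ->
  (forall w, G w -> A w -> B w) -> fine (P A) <= fine (P B).
Proof.
move=> mA mB [N [mN N0 GN]] AB.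
rewrite fine_le ?fin_num_measure//.
have -> : P B = P (B `|` N) by rewrite measureU0.
apply: le_measure; rewrite ?inE//; first exact: measurableU.
move=> w Aw; have [Gw|nG] := pselect (G w); first by left; exact: AB.
by right; apply: GN.
Qed.

End remainder.

(** * First and second moments in coordinates, and cut-off to the sphere *)

Section vmf_moments.
Context {R : realType} (n : nat).
Local Notation tup := (n.-tuple R).
Variables (mu : tup) (k : R) (Q : probability tup R).
Hypotheses (n2 : (2 <= n)%N) (mu1 : tdot mu mu = 1).
Hypothesis QE : forall A, measurable A -> Q A = vmf mu k A.

Lemma bounded_on_sphere_tnth i : bounded_on_sphere (fun x : tup => tnth x i).
Proof.
split; first exact: measurable_tnth.
exists 1 => x; rewrite /sphere/= dotv_tcol => x1.
by rewrite -(expr_le1 (n := 2))// -normrX ger0_norm ?sqr_ge0// -x1 tdot_ge_sqr.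
Qed.

Lemma Rintegral_vmf_sum (I : Type) (s : seq I) (f : I -> tup -> R) :
  (forall i, bounded_on_sphere (f i)) ->
  \int[Q]_x (\sum_(i <- s) f i x) = \sum_(i <- s) \int[Q]_x f i x.
Proof.
move=> bf.
have bs r : bounded_on_sphere (fun x => \sum_(i <- r) f i x).
  elim: r => [|i r ih].
    by under eq_fun do rewrite big_nil; exact: bounded_on_sphere_cst.
  by under eq_fun do rewrite big_cons; exact: bounded_on_sphereD.
elim: s => [|i s ih].
  by under eq_Rintegral do rewrite big_nil; rewrite big_nil Rintegral_cst_prob.
under eq_Rintegral do rewrite big_cons.
rewrite big_cons -ih RintegralD//.
  exact: (integrable_vmf QE (bf i)).
exact: (integrable_vmf QE (bs s)).
Qed.

(** The vector e_i - mu_i mu is orthogonal to mu, so its mixed moments with powers of t vanish. *)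
Lemma vmf_moment_coord i j :
  \int[Q]_x (tnth x i * tdot mu x ^+ j) = tnth mu i * \int[Q]_x (tdot mu x ^+ j.+1).
Proof.
pose u := [tuple (l == i)%:R - tnth mu i * tnth mu l | l < n].
have uE x : tdot u x = tnth x i - tnth mu i * tdot mu x.
  rewrite /tdot mulr_sumr; under eq_bigr do rewrite tnth_mktuple mulrBl.
  rewrite sumrB; congr (_ - _); last by apply: eq_bigr => l _; rewrite mulrA.
  rewrite (bigD1 i)//= eqxx mul1r big1 ?addr0// => l /negPf ->.
  by rewrite mul0r.
have u0 : tdot u mu = 0 by rewrite uE mu1 mulr1 subrr.
have := vmf_orthogonal n2 QE j u0.
have b1 : bounded_on_sphere (fun x => tnth x i * tdot mu x ^+ j).
  by apply: bounded_on_sphereM; [exact: bounded_on_sphere_tnth|exact: bounded_on_sphere_tdotX].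
have b2 := bounded_on_sphere_tdotX mu j.+1.
have b3 := bounded_on_sphereM (bounded_on_sphere_cst n (tnth mu i)) b2.
under eq_Rintegral do rewrite uE mulrBl -mulrA -exprS.
rewrite (RintegralB measurableT (integrable_vmf QE b1) (integrable_vmf QE b3)).
rewrite RintegralZl//; last exact: (integrable_vmf QE b2).
by move/eqP; rewrite subr_eq0 => /eqP.
Qed.

Definition vmf_moment2 : 'M[R]_n := \matrix_(i, j) \int[Q]_x (tnth x i * tnth x j).

Lemma vmf_moment2_tr : vmf_moment2^T = vmf_moment2.
Proof.
by apply/matrixP => i j; rewrite !mxE; apply: eq_Rintegral => x _; rewrite mulrC.
Qed.

(** E [x x^T] mu = E [t x], which is E [t^2] mu by the coordinate formula with exponent 1. *)
Lemma vmf_moment2_mulmx :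
  (1%:M - vmf_moment2) *m tcol mu = vmf_tangent mu Q *: tcol mu.
Proof.
apply/matrixP => i j; rewrite mulmxBl mul1mx !mxE.
have -> : \sum_l vmf_moment2 i l * tcol mu l j = \int[Q]_x (tnth x i * tdot mu x ^+ 1).
  have bt l : bounded_on_sphere (fun x : tup => tnth x i * tnth x l).
    by apply: bounded_on_sphereM; exact: bounded_on_sphere_tnth.
  have bl l : bounded_on_sphere (fun x => tnth mu l * (tnth x i * tnth x l)).
    by apply: bounded_on_sphereM => //; exact: bounded_on_sphere_cst.
  transitivity (\int[Q]_x (\sum_l tnth mu l * (tnth x i * tnth x l))); last first.
    apply: eq_Rintegral => x _; rewrite expr1 mulr_sumr.
    by apply: eq_bigr => l _; ring.
  rewrite Rintegral_vmf_sum//; apply: eq_bigr => l _; rewrite !mxE RintegralZl 1?mulrC//.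
  exact: (integrable_vmf QE (bt l)).
rewrite vmf_moment_coord /vmf_tangent RintegralB//; last 2 first.
- exact: (integrable_vmf QE (bounded_on_sphere_cst n 1)).
- exact: (integrable_vmf QE (bounded_on_sphere_tdotX mu 2)).
by rewrite Rintegral_cst_prob; ring.
Qed.

(** Makes a function that is bounded on the sphere bounded everywhere, as the limit theorem and
    Markov's inequality require, without changing its integral under [Q]. *)
Definition sphere_cut (g : tup -> R) (x : tup) : R := g x * \1_(sphere n) x.

Lemma sphere_cutE g x : sphere n x -> sphere_cut g x = g x.
Proof. by move=> Sx; rewrite /sphere_cut indicE mem_set// mulr1. Qed.

Lemma measurable_sphere_cut g : bounded_on_sphere g -> measurable_fun setT (sphere_cut g).
Proof.
move=> [mg _]; apply: measurable_funM => //; apply: measurable_indic.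
exact: measurable_sphere.
Qed.

Lemma sphere_cut_bounded g : bounded_on_sphere g -> exists C, forall x, `|sphere_cut g x| <= C.
Proof.
move=> [_ [C gC]]; exists `|C| => x; rewrite /sphere_cut indicE.
have [|_] := boolP (x \in sphere n); last by rewrite mulr0 normr0.
by rewrite inE mulr1 => /gC /le_trans; apply; exact: ler_norm.
Qed.

Lemma bounded_on_sphere_cut g : bounded_on_sphere g -> bounded_on_sphere (sphere_cut g).
Proof.
move=> bg; split; first exact: measurable_sphere_cut.
by have [C gC] := sphere_cut_bounded bg; exists C.
Qed.

Lemma Rintegral_sphere_cut g : bounded_on_sphere g -> \int[Q]_x sphere_cut g x = \int[Q]_x g x.
Proof.
move=> bg; apply: (eq_Rintegral_vmf n2 QE) => //; first exact: bounded_on_sphere_cut.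
exact: sphere_cutE.
Qed.

Lemma vmf_sphereC : Q (~` sphere n) = 0%E.
Proof.
have mS := measurableC (@measurable_sphere R n).
have b0 := bounded_on_sphere_cst n (1 : R).
have : \int[Q]_x (1 - sphere_cut (fun=> 1) x) = 0.
  rewrite RintegralB// ?Rintegral_sphere_cut// ?subrr//.
    exact: (integrable_vmf QE b0).
  exact: (integrable_vmf QE (bounded_on_sphere_cut b0)).
under eq_Rintegral => x _.
  rewrite (_ : 1 - _ = \1_(~` sphere n) x); last first.
    by rewrite /sphere_cut mul1r !indicE in_setC; case: (x \in sphere n); rewrite ?subrr ?subr0.
  over.
rewrite /Rintegral integral_indic// setIT => Q0.
by rewrite -[LHS]fineK ?fin_num_measure// Q0.
Qed.

End vmf_moments.

(** * Linearisation of the estimator around the population moments *)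

Section kappa_ST_asymptotics.
Context dT (T : measurableType dT) (R : realType) (P : probability T R) (d : nat).
Variables (X : nat -> {RV P >-> d.-tuple R}) (mu : d.-tuple R) (k : R).
Variable Q : probability (d.-tuple R) R.
Hypotheses (d2 : (2 <= d)%N) (mu1 : tdot mu mu = 1) (k0 : 0 < k).
Hypothesis QE : forall A, measurable A -> Q A = vmf mu k A.
Hypothesis X_indep : mutually_independent X.
Hypothesis X_law : forall i A, measurable A -> P (X i @^-1` A) = Q A.

Let A : R := \int[Q]_x tdot mu x.
Let m : R := vmf_tangent mu Q.
Let S0 := vmf_moment2 Q.

Let m0 : 0 < m. Proof. exact: vmf_tangent_gt0 d2 mu1 k0 QE. Qed.

Let Akm : (d%:R - 1) * A = k * m. Proof. exact: vmf_mean_tangent d2 mu1 QE. Qed.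

Let A0 : 0 < A.
Proof.
have d1 : 0 < d%:R - 1 :> R by rewrite subr_gt0 ltr1n.
by rewrite -(pmulr_rgt0 _ d1) Akm mulr_gt0.
Qed.

(** One index for the entries of both sample moments, in the shape of the sums in
    [perturbation_size]. *)
Let I := ('I_d + 'I_d * 'I_d)%type.

Let f (s : I) (x : d.-tuple R) : R := match s with
  | inl i => tnth x i - A * tnth mu i
  | inr p => tnth x p.1 * tnth x p.2 - S0 p.1 p.2
  end.

Let bounded_f s : bounded_on_sphere (f s).
Proof.
have bt i := @bounded_on_sphere_tnth R d i.
case: s => [i|p] /=; apply: bounded_on_sphereD => //; try exact: bounded_on_sphere_cst.
exact: bounded_on_sphereM.
Qed.

Let iv g : bounded_on_sphere g -> Q.-integrable setT (EFin \o g).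
Proof. exact: integrable_vmf QE g. Qed.

Let f_mean s : \int[Q]_x sphere_cut (f s) x = 0.
Proof.
rewrite (Rintegral_sphere_cut d2 QE)//; case: s => [i|p] /=.
- have := vmf_moment_coord d2 mu1 QE i 0.
  under eq_Rintegral do rewrite mulr1.
  under [in RHS]eq_Rintegral do rewrite expr1.
  move=> E; rewrite RintegralB//; last 2 first.
  - exact: iv (bounded_on_sphere_tnth i).
  - exact: iv (bounded_on_sphere_cst d _).
  by rewrite E Rintegral_cst_prob mulrC subrr.
rewrite RintegralB//; last 2 first.
- exact: iv (bounded_on_sphereM (bounded_on_sphere_tnth p.1) (bounded_on_sphere_tnth p.2)).
- exact: iv (bounded_on_sphere_cst d _).
by rewrite Rintegral_cst_prob mxE subrr.
Qed.

Definition kappa_influence x := - m^-1 * vmf_score mu k x.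

Local Notation zeta := (sphere_cut kappa_influence).

Let bounded_score : bounded_on_sphere (vmf_score mu k).
Proof.
have bt := bounded_on_sphere_tdot mu; have bc c := bounded_on_sphere_cst d (c : R).
have bt2 := bounded_on_sphere_tdotX mu 2.
rewrite (_ : vmf_score mu k = fun x =>
  k * (1 + (- 1) * tdot mu x ^+ 2) + (- (d%:R - 1)) * tdot mu x).
  by do ?[exact: bc|exact: bt|exact: bt2|apply: bounded_on_sphereD|apply: bounded_on_sphereM].
by apply/funext => x; rewrite /vmf_score; ring.
Qed.

Let bounded_influence : bounded_on_sphere kappa_influence.
Proof. exact: bounded_on_sphereM (bounded_on_sphere_cst d _) bounded_score. Qed.

Let influence_mean : \int[Q]_x zeta x = 0.
Proof.
rewrite (Rintegral_sphere_cut d2 QE)// /kappa_influence RintegralZl//; last exact: iv.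
by rewrite (vmf_score_mean d2 mu1 QE) mulr0.
Qed.

Let bounded_score2 : bounded_on_sphere (fun x => vmf_score mu k x ^+ 2).
Proof. exact: bounded_on_sphereX. Qed.

Lemma kappa_influence_var : \int[Q]_x (zeta x ^+ 2) = m ^- 2 * \int[Q]_x (vmf_score mu k x ^+ 2).
Proof.
rewrite -RintegralZl//; last exact: iv.
apply: (eq_Rintegral_vmf d2 QE).
- by apply: bounded_on_sphereX; exact: bounded_on_sphere_cut.
- exact: bounded_on_sphereM (bounded_on_sphere_cst d _) bounded_score2.
by move=> x Sx; rewrite sphere_cutE// /kappa_influence exprMn sqrrN exprVn.
Qed.

(** All observations lie on the sphere at once; being a countable intersection of almost sure
    events, this is almost sure. There the cut-offs disappear from the partial sums. *)
Let good (w : T) := forall i, sphere d (X i w).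

Let ae_good : {ae P, forall w, good w}.
Proof.
apply: ae_foralln => i; have mC := measurableC (@measurable_sphere R d).
exists (X i @^-1` ~` sphere d); split => //.
- by rewrite -[X in measurable X]setTI; exact: measurable_funP.
- by have := X_law i mC; rewrite (vmf_sphereC d2 QE).
Qed.

Let partial_sum_good g n w : good w ->
  partial_sum X (sphere_cut g) n w = \sum_(i < n) g (X i w).
Proof. by move=> Gw; apply: eq_bigr => i _; rewrite sphere_cutE. Qed.

Let h n w : 'cV[R]_d * 'M[R]_d :=
  (sample_mean n (X ^~ w) - A *: tcol mu, sample_moment2 n (X ^~ w) - S0).

Let mean_subr n (F : 'I_n -> R) (c : R) : (0 < n)%N ->
  n%:R^-1 * \sum_(i < n) F i - c = n%:R^-1 * \sum_(i < n) (F i - c).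
Proof.
move=> n0; rewrite sumrB sumr_const card_ord mulrBr -[c *+ n]mulr_natl mulrA mulVf ?mul1r//.
by rewrite pnatr_eq0 -lt0n.
Qed.

Let size_h n w : good w -> (0 < n)%N -> perturbation_size (h n w) ^+ 2 =
  n%:R ^- 2 * \sum_s partial_sum X (sphere_cut (f s)) n w ^+ 2.
Proof.
move=> Gw n0; rewrite perturbation_size_sqr big_sumType/= mulrDr !mulr_sumr.
congr (_ + _); apply: eq_bigr => s _; rewrite partial_sum_good//= -exprVn -exprMn -mean_subr//;
  by rewrite !mxE summxE; congr ((_ * _ - _) ^+ 2); apply: eq_bigr => l _; rewrite !mxE ?big_ord1 ?mxE.
Qed.

Let dotv_outer (u v : 'cV[R]_d) : dotv u (v *m v^T *m u) = dotv u v ^+ 2.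
Proof.
rewrite /dotv -mulmxA mulmxA [LHS]mxE big_ord1 expr2.
by congr (_ * _); exact: dotvC.
Qed.

(** One observation contributes (d - 1) (t - A) + k (t^2 - (1 - m)), which is minus the score
    because (d - 1) A = k m. *)
Let linear_h n w : good w -> (0 < n)%N ->
  ((d%:R - 1) * dotv (tcol mu) (h n w).1 + k * dotv (tcol mu) ((h n w).2 *m tcol mu)) / m =
  n%:R^-1 * partial_sum X zeta n w.
Proof.
move=> Gw n0.
have mu1' : dotv (tcol mu) (tcol mu) = 1 by rewrite dotv_tcol.
have dsum (F : 'I_n -> 'cV[R]_d) : dotv (tcol mu) (\sum_i F i) = \sum_i dotv (tcol mu) (F i).
  by rewrite /dotv mulmx_sumr summxE.
have -> : dotv (tcol mu) (h n w).1 = n%:R^-1 * \sum_(i < n) (tdot mu (X i w) - A).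
  rewrite /h/= dotvDr dotvNr !dotvZr mu1' mulr1 dsum -mean_subr//.
  by congr (_ * _ - _); apply: eq_bigr => i _; rewrite dotv_tcol.
have -> : dotv (tcol mu) ((h n w).2 *m tcol mu) =
    n%:R^-1 * \sum_(i < n) (tdot mu (X i w) ^+ 2 - (1 - m)).
  rewrite -mean_subr// /h/= mulmxBl dotvDr dotvNr; congr (_ - _); last first.
    have := vmf_moment2_mulmx d2 mu1 QE; rewrite mulmxBl mul1mx => /eqP.
    rewrite subr_eq addrC -subr_eq => /eqP <-.
    by rewrite dotvDr dotvNr dotvZr mu1' mulr1.
  rewrite /sample_moment2 -scalemxAl dotvZr mulmx_suml dsum; congr (_ * _).
  by apply: eq_bigr => i _; rewrite dotv_outer dotv_tcol.
rewrite partial_sum_good// !mulr_sumr -big_split/= mulr_suml; apply: eq_bigr => i _.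
rewrite /kappa_influence /vmf_score.
have -> : A = k * m / (d%:R - 1) by rewrite -Akm mulrAC mulfV ?mul1r// subr_eq0 pnatr_eq1 gtn_eqF.
field.
by rewrite gt_eqF// pnatr_eq0 -lt0n n0 subr_eq0 pnatr_eq1 gtn_eqF.
Qed.

Let f_bound : exists B : I -> R, forall s x, `|sphere_cut (f s) x| <= B s.
Proof.
have [B fB] := boolp.choice (fun s => sphere_cut_bounded (bounded_f s)).
by exists B.
Qed.

Let kappa_h n w : kappa_ST n (X ^~ w) = kappa_fun (A *: tcol mu + (h n w).1) (1%:M - S0 - (h n w).2).
Proof.
rewrite kappa_STE; congr kappa_fun; first by rewrite addrC subrK.
by rewrite /h/= opprB addrA subrK.
Qed.

Let near_sqrt_ge (c : R) : \forall n \near \oo, c <= Num.sqrt n%:R.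
Proof.
near=> n; rewrite (le_trans (ler_norm c))// -sqrtr_sqr ler_wsqrtr//.
by near: n; exact: nbhs_infty_ger.
Unshelve. all: by end_near. Qed.

(** The difference is at most sqrt n C eta^2, where eta^2 has mean K / n; Markov's inequality makes
    its probability of exceeding [dl] of order 1 / sqrt n. *)
Lemma kappa_ST_error_influence (dl : R) : 0 < dl ->
  fine (P [set w | dl < `|kappa_ST_error X k n w - partial_sum X zeta n w / Num.sqrt n%:R|])
    @[n --> \oo] --> (0 : R).
Proof.
move=> dl0.
have mz s := measurable_sphere_cut (bounded_f s).
have mzeta := measurable_sphere_cut bounded_influence.
have [B fB] := f_bound.
have M0T : (1%:M - S0)^T = 1%:M - S0 by rewrite linearB/= trmx1 vmf_moment2_tr.
have M0mu := vmf_moment2_mulmx d2 mu1 QE.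
have mu1' : dotv (tcol mu) (tcol mu) = 1 by rewrite dotv_tcol.
have [C [r [C0 r0 _ rem]]] := kappa_fun_expansion mu1' M0T M0mu A0 m0 Akm.
pose K : R := \sum_s \int[Q]_x (sphere_cut (f s) x ^+ 2).
have C1 : 0 < C + 1 by rewrite ltr_wpDl.
apply/cvgrPdist_le => e e0.
near=> n.
have n0 : (0 < n)%N by near: n; exact: nbhs_infty_gt.
(* [sr] keeps eta within the radius of the expansion off the Markov event, and [se] makes the Markov
   bound at most [e]. Using [C + 1] avoids a division by 0. *)
have sr : dl / (r ^+ 2 * (C + 1)) <= Num.sqrt n%:R by near: n; exact: near_sqrt_ge.
have se : K * (C + 1) / (dl * e) <= Num.sqrt n%:R by near: n; exact: near_sqrt_ge.
pose s : R := Num.sqrt n%:R.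
have s0 : 0 < s by rewrite sqrtr_gt0 ltr0n.
have s2 : n%:R = s ^+ 2 :> R by rewrite sqr_sqrtr.
(* The threshold for the sum of squares n^2 eta^2: below it, eta^2 <= dl / (s (C + 1)), so s C eta^2
   <= dl. *)
pose c : R := s ^+ 3 * dl / (C + 1).
have c0 : 0 < c by rewrite divr_gt0// mulr_gt0// exprn_gt0.
have mk := markov_partial_sums X_indep X_law mz fB f_mean n c0.
rewrite sub0r normrN ger0_norm ?fine_ge0//.
apply: (@le_trans _ _ (n%:R * K / c)); last first.
  rewrite s2 /c ler_pdivrMr//.
  rewrite ler_pdivrMr ?mulr_gt0// in se.
  rewrite (_ : e * _ = s ^+ 2 * (s * (dl * e)) / (C + 1)); last by field; rewrite gt_eqF.
  by rewrite ler_pdivlMr// -mulrA ler_wpM2l// exprn_ge0// ltW.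
apply: le_trans mk.
have mS : measurable_fun setT (fun w => `|kappa_ST_error X k n w - partial_sum X zeta n w / Num.sqrt n%:R|).
  apply: measurableT_comp => //; apply: measurable_funB => //.
  by apply: measurable_funM => //; exact: measurable_partial_sum.
apply: (fine_measure_le_ae _ _ ae_good).
- rewrite -[X in measurable X]setTI.
  rewrite (_ : _ `&` _ = setT `&` (fun w => `|kappa_ST_error X k n w
    - partial_sum X zeta n w / Num.sqrt n%:R|) @^-1` `]dl, +oo[%classic); first exact: mS.
  by rewrite !setTI; apply/seteqP; split=> w /=; rewrite in_itv/= andbT.
- rewrite (_ : [set w | _] = setT `&` (fun w => \sum_s partial_sum X (sphere_cut (f s)) n w ^+ 2)
    @^-1` `[c, +oo[%classic).
    exact: measurable_sum_partial_sum_sqr.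
  by rewrite !setTI; apply/seteqP; split=> w /=; rewrite in_itv/= andbT.
move=> w Gw /=; rewrite ltNge; apply: contraNle => qc.
have eta2 : perturbation_size (h n w) ^+ 2 <= dl / (s * (C + 1)).
  rewrite size_h// s2 mulrC -exprM ler_pdivrMr ?exprn_gt0//.
  by rewrite (le_trans (ltW qc))// le_eqVlt /c; apply/orP; left; apply/eqP; field; rewrite !gt_eqF.
have etar : perturbation_size (h n w) <= r.
  rewrite -(ler_pXn2r (n := 2))// ?nnegrE ?sqrtr_ge0//; last exact: ltW.
  apply: (le_trans eta2); rewrite ler_pdivrMr ?mulr_gt0//.
  by move: sr; rewrite ler_pdivrMr ?mulr_gt0 ?exprn_gt0// mulrCA.
have := rem _ etar; rewrite -kappa_h linear_h// /kappa_ST_error -/s => hrem.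
rewrite (_ : _ - _ = s * (kappa_ST n (X ^~ w) - k - n%:R^-1 * partial_sum X zeta n w)); last first.
  by rewrite s2; field; rewrite gt_eqF.
rewrite normrM (gtr0_norm s0) (le_trans (ler_wpM2l (ltW s0) hrem))//.
rewrite (le_trans (ler_wpM2l (ltW s0) (ler_wpM2l C0 eta2)))//.
rewrite [leLHS](_ : _ = C / (C + 1) * dl); last by field; rewrite !gt_eqF.
by rewrite ger_pMl// ler_pdivrMr// mul1r lerDl.
Unshelve. all: by end_near. Qed.

Lemma kappa_ST_clt (sg : R) : 0 < sg -> sg ^+ 2 = \int[Q]_x (zeta x ^+ 2) ->
  cvg_in_distribution (fun n => kappa_ST_error X k n : {RV P >-> R}) (normal_prob 0 sg).
Proof.
move=> sg0 sg2; have [B zB] := sphere_cut_bounded bounded_influence.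
apply: (clt_slutsky X_indep X_law sg0 (measurable_sphere_cut bounded_influence) zB) => //.
exact: kappa_ST_error_influence.
Qed.

End kappa_ST_asymptotics.

Theorem theorem3p1 (R : realType) (d : nat) (hd : (2 <= d)%N)
    (mu0 : d.-tuple R) (hmu0 : mu0 \in sphere d)
    (kappa0 : R) (hkappa0 : 0 < kappa0)
    (dT : measure_display) (T : measurableType dT) (P : probability T R)
    (X : nat -> {RV P >-> d.-tuple R})
    (X_indep : mutually_independent X)
    (X_vmf : forall i (A : set (d.-tuple R)), measurable A ->
      distribution P (X i) A = vmf mu0 kappa0 A) :
  let I0 := besselI (d%:R / 2 - 1) kappa0 in
  let I1 := besselI (d%:R / 2) kappa0 in
  let V := kappa0 * I0 * (2 * kappa0 * I0 - (d%:R + 1) * I1)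
           / ((d%:R - 1) * I1 ^+ 2) in
  cvg_in_distribution (fun n => kappa_ST_error X kappa0 n : {RV P >-> R})
    (normal_prob 0 (Num.sqrt V)).
Proof.
move=> I0 I1 V; pose Q : probability (d.-tuple R) R := distribution P (X 0).
have mu1 : tdot mu0 mu0 = 1 by move: hmu0; rewrite inE /sphere/= dotv_tcol.
have QE A : measurable A -> Q A = vmf mu0 kappa0 A by exact: X_vmf.
have X_law i A : measurable A -> P (X i @^-1` A) = Q A.
  by move=> mA; rewrite QE// -(X_vmf i).
pose m := vmf_tangent mu0 Q; pose w := \int[Q]_x (vmf_score mu0 kappa0 x ^+ 2).
have m0 : 0 < m := vmf_tangent_gt0 hd mu1 hkappa0 QE.
have w0 : 0 < w := vmf_score_variance_gt0 hd mu1 hkappa0 QE.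
have d1 : 0 < d%:R - 1 :> R by rewrite subr_gt0 ltr1n.
have mE : m = (d%:R - 1) * (I1 / I0) / kappa0.
  have := vmf_mean_tangent hd mu1 QE; rewrite (vmf_mean_bessel hd mu1 hkappa0 QE) => ->.
  by rewrite mulrC mulKf// gt_eqF.
have wE : w = 2 * (d%:R - 1) - (d%:R + 1) * m := vmf_score_variance hd mu1 QE.
(* Both Bessel values are nonzero because [m] is positive: if either were 0, the formula for [m],
   with 1/0 = 0, would give m = 0. *)
clearbody I0 I1; have /andP[I00 I10] : (I0 != 0) && (I1 != 0).
  rewrite -negb_or; apply: contraTN m0 => /orP[] /eqP I_eq0;
    by rewrite mE I_eq0 ?invr0 ?mulr0 mul0r ?mulr0 ?mul0r ltxx.
have VE : V = w / m ^+ 2.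
  rewrite wE mE /V; field.
  by rewrite I00 I10 (gt_eqF hkappa0) (gt_eqF d1).
have V0 : 0 < V by rewrite VE divr_gt0// exprn_gt0.
apply: (kappa_ST_clt hd mu1 hkappa0 QE X_indep X_law).
  by rewrite sqrtr_gt0.
rewrite sqr_sqrtr ?ltW// VE (kappa_influence_var hd QE) mulrC.
by [].
Qed.
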